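(* Let $\Sigma^+$ be a topologically transitive one-sided countable Markov shift with finite Gurevich entropy. Let $\phi$ be a $\theta$-weakly H\''older continuous SPR potential with $\sup\phi<\infty$, and let $m$ be the unique equilibrium measure of $\phi$. If $\beta>0$ and $e^{-\beta}\le\theta$, then there exists $C_{\theta,\beta}(\phi)>0$ such that for every $\psi\in\mathcal H_\beta$ and every $\mu\in\mathscr M(\Sigma^+)$, $$\Big|\int\psi\,d\mu-\int\psi\,dm\Big|\le C_{\theta,\beta}(\phi)\,\|\psi\|_\beta\sqrt{P_G(\phi)-P_\mu(\phi)}.$$
   Context: Let $\mathscr G$ be a countable directed graph with vertex set $S$. The one-sided TMS is $\Sigma^+=\{\underline x=(x_0,x_1,\dots)\in S^{\mathbb N\cup\{0\}}:x_i\to x_{i+1}\ \forall i\}$ with left shift $\sigma$ and metric $d(\underline x,\underline y)=e^{-t(\underline x,\underline y)}$, $t(\underline x,\underline y)=\min\{i:x_i\ne y_i\}$. Topologically transitive means $\mathscr G$ strongly connected; period $p$ is the gcd of loop lengths at a vertex; mixing means period 1. For period $p$, $\Sigma^+=\biguplus_{i<p}\Sigma_i^+$, $\Sigma_i^+=\{x_0\in S_i\}$ with $S_i$ the classes of ''$a=b$ or path from $a$ to $b$ of length divisible by $p$'', and $\sigma^p|_{\Sigma_0^+}$ is a mixing TMS. $\mathrm{osc}_n(\phi)=\sup\{|\phi(\underline x)-\phi(\underline y)|:x_i=y_i,i<n\}$; $\theta$-weakly H\''older: $\mathrm{osc}_n(\phi)\le A\theta^n$ for $n\ge2$. $\phi_n=\sum_{k<n}\phi\circ\sigma^k$.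 Mixing case: $Z_n(\phi,a)=\sum_{\sigma^n\underline x=\underline x}e^{\phi_n(\underline x)}1_{[a]}(\underline x)$, $P_G(\phi)=\lim\frac1n\log Z_n(\phi,a)$; period $p$: $P_G(\phi)=\frac1pP_G(\phi_p|_{\Sigma_0^+})$ for $\sigma^p$; Gurevich entropy $=P_G(0)$. $\mathscr M(\Sigma^+)$: shift-invariant Borel probabilities; $P_\mu(\phi)=h_\mu(\sigma)+\int\phi d\mu$; equilibrium measures maximize $P_\mu(\phi)$ (the maximum equals $P_G(\phi)$). SPR (mixing case, $\phi$ with summable variations and finite pressure): with $\tau_a(\underline x)=1_{[a]}(\underline x)\min\{n>0:x_n=a\}$, $Z^\ast_n(\phi,a)=\sum_{\sigma^n\underline x=\underline x}e^{\phi_n(\underline x)}1_{[\tau_a=n]}(\underline x)$, $\phi$ is SPR iff $\limsup\frac1n\log Z^\ast_n(\phi,a)<P_G(\phi)$ for some (every) state $a$ (equivalent to the paper's discriminant definition). Period $p$: $\phi$ SPR iff $\phi_p|_{\Sigma_0^+}$ SPR for $\sigma^p$. $\mathcal H_\beta=\{\psi:\|\psi\|_\beta:=\|\psi\|_\infty+\sup_{\underline x\ne\underline y}|\psi(\underline x)-\psi(\underline y)|e^{\beta t(\underline x,\underline y)}<\infty\}$. *)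

(* Defs.v *)
From HB Require Import structures.
From mathcomp Require Import all_boot all_order all_algebra.
From mathcomp Require Import all_classical all_reals all_analysis.
Set Implicit Arguments. Unset Strict Implicit. Unset Printing Implicit Defensive.
Import Order.TTheory GRing.Theory Num.Theory numFieldNormedType.Exports.
Local Open Scope classical_set_scope.
Local Open Scope ring_scope.

(* The space of sequences S^{N u {0}}; the point s0 only serves to give the type a
   (required) pointed structure. *)
Definition pseq (S : countType) (s0 : S) : Type := nat -> S.
Section CMS0.
Variables (S : countType) (s0 : S).
HB.instance Definition _ := Choice.on (@pseq S s0).
HB.instance Definition _ := isPointed.Build (@pseq S s0) (fun _ => s0).
Definition cyl_sets : set (set (@pseq S s0)) :=
  [set A | exists (n : nat) (w : nat -> S), A = [set x | forall i, (i < n)%N -> x i = w i]].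
End CMS0.
(* the Borel sigma-algebra of the product topology = sigma-algebra generated by cylinders *)
Notation seqT s0 := (g_sigma_algebraType (@cyl_sets _ s0)).

Section CMS.
Variable S : countType.
Variable edge : S -> S -> bool.

Definition Sigma : set (nat -> S) := [set x | forall i, edge (x i) (x i.+1)].
Definition shift (x : nat -> S) : nat -> S := fun n => x n.+1.

Definition path_len (a b : S) (n : nat) : Prop :=
  exists w : nat -> S, w 0%N = a /\ w n = b /\ forall i, (i < n)%N -> edge (w i) (w i.+1).

(* topological transitivity = strong connectivity *)
Definition strongly_connected : Prop := forall a b : S, exists n, path_len a b n.

Definition is_period (a : S) (p : nat) : Prop :=
  (0 < p)%N /\
  (forall n, (0 < n)%N -> path_len a a n -> (p %| n)%N) /\
  (forall d, (forall n, (0 < n)%N -> path_len a a n -> (d %| n)%N) -> (d %| p)%N).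

Variable R : realType.
Variable s0 : S.
Local Open Scope ereal_scope.

Definition birk (phi : (nat -> S) -> R) (n : nat) (x : nat -> S) : R :=
  (\sum_(k < n) phi (iter k shift x))%R.

Definition Zn (phi : (nat -> S) -> R) (a : S) (n : nat) : \bar R :=
  \esum_(x in [set x | Sigma x /\ iter n shift x = x /\ x 0%N = a]) (expR (birk phi n x))%:E.

Definition Zstar (phi : (nat -> S) -> R) (a : S) (n : nat) : \bar R :=
  \esum_(x in [set x | Sigma x /\ iter n shift x = x /\ x 0%N = a /\ x n = a /\
                       (forall i, (0 < i)%N -> (i < n)%N -> x i <> a)])
     (expR (birk phi n x))%:E.

(* Gurevich pressure, for period p, computed at state a of class S_0:
   P_G(phi) = (1/p) lim_n (1/n) log Z_n(phi_p, a) for sigma^p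
            = lim_n log Z_{pn}(phi,a) / (pn) *)
Definition PG (phi : (nat -> S) -> R) (p : nat) (a : S) : \bar R :=
  limn (fun n => lne (Zn phi a (p * n.+1)) * ((p * n.+1)%:R^-1)%:E).

(* SPR (via sigma^p on Sigma_0^+ when p > 1) *)
Definition SPR (phi : (nat -> S) -> R) (p : nat) (a : S) : Prop :=
  limn_esup (fun n => lne (Zstar phi a (p * n.+1)) * ((p * n.+1)%:R^-1)%:E)
    < PG phi p a.

Definition osc (phi : (nat -> S) -> R) (n : nat) : \bar R :=
  ereal_sup [set e | exists x y, Sigma x /\ Sigma y /\ (forall i, (i < n)%N -> x i = y i) /\
                     e = (`|phi x - phi y|)%:E].
Definition weakly_holder (theta : R) (phi : (nat -> S) -> R) : Prop :=
  exists A : R, forall n, (2 <= n)%N -> osc phi n <= (A * theta ^+ n)%:E.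

Definition first_diff (x y : nat -> S) (n : nat) : Prop :=
  x n <> y n /\ forall i, (i < n)%N -> x i = y i.

(* || psi ||_beta = ||psi||_oo + sup_{x<>y} |psi x - psi y| e^{beta t(x,y)}  (possibly +oo);
   psi \in H_beta  <->  hnorm beta psi < +oo *)
Definition hnorm (beta : R) (psi : (nat -> S) -> R) : \bar R :=
  ereal_sup [set e | exists x, Sigma x /\ e = (`|psi x|)%:E] +
  ereal_sup [set e | exists x y n, Sigma x /\ Sigma y /\ first_diff x y n /\
                     e = (`|psi x - psi y| * expR (beta * n%:R))%:E].

Definition invariant_prob (mu : probability (seqT s0) R) : Prop :=
  mu Sigma = 1 /\ forall A : set (seqT s0), measurable A -> mu (shift @^-1` A) = mu A.

(* Kolmogorov-Sinai entropy h_mu(sigma): sup over finite measurable partitions xi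
   (given as measurable maps f : Sigma -> 'I_k) of lim_n (1/n) H_mu(xi v ... v sigma^{-(n-1)} xi) *)
Definition is_fin_partition (k : nat) (f : seqT s0 -> 'I_k) : Prop :=
  forall i : 'I_k, measurable (f @^-1` [set i]).
Definition entf (t : R) : R := (- (t * ln t))%R.
Definition Hjoin (mu : probability (seqT s0) R) (k : nat) (f : seqT s0 -> 'I_k) (n : nat) : R :=
  (\sum_(w : {ffun 'I_n -> 'I_k})
      entf (fine (mu [set x | forall j : 'I_n, f (iter j shift x) = w j])))%R.
Definition hpart (mu : probability (seqT s0) R) (k : nat) (f : seqT s0 -> 'I_k) : R :=
  limn ((fun n : nat => (Hjoin mu f n.+1 / n.+1%:R)%R) : nat -> R).
Definition entropy (mu : probability (seqT s0) R) : \bar R :=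
  ereal_sup [set e | exists k (f : seqT s0 -> 'I_k), is_fin_partition f /\ e = (hpart mu f)%:E].

Definition Pmu (phi : (nat -> S) -> R) (mu : probability (seqT s0) R) : \bar R :=
  entropy mu + \int[mu]_(x in Sigma) (phi x)%:E.

Definition equilibrium (phi : (nat -> S) -> R) (m : probability (seqT s0) R) : Prop :=
  invariant_prob m /\ forall mu, invariant_prob mu -> Pmu phi mu <= Pmu phi m.
End CMS.

(* Main.v *)
Require Import Defs.
From HB Require Import structures.
From mathcomp Require Import all_boot all_order all_algebra.
From mathcomp Require Import all_classical all_reals all_analysis.
From mathcomp Require Import measurable_realfun.
From mathcomp Require Import ring lra zify.
Set Implicit Arguments. Unset Strict Implicit. Unset Printing Implicit Defensive.
Import Order.TTheory GRing.Theory Num.Theory numFieldNormedType.Exports.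
Local Open Scope classical_set_scope.
Local Open Scope ring_scope.

(* Fix a state a and work with loops at a.  Weighting first-return words by exp(phi_n - nP)
   and normalising by the Green function gives a probability kernel on the space of
   sequences starting at a, and strong positive recurrence gives it exponential moments in
   the return time.  A coupling contraction and an approximate Poisson equation then show
   that, for a normalised observable psi and small t, the loop sums of phi + t psi grow at
   a rate at most P_G(phi) + t l + K t^2, with l depending on psi but K only on phi.
   Entropy plus integral of a potential never exceeds the growth rate of its loop sums
   (compare the law of an itinerary, by the Gibbs inequality, with a law built from loop
   weights), so every invariant mu satisfies
   P_mu(phi) + t int psi dmu <= P_G(phi) + t l + K t^2.  Optimising over t gives
   |int psi dmu - l| <= C sqrt(P_G(phi) - P_mu(phi)).  Finally P_m(phi) = P_G(phi),
   because concatenating loops of a fixed length independently produces invariant measures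
   whose free energy is arbitrarily close to P_G(phi); hence int psi dm = l. *)

(** * Summation over discrete types *)

Section RealSums.
Variables (R : realType) (T : choiceType).
Implicit Types u v : T -> R.

Definition nsum u : \bar R := \esum_(i in [set: T]) (u i)%:E.
Definition rsummable u : Prop := (nsum (fun i => `|u i|%R) < +oo)%E.
Definition rsum u : R :=
  fine (nsum (fun i => Num.max (u i) 0)) - fine (nsum (fun i => Num.max (- u i) 0)).

Lemma nsum_ge0 u : (forall i, 0 <= u i) -> (0 <= nsum u)%E.
Proof. by move=> u0; apply: esum_ge0 => i _; rewrite lee_fin. Qed.

Lemma le_nsum u v : (forall i, u i <= v i) -> (nsum u <= nsum v)%E.
Proof. by move=> uv; apply: le_esum => i _; rewrite lee_fin. Qed.

Lemma nsum_ge_term u i : ((u i)%:E <= nsum u)%E.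
Proof.
apply: ereal_sup_ubound; exists [set i]; first by split => //; exact: finite_set1.
by rewrite fsbig_set1.
Qed.

Lemma nsumD u v : (forall i, 0 <= u i) -> (forall i, 0 <= v i) ->
  nsum (fun i => u i + v i) = (nsum u + nsum v)%E.
Proof.
move=> u0 v0; rewrite /nsum -esumD; last 2 first.
- by move=> i _; rewrite lee_fin.
- by move=> i _; rewrite lee_fin.
by apply: eq_esum => i _; rewrite EFinD.
Qed.

Lemma nsum0 : nsum (fun=> 0) = 0%E.
Proof. by apply: esum1. Qed.

Lemma nsum_fin u : (forall i, 0 <= u i) -> (nsum u < +oo)%E -> nsum u \is a fin_num.
Proof. by move=> u0 uoo; rewrite ge0_fin_numE // nsum_ge0. Qed.

Lemma max0_sub (r : R) : Num.max r 0 - Num.max (- r) 0 = r.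
Proof.
have [h|h] := leP r 0; last by rewrite max_r ?oppr_le0 ?ltW ?subr0.
by rewrite max_l ?oppr_ge0 // sub0r opprK.
Qed.

Lemma rsum_decomp u a b : (forall i, 0 <= a i) -> (forall i, 0 <= b i) ->
  (nsum a < +oo)%E -> (nsum b < +oo)%E -> (forall i, u i = a i - b i) ->
  rsum u = fine (nsum a) - fine (nsum b).
Proof.
move=> a0 b0 aoo boo uab.
pose p i := Num.max (u i) 0; pose n i := Num.max (- u i) 0.
have p0 i : 0 <= p i by rewrite /p le_max lexx orbT.
have n0 i : 0 <= n i by rewrite /n le_max lexx orbT.
have poo : (nsum p < +oo)%E.
  apply: le_lt_trans aoo; apply: le_nsum => i; rewrite /p uab ge_max a0 andbT.
  by rewrite lerBlDr lerDl.
have noo : (nsum n < +oo)%E.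
  apply: le_lt_trans boo; apply: le_nsum => i; rewrite /n uab ge_max b0 andbT.
  by rewrite opprB lerBlDr lerDl.
have e : (nsum p + nsum b = nsum n + nsum a)%E.
  rewrite -!nsumD //; congr nsum; apply/funext => i.
  by have := max0_sub (u i); rewrite -/(p i) -/(n i) uab; lra.
rewrite /rsum -/p -/n.
have fp := nsum_fin p0 poo; have fn := nsum_fin n0 noo.
have fa := nsum_fin a0 aoo; have fb := nsum_fin b0 boo.
have := congr1 fine e; rewrite !fineD // => ?; lra.
Qed.

Lemma rsum_nneg u : (forall i, 0 <= u i) -> rsummable u -> (rsum u)%:E = nsum u.
Proof.
move=> u0 su; have uoo : (nsum u < +oo)%E.
  by apply: le_lt_trans su; apply: le_nsum => i; rewrite ler_norm.
rewrite (@rsum_decomp u u (fun=> 0)) //; last 2 first.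
- by rewrite nsum0 ltry.
- by move=> i; rewrite subr0.
by rewrite nsum0 subr0 fineK // nsum_fin.
Qed.

Lemma nsum_rsummable u : (forall i, 0 <= u i) -> (nsum u < +oo)%E -> rsummable u.
Proof.
move=> u0; rewrite /rsummable; congr (nsum _ < _)%E.
by apply/funext => i; rewrite ger0_norm.
Qed.

Lemma rsummable_le u v : (forall i, `|u i| <= v i) -> rsummable v -> rsummable u.
Proof.
move=> uv; apply: le_lt_trans; apply: le_nsum => i.
by rewrite (le_trans (uv i)) // ler_norm.
Qed.

Lemma rsummableD u v : rsummable u -> rsummable v -> rsummable (fun i => u i + v i).
Proof.
move=> su sv; apply: (@le_lt_trans _ _ (nsum (fun i => `|u i| + `|v i|)%R)).
  by apply: le_nsum => i; rewrite ler_normD.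
by rewrite nsumD // lte_add_pinfty.
Qed.

Lemma rsummableN u : rsummable u -> rsummable (fun i => - u i).
Proof.
rewrite /rsummable; congr (nsum _ < _)%E.
by apply/funext => i; rewrite normrN.
Qed.

Lemma nsumZ c u : 0 <= c -> (forall i, 0 <= u i) ->
  nsum (fun i => c * u i) = (c%:E * nsum u)%E.
Proof.
rewrite le_eqVlt => /predU1P[<-|c0] u0.
  by rewrite mul0e -[RHS]nsum0; congr nsum; apply/funext => i; rewrite mul0r.
have key (d : R) (w : T -> R) : 0 < d -> (forall i, 0 <= w i) -> (nsum (fun i => d * w i)%R <= d%:E * nsum w)%E.
  move=> d0 w0; apply: ge_ereal_sup => _ [X [fX _] <-].
  rewrite fsbig_finite //=.
  under eq_bigr do rewrite EFinM.
  rewrite -ge0_sume_distrr; last by move=> i _; rewrite lee_fin.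
  rewrite lee_pmul2l ?lte_fin // -fsbig_finite //.
  by apply: ereal_sup_ubound; exists X.
apply/eqP; rewrite eq_le key //=.
have := @key c^-1 (fun i => c * u i).
rewrite invr_gt0 => /(_ c0); have c'0 i : 0 <= c * u i by rewrite mulr_ge0 // ltW.
move=> /(_ c'0) H.
have -> : nsum u = nsum (fun i => c^-1 * (c * u i)).
  by congr nsum; apply/funext => i; rewrite mulKf // gt_eqF.
by rewrite -lee_pdivlMl.
Qed.

Lemma rsummableZ c u : rsummable u -> rsummable (fun i => c * u i).
Proof.
move=> su; rewrite /rsummable.
rewrite (_ : (fun i => _) = (fun i => `|c| * `|u i|)); last first.
  by apply/funext => i; rewrite normrM.
rewrite nsumZ //.
have := nsum_fin (fun i => normr_ge0 (u i)) su => /fineK <-.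
by rewrite -EFinM ltry.
Qed.

Lemma esum_ge0_mul (I : set T) (c : R) (F : T -> \bar R) : 0 <= c ->
  (forall i, I i -> (0 <= F i)%E) ->
  (\esum_(i in I) (c%:E * F i) = c%:E * \esum_(i in I) F i)%E.
Proof.
rewrite le_eqVlt => /predU1P[<-|c0] F0.
  by rewrite mul0e; apply: esum1 => i _; rewrite mul0e.
have key (d : R) (G : T -> \bar R) : 0 < d -> (forall i, I i -> (0 <= G i)%E) ->
    (\esum_(i in I) (d%:E * G i) <= d%:E * \esum_(i in I) G i)%E.
  move=> d0 G0; apply: ge_ereal_sup => _ [X [fX XI] <-].
  rewrite fsbig_finite //= big_seq.
  rewrite -ge0_sume_distrr; last first.
    by move=> i iX; apply: G0; apply: XI; move: iX; rewrite in_fset_set // inE.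
  rewrite -big_seq lee_pmul2l ?lte_fin // -fsbig_finite //.
  by apply: ereal_sup_ubound; exists X.
apply/eqP; rewrite eq_le key //= -lee_pdivlMl //.
have -> : (\esum_(i in I) F i = \esum_(i in I) (c^-1%:E * (c%:E * F i)))%E.
  by apply: eq_esum => i _; rewrite muleA -EFinM mulVf ?mul1e // gt_eqF.
apply: key; rewrite ?invr_gt0 // => i Ii.
by rewrite mule_ge0 ?F0 // lee_fin ltW.
Qed.

Lemma nsum_mul_le u (L : \bar R) : (forall i, 0 <= u i) -> (0 <= L)%E ->
  (nsum u * L <= \esum_(i in [set: T]) ((u i)%:E * L))%E.
Proof.
move=> u0; case: L => [r|_|//].
  rewrite lee_fin => r0; rewrite muleC -nsumZ //; apply: le_nsum => i.
  by rewrite mulrC.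
have [->|[i ui]] : nsum u = 0%E \/ exists i, 0 < u i.
- have [[i ui]|H] := pselect (exists i, 0 < u i); first by right; exists i.
  left; apply: esum1 => i _; congr EFin; apply/eqP; rewrite eq_le u0 andbT leNgt.
  by apply/negP => h; apply: H; exists i.
- by rewrite mul0e; apply: esum_ge0 => i _; rewrite mule_ge0 // lee_fin.
rewrite (@le_trans _ _ +oo%E) ?leey //.
apply: (@le_trans _ _ ((u i)%:E * +oo)%E); first by rewrite gt0_muley ?lte_fin.
apply: ereal_sup_ubound; exists [set i]; first by split => //; exact: finite_set1.
by rewrite fsbig_set1.
Qed.

Lemma rsumE u : rsummable u ->
  exists a b, [/\ forall i, 0 <= a i, forall i, 0 <= b i,
    (nsum a < +oo)%E, (nsum b < +oo)%E & forall i, u i = a i - b i].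
Proof.
move=> su; exists (fun i => Num.max (u i) 0), (fun i => Num.max (- u i) 0); split.
- by move=> i; rewrite le_max lexx orbT.
- by move=> i; rewrite le_max lexx orbT.
- apply: le_lt_trans su; apply: le_nsum => i; rewrite ge_max normr_ge0 andbT.
  exact: ler_norm.
- apply: le_lt_trans su; apply: le_nsum => i; rewrite ge_max normr_ge0 andbT.
  by rewrite -normrN ler_norm.
- by move=> i; rewrite max0_sub.
Qed.

Lemma rsumD u v : rsummable u -> rsummable v ->
  rsum (fun i => u i + v i) = rsum u + rsum v.
Proof.
move=> /rsumE[a [b [a0 b0 aoo boo uab]]] /rsumE[c [d [c0 d0 coo doo vcd]]].
rewrite (rsum_decomp a0 b0 aoo boo uab) (rsum_decomp c0 d0 coo doo vcd).
rewrite (@rsum_decomp _ (fun i => a i + c i) (fun i => b i + d i)).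
- by rewrite !nsumD // !fineD ?nsum_fin //; lra.
- by move=> i; rewrite addr_ge0.
- by move=> i; rewrite addr_ge0.
- by rewrite nsumD // lte_add_pinfty.
- by rewrite nsumD // lte_add_pinfty.
- by move=> i; rewrite uab vcd; lra.
Qed.

Lemma rsumN u : rsummable u -> rsum (fun i => - u i) = - rsum u.
Proof.
move=> /rsumE[a [b [a0 b0 aoo boo uab]]].
rewrite (rsum_decomp a0 b0 aoo boo uab) (@rsum_decomp _ b a) //.
  by rewrite opprB.
by move=> i; rewrite uab opprB.
Qed.

Lemma rsumB u v : rsummable u -> rsummable v ->
  rsum (fun i => u i - v i) = rsum u - rsum v.
Proof. by move=> su sv; rewrite rsumD ?rsumN //; exact: rsummableN. Qed.

Lemma rsum_ge0 u : (forall i, 0 <= u i) -> rsummable u -> 0 <= rsum u.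
Proof. by move=> u0 su; rewrite -lee_fin rsum_nneg // nsum_ge0. Qed.

Lemma ler_rsum u v : rsummable u -> rsummable v -> (forall i, u i <= v i) ->
  rsum u <= rsum v.
Proof.
move=> su sv uv; rewrite -subr_ge0 -rsumB //; apply: rsum_ge0.
  by move=> i; rewrite subr_ge0.
by apply: rsummableD => //; exact: rsummableN.
Qed.

Lemma rsumZ c u : rsummable u -> rsum (fun i => c * u i) = c * rsum u.
Proof.
have key d (w : T -> R) : 0 <= d -> rsummable w -> rsum (fun i => d * w i) = d * rsum w.
  move=> d0 /rsumE[a [b [a0 b0 aoo boo uab]]].
  have fa : nsum a \is a fin_num by exact: nsum_fin.
  have fb : nsum b \is a fin_num by exact: nsum_fin.
  rewrite (rsum_decomp a0 b0 aoo boo uab).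
  rewrite (@rsum_decomp _ (fun i => d * a i) (fun i => d * b i)).
  - by rewrite !nsumZ // !fineM //=; lra.
  - by move=> i; rewrite mulr_ge0.
  - by move=> i; rewrite mulr_ge0.
  - by rewrite nsumZ // -(fineK fa) -EFinM ltry.
  - by rewrite nsumZ // -(fineK fb) -EFinM ltry.
  - by move=> i; rewrite uab; lra.
move=> su; have [c0|c0] := leP 0 c; first exact: key.
rewrite -[c in RHS]opprK mulNr -key //; last by lra.
rewrite -rsumN; last exact: rsummableZ.
by congr rsum; apply/funext => i; lra.
Qed.

Lemma rsum_norm u : rsummable u -> `|rsum u| <= rsum (fun i => `|u i|).
Proof.
move=> su; have su' : rsummable (fun i => `|u i|).
  by move: su; rewrite /rsummable; under [X in nsum X]eq_fun do rewrite -normr_id.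
rewrite ler_norml -rsumN //; apply/andP; split; apply: ler_rsum => //.
- exact: rsummableN.
- by move=> i; rewrite lerNl -normrN ler_norm.
- by move=> i; exact: ler_norm.
Qed.

End RealSums.

(** * A quadratic exponential-moment bound for contracting kernels *)

Section ExpBounds.
Variable R : realType.
Implicit Types u z A B : R.

Lemma ge_1BexpRN u : 0 <= u -> u / (1 + u) <= 1 - expR (- u).
Proof.
move=> u0; have p : 0 < 1 + u by lra.
have h : expR (- u) <= (1 + u)^-1.
  by rewrite expRN lef_pV2 ?posrE ?expR_gt0 // expR_ge1Dx.
have -> : u / (1 + u) = 1 - (1 + u)^-1 by field; lra.
lra.
Qed.

Lemma le_1BexpRN u : 1 - expR (- u) <= u.
Proof. have := expR_ge1Dx (- u); lra. Qed.

Lemma expRB1_le u : expR u - 1 <= u * expR u.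
Proof.
have h := le_1BexpRN u; have p := expR_gt0 u.
have : expR u * expR (- u) = 1 by rewrite -expRD subrr expR0.
nra.
Qed.

Lemma sqr_le_expR z : 0 <= z -> z ^+ 2 <= 4 * expR z.
Proof.
move=> z0; have h := expR_ge1Dx (z / 2).
have -> : expR z = expR (z / 2) ^+ 2 by rewrite expr2 -expRD; congr expR; lra.
rewrite !expr2; nra.
Qed.

Lemma expR_taylor2 z : expR z <= 1 + z + z ^+ 2 * expR `|z|.
Proof.
have key (y : R) : 0 <= y -> expR y <= 1 + y + y ^+ 2 * expR y.
  move=> y0; have h1 := expRB1_le y; have h := expR_gt0 y.
  have : y * (expR y - 1) <= y * (y * expR y) by rewrite ler_wpM2l.
  rewrite expr2; lra.
have [z0|z0] := leP 0 z; first by rewrite ger0_norm // key.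
rewrite ltr0_norm //.
have h1 := le_1BexpRN (- z); have h2 := expR_ge1Dx (-z).
have h3 := expR_gt0 (- z); have h4 := expR_gt0 z.
have e : expR z * expR (- z) = 1 by rewrite -expRD subrr expR0.
suff : expR z <= 1 + z + z ^+ 2 by rewrite expr2; nra.
have : expR z <= (1 - z)^-1.
  by rewrite -[z]opprK expRN lef_pV2 ?posrE ?expR_gt0 // ?opprK //; lra.
move/le_trans; apply; rewrite -[leLHS]mul1r ler_pdivrMr; last lra.
rewrite expr2; nra.
Qed.

Lemma contraction_factor A B : 0 < A -> A < B ->
  exists2 c : R, 0 < c < 1 &
    forall z, 0 < z <= 1 -> 1 - expR (- (A * z)) <= c * (1 - expR (- (B * z))).
Proof.
move=> A0 AB; pose x := expR (- A) * (B - A) / ((1 + B - A) * A).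
have e0 := expR_gt0 (- A).
have x0 : 0 < x by rewrite /x divr_gt0 ?mulr_gt0 //; lra.
have c0 : 0 < (1 + x)^-1 by rewrite invr_gt0; lra.
exists (1 + x)^-1.
  by rewrite c0 /= invf_lt1; lra.
move=> z /andP[z0 z1]; rewrite [leRHS]mulrC ler_pdivlMr; last lra.
have -> : expR (- (B * z)) = expR (- (A * z)) * expR (- ((B - A) * z)).
  by rewrite -expRD; congr expR; lra.
have h1 := le_1BexpRN (A * z).
have u0 : 0 <= (B - A) * z by apply: mulr_ge0; lra.
have h2 := ge_1BexpRN u0.
have h3 : (B - A) * z / (1 + (B - A)) <= (B - A) * z / (1 + (B - A) * z).
  rewrite ler_wpM2l // lef_pV2 ?posrE; [nra|nra|nra].
have h4 : expR (- A) <= expR (- (A * z)) by rewrite ler_expR; nra.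
have h5 : x * (A * z) = expR (- A) * ((B - A) * z / (1 + (B - A))).
  by rewrite /x; field; rewrite ?gt_eqF //; lra.
have h6 : 0 <= (B - A) * z / (1 + (B - A)) by apply: divr_ge0; lra.
have h7 : x * (1 - expR (- (A * z))) <= x * (A * z) by rewrite ler_pM2l.
have h8 : expR (- A) * ((B - A) * z / (1 + (B - A))) <=
   expR (- (A * z)) * (1 - expR (- ((B - A) * z))) by apply: ler_pM; lra.
lra.
Qed.

End ExpBounds.

Section Kernel.
Variables (R : realType) (X : Type) (W : choiceType).
Variables (gl : W -> X -> X) (agr : nat -> X -> X -> Prop) (len : W -> nat).
Variables th eps D M C0 : R.
Hypothesis agr1 : forall x y, agr 1 x y.
Hypothesis agrS : forall n w x y, agr n x y -> agr n.+1 (gl w x) (gl w y).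
Hypothesis agr_sym : forall n x y, agr n x y -> agr n y x.
Hypothesis th01 : 0 < th < 1.
Hypothesis eps0 : 0 < eps.
Hypothesis len_gt0 : forall w, (0 < len w)%N.

Let th0 : 0 < th. Proof. by case/andP: th01. Qed.
Let th1 : th < 1. Proof. by case/andP: th01. Qed.
Let lenR w : 1 <= (len w)%:R :> R. Proof. by rewrite ler1n len_gt0. Qed.
Let wt w : R := expR (eps * (len w)%:R).

Definition kernel (q : W -> X -> R) : Prop :=
  [/\ forall w x, 0 <= q w x,
      forall x, rsummable (fun w => q w x * wt w) /\ rsum (fun w => q w x * wt w) <= M,
      forall x, rsum (fun w => q w x) = 1 &
      forall n w x y, (0 < n)%N -> agr n x y -> q w x <= q w y * expR (D * th ^+ n)].

Let wt1 w : 1 <= wt w.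
Proof. by rewrite /wt -expR0 ler_expR mulr_ge0 // ltW. Qed.

Lemma len_le_wt w : (len w)%:R <= eps^-1 * wt w.
Proof.
rewrite ler_pdivlMl // /wt; have := expR_ge1Dx (eps * (len w)%:R); lra.
Qed.

Section FixedKernel.
Variable q : W -> X -> R.
Hypothesis Kq : kernel q.

Let q0 w x : 0 <= q w x. Proof. by case: Kq. Qed.

Definition av (x : X) (v : W -> R) : R := rsum (fun w => q w x * v w).
Definition adm (v : W -> R) : Prop := exists c, forall w, `|v w| <= c * wt w.

Lemma adm_cst c : adm (fun=> c).
Proof. by exists `|c| => w; rewrite ler_peMr. Qed.

Lemma adm_bd c v : (forall w, `|v w| <= c) -> adm v.
Proof.
move=> h; exists `|c| => w; apply: (le_trans (h w)).
by rewrite (le_trans (ler_norm c)) // ler_peMr.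
Qed.

Lemma adm_len : adm (fun w => (len w)%:R).
Proof. by exists eps^-1 => w; rewrite ger0_norm // len_le_wt. Qed.

Lemma admD u v : adm u -> adm v -> adm (fun w => u w + v w).
Proof.
move=> [c hc] [d hd]; exists (c + d) => w.
by rewrite (le_trans (ler_normD _ _)) // mulrDl lerD.
Qed.

Lemma admZ k v : adm v -> adm (fun w => k * v w).
Proof.
move=> [c hc]; exists (`|k| * c) => w.
by rewrite normrM -mulrA ler_wpM2l.
Qed.

Lemma adm_le u v : (forall w, `|u w| <= v w) -> adm v -> adm u.
Proof.
by move=> uv [c hc]; exists c => w; rewrite (le_trans (uv w)) // (le_trans _ (hc w)) // ler_norm.
Qed.

Lemma av_summable x v : adm v -> rsummable (fun w => q w x * v w).
Proof.
move=> [c hc]; case: Kq => _ /(_ x)[sq _] _ _.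
apply: (@rsummable_le _ _ _ (fun w => c * (q w x * wt w))); last exact: rsummableZ.
move=> w; rewrite normrM ger0_norm //.
by rewrite mulrCA ler_wpM2l.
Qed.

Lemma avD x u v : adm u -> adm v -> av x (fun w => u w + v w) = av x u + av x v.
Proof.
move=> au av'; rewrite /av -rsumD; try exact: av_summable.
by congr rsum; apply/funext => w; rewrite mulrDr.
Qed.

Lemma avZ x k v : adm v -> av x (fun w => k * v w) = k * av x v.
Proof.
move=> av'; rewrite /av -rsumZ; try exact: av_summable.
by congr rsum; apply/funext => w; rewrite mulrCA.
Qed.

Lemma avB x u v : adm u -> adm v -> av x (fun w => u w - v w) = av x u - av x v.
Proof.
move=> au av'; rewrite (_ : (fun w => _) = (fun w => u w + (-1) * v w)).
  by rewrite avD ?avZ ?mulN1r //; exact: admZ.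
by apply/funext => w; rewrite mulN1r.
Qed.

Lemma av_cst x c : av x (fun=> c) = c.
Proof.
rewrite (_ : (fun=> c) = (fun w : W => c * 1)); last by apply/funext => w; rewrite mulr1.
rewrite avZ; last exact: adm_cst.
rewrite /av (_ : rsum _ = 1) ?mulr1 //; case: Kq => _ _ /(_ x) h _.
by rewrite -[RHS]h; congr rsum; apply/funext => w; rewrite mulr1.
Qed.

Lemma le_av x u v : adm u -> adm v -> (forall w, u w <= v w) -> av x u <= av x v.
Proof.
move=> au av' uv; apply: ler_rsum; try exact: av_summable.
by move=> w; rewrite ler_wpM2l.
Qed.

Lemma norm_av x v : adm v -> `|av x v| <= av x (fun w => `|v w|).
Proof.
move=> av'; rewrite /av (le_trans (rsum_norm _)) //; first exact: av_summable.
rewrite le_eqVlt; apply/orP; left; apply/eqP; congr rsum.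
by apply/funext => w; rewrite normrM (ger0_norm (q0 w x)).
Qed.

Lemma norm_av_le x v c : (forall w, `|v w| <= c) -> `|av x v| <= c.
Proof.
move=> h; rewrite (le_trans (norm_av _ _)) //; first exact: adm_bd h.
rewrite -[leRHS](av_cst x) le_av //; last exact: adm_cst.
by apply: (@adm_bd c) => w; rewrite normr_id.
Qed.

Hypothesis D0 : 0 < D.
Variable B : R.
Hypothesis BE : B * th = B - 2 * D.
Definition sep_gap n := 1 - expR (- (B * th ^+ n)).
Definition gap_holder N (r : X -> R) := forall n x y, (0 < n)%N -> agr n x y ->
  `|r x - r y| <= N * sep_gap n.
Definition avgl (r : X -> R) x := av x (fun w => r (gl w x)).

Let B0 : 0 < B. Proof.
have t1 : 0 < 1 - th by rewrite subr_gt0.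
rewrite -(pmulr_lgt0 _ t1) (_ : B * (1 - th) = 2 * D) ?mulr_gt0 //.
by rewrite mulrBr mulr1 BE; ring.
Qed.

Let thn0 n : 0 < th ^+ n. Proof. exact: exprn_gt0. Qed.
Let thn1 n : th ^+ n <= 1. Proof. by rewrite exprn_ile1 // ltW. Qed.

Lemma sep_gap_le1 n : sep_gap n <= 1.
Proof. by rewrite lerBlDr lerDl expR_ge0. Qed.

Lemma expn_le_sep_gap n : th ^+ n <= (1 + B) / B * sep_gap n.
Proof.
rewrite mulrAC ler_pdivlMr // /sep_gap; have b0 := B0.
have u0 : 0 <= B * th ^+ n by rewrite mulr_ge0 // ltW.
have h1 := ge_1BexpRN u0.
have h2 : B * th ^+ n / (1 + B) <= B * th ^+ n / (1 + B * th ^+ n).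
  rewrite ler_wpM2l // lef_pV2 ?posrE; [|lra|lra].
  by rewrite lerD2l ler_piMr // ltW.
have := le_trans h2 h1; rewrite ler_pdivrMr; last lra.
by rewrite [_ * B]mulrC [(1 + B) * _]mulrC.
Qed.

Lemma gap_holder_osc N r : 0 <= N -> gap_holder N r -> forall x y, `|r x - r y| <= N.
Proof.
move=> N0 H x y; rewrite (le_trans (H 1%N x y isT (agr1 x y))) //.
by rewrite ler_piMr // sep_gap_le1.
Qed.

Lemma adm_comp_gl N r (x : X) : 0 <= N -> gap_holder N r ->
  exists c, forall y w, `|r (gl w y)| <= c.
Proof.
move=> N0 H; exists (`|r x| + N) => y w.
rewrite -[r (gl w y)](subrK (r x)) addrC (le_trans (ler_normD _ _)) // lerD2l.
exact: gap_holder_osc.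
Qed.

Variable c : R.
Hypothesis c01 : 0 < c < 1.
Hypothesis cP : forall z, 0 < z <= 1 ->
  1 - expR (- ((B - D) * z)) <= c * (1 - expR (- (B * z))).

(* Doeblin coupling: the kernels at x and y share the mass exp(-D th^n); on the shared
   part the images agree one step longer, on the rest the oscillation of r is at most N. *)
Lemma avgl_contract N r : 0 <= N -> gap_holder N r -> gap_holder (c * N) (avgl r).
Proof.
move=> N0 H.
suff half n x y : (0 < n)%N -> agr n x y -> avgl r x - avgl r y <= c * N * sep_gap n.
  move=> n x y n0 xy; rewrite ler_norml half // andbT lerNl opprB half //.
  exact: agr_sym.
move=> n0 xy; pose m := avgl r y; pose e := expR (- (D * th ^+ n)).
have e0 : 0 < e by exact: expR_gt0.
have [b hb] := adm_comp_gl x N0 H.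
have admr z z' : adm (fun w => r (gl w z) + z') by apply: admD; [exact: adm_bd (hb z)|exact: adm_cst].
have admr0 z : adm (fun w => r (gl w z)) by exact: adm_bd (hb z).
have rm w : r (gl w x) <= m + N.
  rewrite -(av_cst y (r (gl w x))) /m -(av_cst y N) -avD //; last exact: adm_cst.
  apply: le_av => //; first exact: adm_cst.
  move=> w'; have := gap_holder_osc N0 H (gl w x) (gl w' y); rewrite ler_norml; lra.
have rr w : r (gl w x) <= r (gl w y) + N * sep_gap n.+1.
  have := H n.+1 _ _ isT (agrS w xy); rewrite ler_norml; lra.
have qq w : e * q w y <= q w x.
  case: Kq => _ _ _ /(_ n w y x n0 (agr_sym xy)) h.
  have -> : q w x = e * (q w x * expR (D * th ^+ n)).
    by rewrite mulrCA -expRD addNr expR0 mulr1.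
  by rewrite ler_pM2l.
have : avgl r x <= rsum (fun w => (m + N) * (q w x * 1) +
    ((- (e * (m + N)) + e * (N * sep_gap n.+1)) * (q w y * 1) + e * (q w y * r (gl w y)))).
  apply: ler_rsum.
  - exact: av_summable.
  - apply: rsummableD; first by apply: rsummableZ; apply: av_summable; exact: adm_cst.
    apply: rsummableD; first by apply: rsummableZ; apply: av_summable; exact: adm_cst.
    by apply: rsummableZ; exact: av_summable.
  - move=> w; have h1 := rm w; have h2 := rr w; have h3 := qq w; have h4 := q0 w y.
    have h5 : (q w x - e * q w y) * r (gl w x) <= (q w x - e * q w y) * (m + N).
      by rewrite ler_wpM2l // subr_ge0.
    have h6 : e * q w y * r (gl w x) <= e * q w y * (r (gl w y) + N * sep_gap n.+1).
      by rewrite ler_wpM2l // mulr_ge0 // ltW.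
    lra.
have s1 z : rsummable (fun w => q w z * 1) by apply: av_summable; exact: adm_cst.
have s2 z : rsummable (fun w => q w z * r (gl w z)) by exact: av_summable.
rewrite rsumD; [|exact: rsummableZ|by apply: rsummableD; exact: rsummableZ].
rewrite rsumD; [|exact: rsummableZ|exact: rsummableZ].
rewrite !rsumZ //.
have -> : rsum (fun w => q w x * 1) = 1 by exact: av_cst.
have -> : rsum (fun w => q w y * 1) = 1 by exact: av_cst.
have -> : rsum (fun w => q w y * r (gl w y)) = m by [].
move=> h.
have h2 : 1 - e + e * sep_gap n.+1 <= c * sep_gap n.
  have := cP (z := th ^+ n); rewrite thn0 thn1 => /(_ isT); apply: le_trans.
  rewrite /sep_gap /e mulrBr -expRD mulr1.
  have -> : - (D * th ^+ n) - B * th ^+ n.+1 = - ((B - D) * th ^+ n).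
    rewrite exprS; have -> : B * (th * th ^+ n) = (B * th) * th ^+ n by ring.
    rewrite BE; ring.
  lra.
have : N * (1 - e + e * sep_gap n.+1) <= N * (c * sep_gap n) by rewrite ler_wpM2l.
rewrite -/m; lra.
Qed.

Lemma iter_avgl_holder N r k : 0 <= N -> gap_holder N r ->
  gap_holder (c ^+ k * N) (iter k avgl r).
Proof.
move=> N0 H; elim: k => [|k IH] /=; first by rewrite expr0 mul1r.
rewrite exprS -mulrA; apply: avgl_contract => //.
by rewrite mulr_ge0 // exprn_ge0 // ltW //; case/andP: c01.
Qed.

End FixedKernel.

Hypothesis D0 : 0 < D.
Hypothesis C00 : 0 <= C0.
Hypothesis M0 : 0 <= M.

Section Averages.
Variables (B c : R).
Hypothesis BE : B * th = B - 2 * D.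
Hypothesis c01 : 0 < c < 1.
Hypothesis cP : forall z, 0 < z <= 1 ->
  1 - expR (- ((B - D) * z)) <= c * (1 - expR (- (B * z))).
Variable q : W -> X -> R.
Hypothesis Kq : kernel q.

Let q0 w x : 0 <= q w x. Proof. by case: Kq. Qed.

Let N1 := (C0 + D * expR D * (eps^-1 * M)) * ((1 + B) / B).

Lemma gap_holder_ge0 N r (x : X) : 0 < B -> gap_holder B N r -> 0 <= N.
Proof.
move=> B0 H; have := H 1%N x x isT (agr1 x x); rewrite subrr normr0.
by rewrite pmulr_lge0 // /sep_gap subr_gt0 -expR0 ltr_expR oppr_lt0 mulr_gt0.
Qed.

Lemma av_gap_holder (v : W -> X -> R) : 0 < B ->
  (forall w x, `|v w x| <= (len w)%:R) ->
  (forall n w x y, (0 < n)%N -> agr n x y -> `|v w x - v w y| <= C0 * th ^+ n) ->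
  gap_holder B N1 (fun x => av q x (v ^~ x)).
Proof.
move=> B0 vl vh n x y n0 xy; have tn0 : 0 < th ^+ n by exact: exprn_gt0.
have tn1 : th ^+ n <= 1 by rewrite exprn_ile1 // ltW.
have av1 z : adm (v ^~ z) by apply: (@adm_le _ (fun w => (len w)%:R)) (adm_len).
have -> : av q x (v ^~ x) - av q y (v ^~ y) =
   av q x (fun w => v w x - v w y) + (av q x (v ^~ y) - av q y (v ^~ y)).
  by rewrite (avB Kq) //; ring.
have h1 : `|av q x (fun w => v w x - v w y)| <= C0 * th ^+ n.
  by apply: (norm_av_le Kq) => w; exact: vh.
have h2 : `|av q x (v ^~ y) - av q y (v ^~ y)| <= D * expR D * (eps^-1 * M) * th ^+ n.
  rewrite /av -rsumB; try exact: (av_summable Kq).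
  set u := D * th ^+ n.
  have u0 : 0 < u by rewrite mulr_gt0.
  have uD : u <= D by rewrite ler_piMr // ltW.
  have su : rsummable (fun w => (expR u - 1) * (q w y * (len w)%:R)).
    by apply: rsummableZ; apply: (av_summable Kq); exact: adm_len.
  have sb : rsummable (fun w => q w x * v w y - q w y * v w y).
    by apply: rsummableD; [|apply: rsummableN]; exact: (av_summable Kq).
  apply: (le_trans (rsum_norm sb)).
  have pw w : `|q w x * v w y - q w y * v w y| <= (expR u - 1) * (q w y * (len w)%:R).
    rewrite -mulrBl normrM mulrA ler_pM //.
    case: Kq => _ _ _ Kr.
    have h3 := Kr n w x y n0 xy; have h4 := Kr n w y x n0 (agr_sym xy).
    rewrite -/u in h3 h4.
    have e1 := expR_gt0 (- u); have e2 : 1 < expR u by rewrite -expR0 ltr_expR.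
    have e3 : expR u * expR (- u) = 1 by rewrite -expRD subrr expR0.
    have h5 : q w y * expR (- u) <= q w x.
      have := ler_wpM2r (ltW e1) h4; by rewrite -mulrA e3 mulr1.
    have h6 : q w y * (2 - expR u) <= q w y * expR (- u).
      rewrite ler_wpM2l //; have := expR_ge1Dx (- u); have := expR_ge1Dx u; nra.
    by rewrite ler_norml; lra.
  apply: (@le_trans _ _ ((expR u - 1) * rsum (fun w => q w y * (len w)%:R))).
    rewrite -rsumZ; last by apply: (av_summable Kq); exact: adm_len.
    apply: ler_rsum => //; apply: rsummable_le su => w.
    by rewrite normr_id pw.
  have h7 : rsum (fun w => q w y * (len w)%:R) <= eps^-1 * M.
    case: Kq => _ /(_ y)[s1 s2] _ _.
    apply: (@le_trans _ _ (eps^-1 * rsum (fun w => q w y * wt w))).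
      rewrite -rsumZ //; apply: ler_rsum; last first.
      - by move=> w; rewrite mulrCA ler_wpM2l // len_le_wt.
      - exact: rsummableZ.
      - by apply: (av_summable Kq); exact: adm_len.
    by rewrite ler_wpM2l // invr_ge0 ltW.
  have h8 : expR u - 1 <= D * expR D * th ^+ n.
    apply: (le_trans (expRB1_le u)); rewrite /u mulrAC ler_wpM2r ?(ltW tn0) //.
    by rewrite ler_wpM2l ?(ltW D0) // ler_expR.
  have h9 : 0 <= expR u - 1 by rewrite subr_ge0 -expR0 ler_expR ltW.
  rewrite mulrAC.
  apply: ler_pM => //; apply: rsum_ge0; last by apply: (av_summable Kq); exact: adm_len.
  by move=> w; rewrite mulr_ge0.
apply: (le_trans (ler_normD _ _)); apply: (le_trans (lerD h1 h2)).
rewrite -mulrDl /N1 -[leRHS]mulrA ler_wpM2l //.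
  rewrite addr_ge0 // !mulr_ge0 ?invr_ge0 ?expR_ge0 //; exact: ltW.
exact: expn_le_sep_gap.
Qed.

Lemma avgl_bounds r a b x : (forall y, a <= r y <= b) -> a <= avgl q r x <= b.
Proof.
move=> h.
have A : adm (fun w => r (gl w x)).
  apply: (@adm_bd (`|a| + `|b|)) => w; have /andP[h1 h2] := h (gl w x).
  have := ler_norm b; have := ler_norm (- a); rewrite normrN ler_norml.
  have := normr_ge0 a; have := normr_ge0 b; lra.
apply/andP; split.
  rewrite -[leLHS](av_cst Kq x a) (le_av Kq) //; first exact: adm_cst.
  by move=> w; case/andP: (h (gl w x)).
rewrite -[leRHS](av_cst Kq x b) (le_av Kq) //; first exact: adm_cst.
by move=> w; case/andP: (h (gl w x)).
Qed.

Lemma iter_avgl_bounds r a b k : (forall y, a <= r y <= b) ->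
  forall x, a <= iter k (avgl q) r x <= b.
Proof. by move=> h; elim: k => // k IH x /=; exact: avgl_bounds. Qed.

Lemma avgl_small N r k x : 0 <= N -> gap_holder B N r ->
  iter k (avgl q) r x = 0 -> forall y, `|r y| <= N.
Proof.
move=> N0 H e y.
have B0 : 0 < B.
  have t1 : 0 < 1 - th by rewrite subr_gt0.
  rewrite -(pmulr_lgt0 _ t1) (_ : B * (1 - th) = 2 * D) ?mulr_gt0 //.
  by rewrite mulrBr mulr1 BE; ring.
have := @iter_avgl_bounds r (r y - N) (r y + N) k _ x.
rewrite e ler_norml => h.
have : r y - N <= 0 <= r y + N; last by lra.
apply: h => z; have := gap_holder_osc N0 H z y; rewrite ler_norml; lra.
Qed.

Variable Psi : W -> X -> R.
Hypothesis Psi_len : forall w x, `|Psi w x| <= (len w)%:R.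
Hypothesis Psi_holder : forall n w x y, (0 < n)%N -> agr n x y ->
  `|Psi w x - Psi w y| <= C0 * th ^+ n.
Variable x0 : X.

Let c0 : 0 < c. Proof. by case/andP: c01. Qed.
Let c1 : c < 1. Proof. by case/andP: c01. Qed.

(* An approximate solution u of the Poisson equation u - E u = f for the centred
   observable f; the finite Neumann sum of length J leaves the remainder E^J f. *)
Lemma approx_poisson e : 0 < e -> exists (l : R) (u : X -> R),
  [/\ `|l| <= 1, forall x, `|u x| <= 2 * N1 / (1 - c) &
      forall x, `|av q x (fun w => Psi w x - l * (len w)%:R + (u (gl w x) - u x))| <= e].
Proof.
move=> e0; have cc0 := c0; have cc1 := c1; have d0 := D0.
have B0 : 0 < B.
  have t1 : 0 < 1 - th by rewrite subr_gt0.
  rewrite -(pmulr_lgt0 _ t1) (_ : B * (1 - th) = 2 * D) ?mulr_gt0 //.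
  by rewrite mulrBr mulr1 BE; ring.
have aPsi x : adm (Psi ^~ x) by apply: (@adm_le _ (fun w => (len w)%:R)) (adm_len).
have alen : adm (fun w => (len w)%:R) by exact: adm_len.
pose f1 x := av q x (Psi ^~ x); pose f2 x := av q x (fun w => (len w)%:R).
have H1 : gap_holder B N1 f1 by exact: av_gap_holder.
have H2 : gap_holder B N1 f2.
  apply: (@av_gap_holder (fun w _ => (len w)%:R)) => //; first by move=> w x; rewrite ger0_norm.
  move=> n w x y n0 _; rewrite subrr normr0 mulr_ge0 // exprn_ge0 // ltW //.
have N0 : 0 <= N1 by exact: (gap_holder_ge0 x0 B0 H1).
have adm_gl N r x : 0 <= N -> gap_holder B N r -> adm (fun w => r (gl w x)).
  move=> N0' Hr; have [b hb] := adm_comp_gl x N0' Hr; exact: adm_bd (hb x).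
have cN k : 0 <= c ^+ k * N1 by rewrite mulr_ge0 // exprn_ge0 // ltW.
have I1 k : gap_holder B (c ^+ k * N1) (iter k (avgl q) f1).
  by apply: (iter_avgl_holder Kq BE c01 cP).
have I2 k : gap_holder B (c ^+ k * N1) (iter k (avgl q) f2).
  by apply: (iter_avgl_holder Kq BE c01 cP).
have f21 k x : 1 <= iter k (avgl q) f2 x.
  elim: k x => [|k IH] x /=.
    rewrite -[leLHS](av_cst Kq x 1) /f2; apply: (le_av Kq) => //; exact: adm_cst.
  rewrite -[leLHS](av_cst Kq x 1); apply: (le_av Kq) => //; first exact: adm_cst.
  exact: adm_gl (I2 k).
have f12 k x : `|iter k (avgl q) f1 x| <= iter k (avgl q) f2 x.
  elim: k x => [|k IH] x /=.
    apply: (le_trans (norm_av Kq _ (aPsi x))); apply: (le_av Kq) => //.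
    by apply: (@adm_le _ (fun w => (len w)%:R)) => // w; rewrite normr_id.
  apply: (le_trans (norm_av Kq _ (adm_gl _ _ _ (cN k) (I1 k)))).
  apply: (le_av Kq) => //; last exact: adm_gl (I2 k).
  apply: (@adm_le _ (fun w => iter k (avgl q) f2 (gl w x))); last exact: adm_gl (I2 k).
  by move=> w; rewrite normr_id.
have [J HJ] : exists J, c ^+ J * (2 * N1) <= e.
  have : c ^+ n @[n --> \oo] --> 0 by apply: cvg_expr; rewrite ger0_norm // ltW.
  move=> /cvgrPdist_le /(_ (e / (2 * N1 + 1))).
  have d1 : 0 < e / (2 * N1 + 1) by rewrite divr_gt0 //; lra.
  move=> /(_ d1)[J _ /(_ J (leqnn J))]; rewrite sub0r normrN => h; exists J.
  have h2 := le_trans (ler_norm _) h.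
  have : c ^+ J * (2 * N1 + 1) <= e by rewrite -ler_pdivlMr //; lra.
  have : 0 <= c ^+ J by rewrite exprn_ge0 // ltW.
  nra.
pose l := iter J (avgl q) f1 x0 / iter J (avgl q) f2 x0.
have l1 : `|l| <= 1.
  have p := f21 J x0; have pp : 0 < iter J (avgl q) f2 x0 by lra.
  by rewrite /l normrM normfV (gtr0_norm pp) ler_pdivrMr // mul1r.
pose f x := f1 x - l * f2 x.
have fk k : iter k (avgl q) f = fun x => iter k (avgl q) f1 x - l * iter k (avgl q) f2 x.
  elim: k => // k IH; apply/funext => x /=; rewrite IH /avgl (avB Kq); last 2 first.
  - exact: adm_gl (I1 k).
  - by apply: admZ; exact: adm_gl (I2 k).
  by rewrite (avZ Kq) //; exact: adm_gl (I2 k).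
have F k : gap_holder B (c ^+ k * (2 * N1)) (iter k (avgl q) f).
  move=> n x y n0 xy; rewrite fk.
  have h1 := I1 k n x y n0 xy; have h2 := I2 k n x y n0 xy.
  set a1 := iter k _ f1 x in h1 *; set b1 := iter k _ f1 y in h1 *.
  set a2 := iter k _ f2 x in h2 *; set b2 := iter k _ f2 y in h2 *.
  have -> : a1 - l * a2 - (b1 - l * b2) = (a1 - b1) - l * (a2 - b2) by ring.
  apply: (le_trans (ler_normB _ _)); rewrite normrM.
  have : `|l| * `|a2 - b2| <= 1 * (c ^+ k * N1 * sep_gap B n) by rewrite ler_pM.
  lra.
have N20 k : 0 <= c ^+ k * (2 * N1) by have := cN k; lra.
have fJ : iter J (avgl q) f x0 = 0.
  rewrite fk /l divfK ?subrr // gt_eqF //; have := f21 J x0; lra.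
have fb j x : (j <= J)%N -> `|iter j (avgl q) f x| <= c ^+ j * (2 * N1).
  move=> jJ; apply: (@avgl_small _ _ (J - j) x0 (N20 j) (F j)) => //.
  by rewrite -iterD subnK.
pose u k x := \sum_(j < k) iter j (avgl q) f x.
have ub k x : (k <= J)%N -> `|u k x| <= 2 * N1 / (1 - c).
  move=> kJ; suff H : `|u k x| <= 2 * N1 / (1 - c) * (1 - c ^+ k).
    apply: (le_trans H); rewrite ler_piMr //.
      by apply: divr_ge0; lra.
    by rewrite lerBlDr lerDl exprn_ge0 // ltW.
  elim: k kJ => [|k IH] kJ; first by rewrite /u big_ord0 normr0 expr0 subrr mulr0.
  rewrite /u big_ord_recr /= (le_trans (ler_normD _ _)) //.
  have h1 := IH (ltnW kJ); have h2 := fb k x (ltnW kJ).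
  apply: (le_trans (lerD h1 h2)); rewrite le_eqVlt; apply/orP; left; apply/eqP.
  rewrite exprS; field; lra.
have uadm k x : (k <= J)%N -> adm (fun w => u k (gl w x)).
  by move=> kJ; apply: adm_bd => w; exact: (ub k (gl w x) kJ).
have Eu k x : (k <= J)%N -> avgl q (u k) x = u k x - f x + iter k (avgl q) f x.
  elim: k => [|k IH] kJ.
    rewrite /avgl /u; under eq_fun do rewrite big_ord0.
    by rewrite (av_cst Kq) big_ord0 /=; ring.
  rewrite /avgl; under [X in av q x X]eq_fun do rewrite /u big_ord_recr /=.
  rewrite (avD Kq); last 2 first.
  - exact: (uadm k x (ltnW kJ)).
  - exact: adm_gl (F k).
  rewrite -/(avgl q (u k) x) IH ?(ltnW kJ) // /u big_ord_recr /= /avgl; ring.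
exists l, (u J); split => //; first by move=> x; exact: ub.
move=> x.
have aY : adm (fun w => Psi w x - l * (len w)%:R).
  by apply: admD => //; under eq_fun do rewrite -mulNr; exact: admZ.
rewrite (avD Kq) //; last first.
  by apply: admD; [exact: uadm|exact: adm_cst].
rewrite (avB Kq) //; last exact: admZ.
rewrite (avZ Kq) // (avB Kq); last 2 first.
- exact: uadm.
- exact: adm_cst.
rewrite (av_cst Kq) -/(avgl q (u J) x) Eu // -/(f1 x) -/(f2 x) -/(f x).
have -> : f x + (u J x - f x + iter J (avgl q) f x - u J x) = iter J (avgl q) f x by ring.
exact: le_trans (fb J x (leqnn J)) HJ.
Qed.

End Averages.

Lemma kernel_exp_moment : exists e1 K b : R, [/\ 0 < e1, e1 <= 1, 0 < K &
  forall q, kernel q -> X -> forall Psi : W -> X -> R,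
  (forall w x, `|Psi w x| <= (len w)%:R) ->
  (forall n w x y, (0 < n)%N -> agr n x y -> `|Psi w x - Psi w y| <= C0 * th ^+ n) ->
  forall e, 0 < e -> exists (l : R) (u : X -> R),
  [/\ `|l| <= 1, forall x, `|u x| <= b &
   forall t x, `|t| <= e1 ->
   adm (fun w => expR (t * (Psi w x - l * (len w)%:R + (u (gl w x) - u x)))) /\
   av q x (fun w => expR (t * (Psi w x - l * (len w)%:R + (u (gl w x) - u x))))
     <= expR (K * t ^+ 2 + e)]].
Proof.
have th1' := th1; have d0 := D0; have ep0 := eps0; pose B := 2 * D / (1 - th).
have BE : B * th = B - 2 * D by rewrite /B; field; lra.
have t1 : 0 < 1 - th by rewrite subr_gt0.
have dt := mulr_gt0 D0 th0.
have DB : D < B by rewrite /B ltr_pdivlMr //; lra.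
have [||c c01 cP] := @contraction_factor R (B - D) B; [by rewrite subr_gt0|by lra|].
have c1 : c < 1 by case/andP: c01.
pose b := 2 * ((C0 + D * expR D * (eps^-1 * M)) * ((1 + B) / B)) / (1 - c).
have b0 : 0 <= b.
  rewrite /b; apply: divr_ge0; last lra.
  rewrite mulr_ge0 // mulr_ge0 //; last by apply: divr_ge0; lra.
  by rewrite addr_ge0 // !mulr_ge0 ?invr_ge0 ?expR_ge0 //; exact: ltW.
pose k := 2 + 2 * b.
have k0 : 0 < k by rewrite /k; lra.
pose e1 := Num.min 1 (eps / (2 * k)).
have e10 : 0 < e1 by rewrite lt_min ltr01 divr_gt0 // mulr_gt0.
pose K := 16 * k ^+ 2 / eps ^+ 2 * M + 1.
have K0 : 0 < K.
  have : 0 <= 16 * k ^+ 2 / eps ^+ 2 * M.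
    by rewrite mulr_ge0 // divr_ge0 ?exprn_ge0 // ?mulr_ge0 ?exprn_ge0 // ltW.
  by rewrite /K; lra.
exists e1, K, b; split => //; first by rewrite ge_min lexx.
move=> q Kq x0 Psi Psi_len Psi_holder e e0.
have [l [u [l1 ub Hav]]] := approx_poisson BE c01 cP Kq Psi_len Psi_holder x0 e0.
rewrite -/b in ub; exists l, u; split => // t x te.
pose Y w := Psi w x - l * (len w)%:R + (u (gl w x) - u x).
have aY : adm Y.
  apply: admD; last first.
    apply: (@adm_bd (b + b)) => w; apply: (le_trans (ler_normB _ _)); exact: lerD.
  apply: admD; first by apply: (@adm_le _ (fun w => (len w)%:R)) (adm_len).
  by under eq_fun do rewrite -mulNr; apply: admZ; exact: adm_len.
have Yk w : `|Y w| <= k * (len w)%:R.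
  have h1 := Psi_len w x; have h2 := lenR w; have h3 := ub (gl w x); have h4 := ub x.
  apply: (le_trans (ler_normD _ _)); have h5 := ler_normB (u (gl w x)) (u x).
  have h6 := ler_normB (Psi w x) (l * (len w)%:R).
  rewrite normrM (ger0_norm (ler0n _ _)) in h6.
  have h7 : `|l| * (len w)%:R <= (len w)%:R by rewrite ler_piMl.
  have h8 : b <= b * (len w)%:R by rewrite ler_peMr.
  by rewrite /k; lra.
have tY w : `|t * Y w| <= eps * (len w)%:R / 2.
  rewrite normrM; apply: (@le_trans _ _ (eps / (2 * k) * (k * (len w)%:R))).
    by rewrite ler_pM // (le_trans te) // ge_min lexx orbT.
  rewrite le_eqVlt; apply/orP; left; apply/eqP; field; lra.
pose K1 := 16 * k ^+ 2 / eps ^+ 2.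
have quad w : expR (t * Y w) <= 1 + t * Y w + t ^+ 2 * K1 * wt w.
  apply: (le_trans (expR_taylor2 _)); rewrite lerD2l exprMn -[leLHS]mulrA -[leRHS]mulrA ler_wpM2l ?sqr_ge0 //.
  have z0 : 0 <= eps * (len w)%:R / 2 by rewrite divr_ge0 // mulr_ge0 // ltW.
  have h1 := sqr_le_expR z0; set z := eps * (len w)%:R / 2 in h1 z0 tY *.
  have -> : wt w = expR z * expR z by rewrite -expRD; congr expR; rewrite /z; field.
  have h2 : expR `|t * Y w| <= expR z by rewrite ler_expR /z.
  have h3 : Y w ^+ 2 <= (4 * k ^+ 2 / eps ^+ 2) * z ^+ 2.
    rewrite -real_normK ?num_real //.
    have -> : 4 * k ^+ 2 / eps ^+ 2 * z ^+ 2 = (k * (len w)%:R) ^+ 2.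
      by rewrite /z; field; lra.
    by rewrite lerXn2r // nnegrE ?mulr_ge0 // ltW.
  rewrite mulrA; apply: ler_pM => //; rewrite ?sqr_ge0 ?expR_ge0 //.
  apply: (le_trans h3).
  have -> : K1 * expR z = 4 * k ^+ 2 / eps ^+ 2 * (4 * expR z) by rewrite /K1; ring.
  rewrite ler_wpM2l // divr_ge0 ?mulr_ge0 ?exprn_ge0 //; exact: ltW.
have awt : adm wt by exists 1 => w; rewrite mul1r ger0_norm // expR_ge0.
have aE : adm (fun w => expR (t * Y w)).
  exists 1 => w; rewrite mul1r ger0_norm ?expR_ge0 // ler_expR.
  apply: (le_trans (ler_norm _)); apply: (le_trans (tY w)).
  by have := lenR w; nra.
split => //.
apply: (@le_trans _ _ (av q x (fun w => 1 + t * Y w + t ^+ 2 * K1 * wt w))).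
  apply: (le_av Kq) => //; apply: admD; last exact: admZ.
  by apply: admD; [exact: adm_cst|exact: admZ].
rewrite (avD Kq); [|by apply: admD; [exact: adm_cst|exact: admZ]|exact: admZ].
rewrite (avD Kq) ?(avZ Kq) ?(av_cst Kq) //; [|exact: adm_cst|exact: admZ].
have h1 : av q x wt <= M by case: Kq => _ /(_ x)[].
have h2 : t * av q x Y <= e.
  apply: (le_trans (ler_norm _)); rewrite normrM -[leRHS]mul1r ler_pM //.
  by rewrite (le_trans te) // ge_min lexx.
have h3 : t ^+ 2 * K1 * av q x wt <= t ^+ 2 * K1 * M.
  rewrite ler_wpM2l // mulr_ge0 ?sqr_ge0 // /K1 divr_ge0 ?mulr_ge0 ?exprn_ge0 //; exact: ltW.
have h4 := expR_ge1Dx (K * t ^+ 2 + e).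
have h5 := sqr_ge0 t.
rewrite -/K1 in h4; apply: le_trans h4; rewrite /K -/K1.
lra.
Qed.

End Kernel.

(** * Words and loops *)

Section Words.
Variables (S : countType) (edge : S -> S -> bool) (R : realType) (a : S).
Implicit Types (x y z : nat -> S) (v w : seq S) (f : (nat -> S) -> R).

Definition agree n x y : Prop := forall i, (i < n)%N -> x i = y i.
Definition glue v x : nat -> S := fun i => if (i < size v)%N then nth (x 0%N) v i else x (i - size v)%N.

Lemma iter_shiftE k x i : iter k (@Defs.shift S) x i = x (k + i)%N.
Proof. by elim: k i => // k IH i; rewrite iterS /Defs.shift IH addSnnS. Qed.

Lemma Sigma_iter_shift k x : Sigma edge x -> Sigma edge (iter k (@Defs.shift S) x).
Proof. by move=> h i; rewrite !iter_shiftE addnS; exact: h. Qed.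

Lemma agree_sym n x y : agree n x y -> agree n y x.
Proof. by move=> h i /h ->. Qed.

Lemma agree_le m n x y : (m <= n)%N -> agree n x y -> agree m x y.
Proof. by move=> mn h i im; apply: h; exact: leq_trans im mn. Qed.

Lemma agree_shift k n x y : agree (k + n) x y ->
  agree n (iter k (@Defs.shift S) x) (iter k (@Defs.shift S) y).
Proof. by move=> h i ni; rewrite !iter_shiftE; apply: h; rewrite ltn_add2l. Qed.

Lemma glueE v x s i : (i < size v)%N -> glue v x i = nth s v i.
Proof. by rewrite /glue => h; rewrite h; exact: set_nth_default. Qed.

Lemma glueEr v x i : glue v x (size v + i)%N = x i.
Proof. by rewrite /glue ltnNge leq_addr /= addKn. Qed.

Lemma iter_shift_glue v x : iter (size v) (@Defs.shift S) (glue v x) = x.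
Proof. by apply/funext => i; rewrite iter_shiftE glueEr. Qed.

Lemma glue_cat v w x : glue (v ++ w) x = glue v (glue w x).
Proof.
apply/funext => i; rewrite /glue size_cat.
have [iv|vi] := ltnP i (size v).
  by rewrite (leq_trans iv) ?leq_addr // nth_cat iv; exact: set_nth_default.
by rewrite nth_cat (ltnNge i (size v)) vi /= ltn_subLR // subnDA.
Qed.

Lemma glue_agree v x y n : agree n x y -> agree (size v + n) (glue v x) (glue v y).
Proof.
move=> h i; rewrite /glue; have [iv _|vi] := ltnP i (size v); first exact: set_nth_default.
by move=> ivn; apply: h; rewrite ltn_subLR.
Qed.

Lemma glue0 v x : glue v x 0%N = head (x 0%N) v.
Proof. by case: v => [|b v] //=; rewrite /glue. Qed.

Lemma glue_Sigma v x : sorted edge (rcons v (x 0%N)) -> Sigma edge x -> Sigma edge (glue v x).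
Proof.
move=> /(sortedP (x 0%N)) h hx i; rewrite size_rcons in h.
have [iv|vi] := ltnP i (size v).
  have := h i; rewrite ltnS => /(_ iv).
  rewrite nth_rcons iv nth_rcons /glue iv.
  have [//|] := ltnP i.+1 (size v).
  by rewrite leq_eqVlt ltnS leqNgt iv orbF => /eqP e; rewrite e eqxx subnn.
by rewrite /glue ltnNge vi /= ltnNge (leqW vi) /= subSn.
Qed.

Definition isloop v : bool := sorted edge (rcons v a) && (head a v == a).
Definition isfirst v : bool := [&& v != [::], isloop v & a \notin behead v].

Lemma isloop_nil : isloop [::]. Proof. by rewrite /isloop /= eqxx. Qed.

Lemma isloop_cat v w : isloop v -> isloop w -> isloop (v ++ w).
Proof.
rewrite /isloop => /andP[v1 v2] /andP[w1 w2]; rewrite rcons_cat.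
case: w w1 w2 => [|b w] /=; first by rewrite !cats0 => _ _; rewrite cats1 v1.
move=> w1 /eqP ba; subst b; rewrite sorted_cat_cons v1 w1 /=.
by case: v {v1} v2 => //=; rewrite eqxx.
Qed.

Lemma isloop_glue v x : isloop v -> Sigma edge x /\ x 0%N = a ->
  Sigma edge (glue v x) /\ glue v x 0%N = a.
Proof.
move=> /andP[v1 /eqP v2] [h e]; split; first by apply: glue_Sigma; rewrite ?e.
by rewrite glue0 e.
Qed.

Lemma last_split v : a \in v -> exists v1 v2, v = v1 ++ a :: v2 /\ a \notin v2.
Proof.
elim: v => // b v IH; rewrite inE; case: (boolP (a \in v)) => [av _|av].
  by have [v1 [v2 [-> h]]] := IH av; exists (b :: v1), v2.
by rewrite orbF => /eqP <-; exists [::], v.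
Qed.

Lemma isloop_split v : isloop v -> v != [::] ->
  exists v1 w, [/\ isloop v1, isfirst w & v = v1 ++ w].
Proof.
move=> /andP[v1 v2] v0; have av : a \in v.
  by case: v v0 v2 {v1} => //= b v _ /eqP ->; rewrite inE eqxx.
have [u [w [e aw]]] := last_split av; exists u, (a :: w).
move: v1 v2; rewrite e rcons_cat sorted_cat_cons => /andP[h1 h2] h3; split => //.
  by rewrite /isloop h1 /=; move: h3; case: (u).
by apply/and3P; split => //; apply/andP; split; [exact: h2|rewrite /= eqxx].
Qed.

Lemma split_inj v1 w1 v2 w2 : isfirst w1 -> isfirst w2 -> v1 ++ w1 = v2 ++ w2 ->
  v1 = v2 /\ w1 = w2.
Proof.
have hd w : isfirst w -> exists2 t, w = a :: t & a \notin t.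
  by case: w => // b t /and3P[_ /andP[_ /= /eqP ->] h]; exists t.
move=> /hd[t1 -> n1] /hd[t2 -> n2] e.
have ix v t : a \notin t -> index a (rev (v ++ a :: t)) = size t.
  move=> n; rewrite rev_cat rev_cons cat_rcons index_cat mem_rev (negbTE n).
  by rewrite size_rev /= eqxx addn0.
have st : size t1 = size t2 by rewrite -(ix v1 _ n1) -(ix v2 _ n2) e.
have sv : size v1 = size v2.
  by have := congr1 size e; rewrite !size_cat /= st => /addIn.
by move/eqP: e; rewrite eqseq_cat // => /andP[/eqP -> /eqP ->].
Qed.

Lemma birkS f n x : birk f n.+1 x = f x + birk f n (Defs.shift x).
Proof.
by rewrite /birk big_ord_recl; congr (_ + _); apply: eq_bigr => i _; rewrite -iterSr.
Qed.

Lemma birkD f n m x : birk f (n + m) x = birk f n x + birk f m (iter n (@Defs.shift S) x).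
Proof.
rewrite /birk big_split_ord /=; congr (_ + _).
by apply: eq_bigr => i _; rewrite addnC iterD.
Qed.

Lemma birk_glue_cat f v w x :
  birk f (size (v ++ w)) (glue (v ++ w) x) =
  birk f (size v) (glue v (glue w x)) + birk f (size w) (glue w x).
Proof. by rewrite size_cat birkD glue_cat iter_shift_glue. Qed.

Definition var_holder (A th : R) f : Prop := forall n x y, (2 <= n)%N ->
  Sigma edge x -> Sigma edge y -> agree n x y -> `|f x - f y| <= A * th ^+ n.

Lemma birk_distortion A th f : 0 < th < 1 -> 0 <= A -> var_holder A th f ->
  forall n l x y, (0 < l)%N -> Sigma edge x -> Sigma edge y -> agree (n + l) x y ->
  `|birk f n x - birk f n y| <= A / (1 - th) * th ^+ l.
Proof.
move=> /andP[th0 th1] A0 H n l x y l0 sx sy xy; have t1 : 0 < 1 - th by lra.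
suff h : `|birk f n x - birk f n y| <= A / (1 - th) * th ^+ l * (th * (1 - th ^+ n)).
  apply: (le_trans h); rewrite ler_piMr //.
    by rewrite mulr_ge0 ?divr_ge0 ?exprn_ge0 // ltW.
  have : 0 <= th ^+ n by rewrite exprn_ge0 // ltW.
  nra.
elim: n x y sx sy xy => [|n IH] x y sx sy xy.
  by rewrite /birk !big_ord0 subrr normr0 expr0 subrr !mulr0.
rewrite !birkS.
have -> : f x + birk f n (Defs.shift x) - (f y + birk f n (Defs.shift y)) =
  (f x - f y) + (birk f n (Defs.shift x) - birk f n (Defs.shift y)) by ring.
apply: (le_trans (ler_normD _ _)).
have h1 : `|f x - f y| <= A * th ^+ (n.+1 + l).
  by apply: H => //; lia.
have h2 := IH _ _ (Sigma_iter_shift 1 sx) (Sigma_iter_shift 1 sy) (@agree_shift 1 (n + l) _ _ xy).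
apply: (le_trans (lerD h1 h2)).
rewrite exprD exprS le_eqVlt; apply/orP; left; apply/eqP; field; lra.
Qed.

Lemma weakly_holderP th f : 0 < th -> weakly_holder edge th f ->
  exists2 A : R, 0 < A & var_holder A th f.
Proof.
move=> th0 [A0 H]; exists (Num.max A0 1); first by rewrite lt_max ltr01 orbT.
move=> n x y n2 sx sy xy.
have h : ((`|f x - f y|)%:E <= osc edge f n)%E.
  by apply: ereal_sup_ubound; exists x, y.
have := le_trans h (H n n2); rewrite lee_fin => /le_trans; apply.
by rewrite ler_pM2r ?exprn_gt0 // le_max lexx.
Qed.

Lemma var_holderD A B th (f g : (nat -> S) -> R) t : var_holder A th f -> var_holder B th g ->
  var_holder (A + `|t| * B) th (fun x => f x + t * g x).
Proof.
move=> H1 H2 n x y n2 sx sy xy.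
have -> : f x + t * g x - (f y + t * g y) = (f x - f y) + t * (g x - g y) by ring.
apply: (le_trans (ler_normD _ _)); rewrite mulrDl lerD //; first exact: H1.
by rewrite normrM -mulrA ler_wpM2l //; exact: H2.
Qed.

End Words.

Section WordSums.
Variables (S : countType) (edge : S -> S -> bool) (R : realType) (a : S).
Implicit Types (x y : nat -> S) (v w : seq S) (f : (nat -> S) -> R).
Notation isloop := (isloop edge a).
Notation isfirst := (isfirst edge a).

Lemma nsum_cond (T : choiceType) (P : pred T) (F : T -> R) :
  nsum (fun u => if P u then F u else 0) = (\esum_(u in [set u | P u]) (F u)%:E)%E.
Proof.
rewrite [RHS]esum_mkcond; apply: eq_esum => u _.
by case: (boolP (P u)) => h; [rewrite mem_set|rewrite memNset //; apply/negP].
Qed.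

Lemma nsum_renewal (F : seq S -> R) : (forall u, 0 <= F u) ->
  nsum (fun u => if isloop u && (u != [::]) then F u else 0) =
  (\esum_(w in [set w | isfirst w]) nsum (fun v => if isloop v then F (v ++ w)%SEQ else 0%R))%E.
Proof.
move=> F0; rewrite (nsum_cond (fun u => isloop u && (u != [::])%SEQ)).
rewrite [RHS](eq_esum (b := fun w => (\esum_(v in [set v | isloop v]) (F (v ++ w)%SEQ)%:E)%E)); last first.
  by move=> w _; exact: nsum_cond.
rewrite esum_esum; last by move=> i j _ _; rewrite lee_fin.
rewrite (reindex_esum ([set w | isfirst w] `*`` (fun=> [set v | isloop v]))
  [set u | isloop u && (u != [::])] (fun p => p.2 ++ p.1)) //; split.
- move=> [w v] /= [fw lv]; case/and3P: fw => w0 lw _.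
  rewrite isloop_cat //=; by move: w0; case: (w); case: (v).
- move=> [w v] [w' v']; rewrite !inE /= => -[fw lv] [fw' lv'] e.
  by have [-> ->] := split_inj fw fw' e.
- move=> u /= /andP[lu u0]; have [v [w [lv fw ->]]] := isloop_split lu u0.
  by exists (w, v).
Qed.

Lemma nsum_by_size (F : seq S -> R) (C r : R) : (forall u, 0 <= F u) -> 0 <= C -> 0 <= r < 1 ->
  (forall n, (nsum (fun v => if size v == n then F v else 0%R) <= (C * r ^+ n)%:E)%E) ->
  (nsum F <= (C / (1 - r))%:E)%E.
Proof.
move=> F0 C0 /andP[r0 r1] H; apply: ge_ereal_sup => _ [X [fX _] <-].

rewrite fsbig_finite //=; set s := finmap.enum_fset (fset_set X).
pose N := (\max_(v <- s) size v).+1.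
have HN v : v \in s -> (size v < N)%N.
  by move=> vs; rewrite ltnS (leq_bigmax_seq (F := fun v : seq S => size v)).
have part v : v \in s -> F v = \sum_(n < N) (if size v == n then F v else 0).
  move=> vs; rewrite (bigD1 (Ordinal (HN v vs))) //= eqxx big1 ?addr0 // => i.
  by rewrite -val_eqE /= eq_sym => /negbTE ->.
apply: (@le_trans _ _ (\sum_(n < N) (C * r ^+ n))%:E); last first.
  rewrite lee_fin -mulr_sumr ler_wpM2l // -[leRHS]mul1r ler_pdivlMr; last lra.
  have -> : (\sum_(i < N) r ^+ i) * (1 - r) = 1 - r ^+ N.
    by rewrite -[RHS]opprB subrX1 mulrC -mulNr opprB.
  by rewrite lerBlDr lerDl exprn_ge0.
rewrite -sumEFin (eq_big_seq (fun v => (\sum_(n < N) (if size v == n then F v else 0))%:E)).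
  under eq_bigr do rewrite -sumEFin.
  rewrite exchange_big /=; apply: lee_sum => n _; apply: le_trans (H n).
  apply: ereal_sup_ubound; exists X; first by split.
  by rewrite fsbig_finite.
by move=> v vs; rewrite -part.
Qed.

End WordSums.

Section LoopSums.
Variables (S : countType) (edge : S -> S -> bool) (R : realType) (a : S).
Implicit Types (v w : seq S) (f : (nat -> S) -> R) (s : R).
Notation isloop := (isloop edge a).
Notation isfirst := (isfirst edge a).

Definition baseX := {x : nat -> S | Sigma edge x /\ x 0%N = a}.
Definition firstW := {w : seq S | isfirst w}.

Lemma first_loop (w : firstW) : isloop (val w).
Proof. by case/and3P: (valP w). Qed.

Lemma first_size (w : firstW) : (0 < size (val w))%N.
Proof. by case/and3P: (valP w); case: (val w). Qed.

Definition glueX (w : firstW) (x : baseX) : baseX :=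
  exist _ (glue (val w) (sval x)) (isloop_glue (first_loop w) (svalP x)).

Definition gibbs f s v (x : nat -> S) : R :=
  expR (birk f (size v) (glue v x) - s * (size v)%:R).

Definition loopsum f s n (x : nat -> S) : \bar R :=
  nsum (fun v => if isloop v && (size v == n) then gibbs f s v x else 0).

Definition greensum f s (x : nat -> S) : \bar R :=
  nsum (fun v => if isloop v then gibbs f s v x else 0).

Lemma gibbs_ge0 f s v x : 0 <= gibbs f s v x. Proof. exact: expR_ge0. Qed.

Lemma gibbs_cat f s v w x : gibbs f s (v ++ w) x = gibbs f s v (glue w x) * gibbs f s w x.
Proof.
rewrite /gibbs -expRD birk_glue_cat size_cat natrD; congr expR; ring.
Qed.

Lemma gibbs_nil f s x : gibbs f s [::] x = 1.
Proof. by rewrite /gibbs /= /birk big_ord0 mulr0 subrr expR0. Qed.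

Lemma gibbs_rate f s s' v x : gibbs f s v x = gibbs f s' v x * expR ((s' - s) * (size v)%:R).
Proof. by rewrite /gibbs -expRD; congr expR; ring. Qed.

Lemma loopsum_rate f s s' n x :
  loopsum f s n x = ((expR ((s' - s) * n%:R))%:E * loopsum f s' n x)%E.
Proof.
rewrite /loopsum -nsumZ ?expR_ge0 //; last by move=> v; case: ifP => // _; exact: gibbs_ge0.
congr nsum; apply/funext => v; case: (boolP (isloop v)) => /= _; rewrite ?mulr0 //.
by case: eqP => [<-|]; rewrite ?mulr0 // mulrC; exact: gibbs_rate.
Qed.

Lemma nsum_renewalW (F : seq S -> R) : (forall u, 0 <= F u) ->
  nsum (fun u => if isloop u && (u != [::]) then F u else 0) =
  (\esum_(w in [set: firstW])
     nsum (fun v => if isloop v then F (v ++ val w)%SEQ else 0%R))%E.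
Proof.
by move=> F0; rewrite nsum_renewal // (reindex_esum [set: firstW] _ val).
Qed.

Lemma loopsum0 f s x : loopsum f s 0 x = 1%E.
Proof.
rewrite /loopsum (nsum_cond (fun v => isloop v && (size v == 0%N))).
rewrite (_ : [set _ | _] = [set [::]]); last first.
  apply/seteqP; split => [v /= /andP[_ /nilP //]|v /= ->].
  by rewrite isloop_nil.
by rewrite esum_set1 ?gibbs_nil // lee_fin gibbs_ge0.
Qed.

(* Induction along the decomposition of a loop by its last first-return block. *)
Lemma loopsum_superharmonic f s (H : baseX -> R) (c : R) : 0 < c -> (forall x, c <= H x) ->
  (forall x, (nsum (fun w : firstW => gibbs f s (val w) (sval x) * H (glueX w x))%R <= (H x)%:E)%E) ->
  forall n x, (loopsum f s n (sval x) <= (H x / c)%:E)%E.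
Proof.
move=> c0 cH sH; elim/ltn_ind => -[_|n IH] x.
  by rewrite loopsum0 lee_fin ler_pdivlMr // mul1r.
pose F u := if size u == n.+1 then gibbs f s u (sval x) else 0.
have F0 u : 0 <= F u by rewrite /F; case: ifP => // _; exact: gibbs_ge0.
have -> : loopsum f s n.+1 (sval x) =
    nsum (fun u => if isloop u && (u != [::]) then F u else 0).
  congr nsum; apply/funext => u; rewrite /F; case: (isloop u) => //=.
  by case: (u).
rewrite nsum_renewalW //.
apply: (@le_trans _ _ (nsum (fun w : firstW =>
    c^-1 * (gibbs f s (val w) (sval x) * H (glueX w x)))%R)).
  apply: le_esum => w _.
  have [wn|nw] := leqP (size (val w)) n.+1; last first.
    rewrite (_ : (fun v => _) = (fun=> 0)); last first.
      apply/funext => v; rewrite /F size_cat; case: ifP => // _.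
      by case: eqP => // e; move: nw; rewrite -e ltnNge leq_addl.
    rewrite nsum0 lee_fin !mulr_ge0 ?invr_ge0 ?gibbs_ge0 //; first exact: ltW.
    by rewrite (le_trans _ (cH _)) // ltW.
  rewrite (_ : (fun v => _) = (fun v => gibbs f s (val w) (sval x) *
     (if isloop v && (size v == n.+1 - size (val w))%N then gibbs f s v (glue (val w) (sval x)) else 0))).
    rewrite nsumZ ?gibbs_ge0 //; last by move=> v; case: ifP => // _; exact: gibbs_ge0.
    have := IH (n.+1 - size (val w))%N _ (glueX w x).
    have -> : (n.+1 - size (val w) < n.+1)%N by rewrite ltn_subrL first_size.
    move=> /(_ isT) h; rewrite mulrCA EFinM lee_wpmul2l ?lee_fin ?gibbs_ge0 //.
    by rewrite mulrC.
  apply/funext => v; rewrite /F; case: (isloop v); rewrite /= ?mulr0 // size_cat.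
  have -> : (size v + size (val w) == n.+1)%N = (size v == n.+1 - size (val w))%N.
    by apply/eqP/eqP; lia.
  by case: eqP; rewrite ?mulr0 // gibbs_cat mulrC.
rewrite nsumZ ?invr_ge0 ?(ltW c0) //; last first.
  by move=> w; rewrite mulr_ge0 ?gibbs_ge0 // (le_trans _ (cH _)) // ltW.
by rewrite mulrC EFinM lee_wpmul2l // lee_fin invr_ge0 ltW.
Qed.

Lemma greensum_renewal f s (x : baseX) :
  (\esum_(w in [set: firstW]) ((gibbs f s (val w) (sval x))%:E * greensum f s (sval (glueX w x)))
    <= greensum f s (sval x))%E.
Proof.
apply: (@le_trans _ _ (nsum (fun u => if isloop u && (u != [::]) then gibbs f s u (sval x) else 0))).
  rewrite nsum_renewalW; last by move=> u; exact: gibbs_ge0.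
  apply: le_esum => w _; rewrite -nsumZ ?gibbs_ge0 //; last first.
    by move=> v; case: ifP => // _; exact: gibbs_ge0.
  apply: le_nsum => v; case: ifP; rewrite ?mulr0 // => _.
  by rewrite gibbs_cat mulrC.
apply: le_nsum => u; case: (isloop u) => //=; case: ifP => // _; exact: gibbs_ge0.
Qed.

Lemma greensum_ge1 f s x : (1 <= greensum f s x)%E.
Proof.
rewrite -(loopsum0 f s x); apply: le_nsum => v.
by case: (isloop v) => //=; case: ifP => // _; exact: gibbs_ge0.
Qed.

Lemma greensum_fin f s P C x : 0 <= C -> P < s ->
  (forall n, (loopsum f 0%R n x <= (C * expR (P * n%:R))%:E)%E) ->
  (greensum f s x <= (C / (1 - expR (P - s)))%:E)%E.
Proof.
move=> C0 Ps H; apply: nsum_by_size => //.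
- by move=> u; case: ifP => // _; exact: gibbs_ge0.
- by rewrite expR_ge0 /= -expR0 ltr_expR; lra.
move=> n; rewrite (_ : nsum _ = loopsum f s n x); last first.
  by congr nsum; apply/funext => v; case: (isloop v); case: eqP.
rewrite (loopsum_rate _ _ 0) -expRM_natr.
have -> : (C * expR ((P - s) * n%:R)) = expR ((0 - s) * n%:R) * (C * expR (P * n%:R)).
  by rewrite mulrCA -expRD; congr (_ * expR _); ring.
by rewrite EFinM lee_wpmul2l // lee_fin expR_ge0.
Qed.

Lemma gibbs_distortion A th f : 0 < th < 1 -> 0 <= A -> var_holder edge A th f ->
  forall s v n (x y : baseX), isloop v -> (0 < n)%N -> agree n (sval x) (sval y) ->
  gibbs f s v (sval x) <= gibbs f s v (sval y) * expR (A / (1 - th) * th ^+ n).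
Proof.
move=> th01 A0 H s v n x y lv n0 xy; rewrite /gibbs -expRD ler_expR.
have [sx _] := isloop_glue lv (svalP x); have [sy _] := isloop_glue lv (svalP y).
have := birk_distortion th01 A0 H n0 sx sy (glue_agree (v := v) xy).
rewrite ler_norml; lra.
Qed.

Lemma greensum_distortion A th f : 0 < th < 1 -> 0 <= A -> var_holder edge A th f ->
  forall s n (x y : baseX), (0 < n)%N -> agree n (sval x) (sval y) ->
  (greensum f s (sval x) <= (expR (A / (1 - th) * th ^+ n))%:E * greensum f s (sval y))%E.
Proof.
move=> th01 A0 H s n x y n0 xy; rewrite -nsumZ ?expR_ge0 //; last first.
  by move=> v; case: ifP => // _; exact: gibbs_ge0.
apply: le_nsum => v; case: ifP => lv; rewrite ?mulr0 // mulrC.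
exact: gibbs_distortion.
Qed.

End LoopSums.

(** * Growth of perturbed loop sums *)

Section Perturbation.
Variables (S : countType) (edge : S -> S -> bool) (R : realType) (a : S).
Variables (f : (nat -> S) -> R) (A th P C M1 eps : R) (w0 : firstW edge a) (x0 : baseX edge a).
Notation X := (baseX edge a).
Notation W := (firstW edge a).
Hypothesis th01 : 0 < th < 1.
Hypothesis A0 : 0 < A.
Hypothesis fA : var_holder edge A th f.
Hypothesis C0 : 0 <= C.
Hypothesis growth : forall (x : X) n, (loopsum edge a f 0%R n (sval x) <= (C * expR (P * n%:R))%:E)%E.
Hypothesis eps0 : 0 < eps.
Hypothesis M10 : 0 <= M1.
Hypothesis tail : forall x : X,
  (nsum (fun w : W => gibbs f P (val w) (sval x) * expR (eps * (size (val w))%:R))%R <= M1%:E)%E.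

Let D := A / (1 - th).
Let D0 : 0 < D. Proof. by rewrite /D divr_gt0 // subr_gt0; case/andP: th01. Qed.
Let agr n (x y : X) := agree n (sval x) (sval y).
Let len (w : W) := size (val w).
Let sig := expR (birk f (len w0) (glue (val w0) (sval x0)) - (P + 1) * (len w0)%:R - D).
Let M := expR D / sig * M1.

Let thn n : 0 < th ^+ n <= 1.
Proof. by case/andP: th01 => t0 t1; rewrite exprn_gt0 //= exprn_ile1 // ltW. Qed.

Let agr1 x y : agr 1 x y.
Proof. by case=> // _; have [_ ->] := svalP x; have [_ ->] := svalP y. Qed.

Section FixedRate.
Variable s : R.
Hypothesis Ps : P < s.
Hypothesis sP1 : s <= P + 1.

Let g (w : W) (x : X) : R := gibbs f s (val w) (sval x).
Let U (x : X) : R := fine (greensum edge a f s (sval x)).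

Let g0 w x : 0 <= g w x. Proof. exact: gibbs_ge0. Qed.

Let UE x : (U x)%:E = greensum edge a f s (sval x).
Proof.
rewrite fineK // ge0_fin_numE; last by apply: le_trans (greensum_ge1 _ _ _ _ _).
by apply: le_lt_trans (greensum_fin C0 Ps (growth x)) _; rewrite ltry.
Qed.

Let U1 x : 1 <= U x. Proof. by rewrite -lee_fin UE greensum_ge1. Qed.

Let gd n w x y : (0 < n)%N -> agr n x y -> g w x <= g w y * expR (D * th ^+ n).
Proof. by move=> n0 xy; apply: (gibbs_distortion th01 (ltW A0) fA) => //; exact: first_loop. Qed.

Let Ud n x y : (0 < n)%N -> agr n x y -> U x <= U y * expR (D * th ^+ n).
Proof.
move=> n0 xy; rewrite -lee_fin mulrC EFinM !UE.
exact: (greensum_distortion th01 (ltW A0) fA).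
Qed.

Let expD n : expR (D * th ^+ n) <= expR D.
Proof. by rewrite ler_expR ler_piMr ?(ltW D0) //; case/andP: (thn n). Qed.

Let UD x y : U x <= U y * expR D.
Proof.
apply: (le_trans (@Ud 1%N _ _ isT (agr1 x y))); rewrite ler_wpM2l //.
by rewrite (le_trans _ (U1 y)).
Qed.

Let gsum x : rsummable (fun w => g w x * expR (eps * (len w)%:R)) /\
  rsum (fun w => g w x * expR (eps * (len w)%:R)) <= M1.
Proof.
have h0 w : 0 <= g w x * expR (eps * (len w)%:R) by rewrite mulr_ge0 ?expR_ge0.
have h : (nsum (fun w => g w x * expR (eps * (len w)%:R))%R <= M1%:E)%E.
  apply: le_trans (tail x); apply: le_nsum => w.
  rewrite ler_wpM2r ?expR_ge0 // /g (gibbs_rate _ _ P).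
  rewrite ler_piMr ?gibbs_ge0 // -expR0 ler_expR.
  by rewrite mulr_le0_ge0 // subr_le0 ltW.
have sm : rsummable (fun w => g w x * expR (eps * (len w)%:R)).
  by apply: nsum_rsummable => //; apply: le_lt_trans h _; rewrite ltry.
by split => //; rewrite -lee_fin rsum_nneg.
Qed.

Let gsm x : rsummable (fun w => g w x).
Proof.
apply: rsummable_le (gsum x).1 => w; rewrite ger0_norm // ler_peMr //.
by rewrite -expR0 ler_expR mulr_ge0 // ltW.
Qed.

Let gUsm x : rsummable (fun w => g w x * U (glueX w x)).
Proof.
apply: (@rsummable_le _ _ _ (fun w => (U x0 * expR D) * g w x)); last exact: rsummableZ.
move=> w; rewrite mulrC ger0_norm; last by rewrite mulr_ge0 // (le_trans _ (U1 _)).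
by rewrite ler_wpM2r // UD.
Qed.

Let V x := rsum (fun w => g w x * U (glueX w x)).

Let sig0 : 0 < sig. Proof. exact: expR_gt0. Qed.

Let gsig x : sig <= rsum (g ^~ x).
Proof.
rewrite -lee_fin rsum_nneg //; apply: le_trans (nsum_ge_term _ w0).
rewrite lee_fin.
have h2 := @gd 1%N w0 _ _ isT (agr1 x0 x).
have h3 : g w0 x0 <= g w0 x * expR D.
  by apply: (le_trans h2); rewrite ler_wpM2l.
have -> : sig = expR (birk f (len w0) (glue (val w0) (sval x0)) - (P + 1) * (len w0)%:R) * expR (- D).
  by rewrite -expRD.
have -> : g w0 x = g w0 x * expR D * expR (- D).
  by rewrite -mulrA -expRD subrr expR0 mulr1.
rewrite ler_wpM2r ?expR_ge0 //; apply: le_trans h3.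
by rewrite /g /gibbs ler_expR lerD2l lerN2 ler_wpM2r.
Qed.

Let V_le x : V x <= U x.
Proof.
rewrite -lee_fin UE rsum_nneg //.
  apply: le_trans (greensum_renewal _ _ _); apply: le_esum => w _.
  by rewrite EFinM UE.
by move=> w; rewrite mulr_ge0 // (le_trans _ (U1 _)).
Qed.

Let V_ge x z : U z * sig <= V x * expR D.
Proof.
apply: (@le_trans _ _ (U z * rsum (g ^~ x))).
  by rewrite ler_wpM2l // (le_trans _ (U1 _)).
rewrite -rsumZ // mulrC -rsumZ //; apply: ler_rsum.
- exact: rsummableZ.
- exact: rsummableZ.
by move=> w; rewrite mulrC [leRHS]mulrCA ler_wpM2l // mulrC UD.
Qed.

Let V0 x : 0 < V x.
Proof.
have := V_ge x x; have h : 0 < U x * sig by rewrite mulr_gt0 // (lt_le_trans _ (U1 _)).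
by move/(lt_le_trans h); rewrite pmulr_lgt0 // expR_gt0.
Qed.

Let Vd n x y : (0 < n)%N -> agr n x y -> V x <= V y * expR (2 * D * th ^+ n).
Proof.
move=> n0 xy; rewrite mulrC -rsumZ //; apply: ler_rsum => //; first exact: rsummableZ.
move=> w; have h1 := gd w n0 xy.
have xy' : agr n (glueX w x) (glueX w y).
  apply: agree_le (glue_agree (v := val w) xy); exact: leq_addl.
have h2 := Ud n0 xy'.
have -> : expR (2 * D * th ^+ n) = expR (D * th ^+ n) * expR (D * th ^+ n).
  by rewrite -expRD; congr expR; ring.
have -> : expR (D * th ^+ n) * expR (D * th ^+ n) * (g w y * U (glueX w y)) =
  (g w y * expR (D * th ^+ n)) * (U (glueX w y) * expR (D * th ^+ n)) by ring.
by rewrite ler_pM // (le_trans _ (U1 _)).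
Qed.

Let q w x := g w x * U (glueX w x) / V x.

Let q_kernel : kernel agr len th eps (4 * D) M q.
Proof.
split.
- by move=> w x; rewrite /q divr_ge0 ?mulr_ge0 ?(ltW (V0 _)) // (le_trans _ (U1 _)).
- move=> x; have [s1 s2] := gsum x.
  have pw w : `|q w x * expR (eps * (len w)%:R)| <= expR D / sig * (g w x * expR (eps * (len w)%:R)).
    rewrite ger0_norm; last first.
      by rewrite mulr_ge0 ?expR_ge0 // divr_ge0 ?mulr_ge0 ?(ltW (V0 _)) // (le_trans _ (U1 _)).
    rewrite mulrA ler_wpM2r ?expR_ge0 // /q mulrC [leRHS]mulrC -mulrCA ler_wpM2l //.
    rewrite mulrC ler_pdivrMr // mulrAC ler_pdivlMr // [leRHS]mulrC.
    exact: V_ge.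
  have sq : rsummable (fun w => q w x * expR (eps * (len w)%:R)).
    by apply: rsummable_le pw _; exact: rsummableZ.
  split => //; apply: (@le_trans _ _ (rsum (fun w => expR D / sig * (g w x * expR (eps * (len w)%:R))))).
    apply: ler_rsum => //; first exact: rsummableZ.
    by move=> w; rewrite (le_trans _ (pw w)) // ler_norm.
  by rewrite rsumZ // ler_wpM2l // divr_ge0 ?expR_ge0.
- move=> x; rewrite /q (_ : (fun w => _) = (fun w => (V x)^-1 * (g w x * U (glueX w x)))).
    by rewrite rsumZ // mulVf // gt_eqF.
  by apply/funext => w; rewrite mulrC.
- move=> n w x y n0 xy; have h1 := gd w n0 xy.
  have xy' : agr n (glueX w x) (glueX w y).
    apply: agree_le (glue_agree (v := val w) xy); exact: leq_addl.
  have h2 := Ud n0 xy'; have h3 := Vd n0 (agree_sym xy).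
  rewrite /q ler_pdivrMr //.
  set E := expR (D * th ^+ n) in h1 h2.
  have e2 : expR (2 * D * th ^+ n) = E * E by rewrite -expRD; congr expR; ring.
  have -> : expR (4 * D * th ^+ n) = E * E * (E * E) by rewrite -!expRD; congr expR; ring.
  rewrite e2 in h3.
  have -> : g w y * U (glueX w y) / V y * (E * E * (E * E)) * V x =
    (g w y * E) * (U (glueX w y) * E) * (V x * (E * E) / V y) by ring.
  have h4 : g w x * U (glueX w x) <= g w y * E * (U (glueX w y) * E).
    by rewrite ler_pM // (le_trans _ (U1 _)).
  apply: (le_trans h4); rewrite ler_peMr //.
    by rewrite !mulr_ge0 ?expR_ge0 // (le_trans _ (U1 _)).
  by rewrite ler_pdivlMr // mul1r.
Qed.

Lemma gibbs_kernel : exists (q : W -> X -> R) (U V : X -> R),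
  [/\ kernel agr len th eps (4 * D) M q, forall x, 1 <= U x, forall x, 0 < V x <= U x &
      forall w x, gibbs f s (val w) (sval x) * U (glueX w x) = q w x * V x].
Proof.
exists q, U, V; split => // [x|w x]; first by rewrite V0 V_le.
by rewrite /q divfK // gt_eqF.
Qed.

End FixedRate.

Lemma norm_birk_le (psi : (nat -> S) -> R) n x : (forall y, Sigma edge y -> `|psi y| <= 1) ->
  Sigma edge x -> `|birk psi n x| <= n%:R.
Proof.
move=> h sx; apply: (le_trans (ler_norm_sum _ _ _)).
rewrite -[leRHS]mulr1 -[n in leRHS]card_ord mulr_natl -sumr_const; apply: ler_sum => i _.
by apply: h; exact: Sigma_iter_shift.
Qed.

Theorem perturbed_growth : exists e1 K : R, [/\ 0 < e1, 0 < K &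
  forall psi, (forall y, Sigma edge y -> `|psi y| <= 1) -> var_holder edge 1 th psi ->
  forall e, 0 < e <= 1 -> exists2 l : R, `|l| <= 1 & forall t, `|t| <= e1 ->
  exists2 C' : R, 0 <= C' & forall n,
  (loopsum edge a (fun y => f y + t * psi y)%R 0%R n (sval x0) <=
    (C' * expR ((P + e + (t * l + K * t ^+ 2 + e)) * n%:R))%:E)%E].
Proof.
have agrS n (w : W) x y : agr n x y -> agr n.+1 (glueX w x) (glueX w y).
  move=> xy; apply: agree_le (glue_agree (v := val w) xy).
  by rewrite -add1n leq_add2r; exact: first_size.
have D40 : 0 < 4 * D by rewrite mulr_gt0.
have th1 : 0 < 1 - th by rewrite subr_gt0; case/andP: th01.
have C00 : 0 <= 1 / (1 - th) by rewrite divr_ge0 // ltW.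
have M0 : 0 <= M by rewrite mulr_ge0 // divr_ge0 ?expR_ge0.
have [e1 [K [b [e10 e11 K0 key]]]] := kernel_exp_moment agr1 agrS
  (fun n x y => @agree_sym _ n _ _) th01 eps0 (@first_size _ _ _) D40 C00 M0.
exists e1, K; split => // psi psi1 psiH e /andP[e0 ele1].
have Ps : P < P + e by rewrite ltrDl.
have sP1 : P + e <= P + 1 by rewrite lerD2l.
have [q [U [V [Kq U1 V0 qV]]]] := gibbs_kernel Ps sP1.
pose Psi (w : W) (x : X) := birk psi (len w) (glue (val w) (sval x)).
have Psi1 w x : `|Psi w x| <= (len w)%:R.
  by apply: norm_birk_le => //; have [] := isloop_glue (first_loop w) (svalP x).
have PsiH n w x y : (0 < n)%N -> agr n x y -> `|Psi w x - Psi w y| <= 1 / (1 - th) * th ^+ n.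
  move=> n0 xy; apply: (birk_distortion th01 ler01 psiH) => //.
  - by have [] := isloop_glue (first_loop w) (svalP x).
  - by have [] := isloop_glue (first_loop w) (svalP y).
  - exact: glue_agree.
have [l [u [l1 ub Hav]]] := key q Kq x0 Psi Psi1 PsiH e e0.
exists l => // t te.
pose s := P + e + (t * l + K * t ^+ 2 + e).
pose H x := U x * expR (t * u x).
pose c := expR (- (`|t| * b)).
have cH x : c <= H x.
  rewrite -[c]mul1r /H ler_pM ?expR_ge0 // ler_expR.
  have h : `|t * u x| <= `|t| * b by rewrite normrM ler_wpM2l.
  by move: h; rewrite ler_norml => /andP[].
exists (H x0 / c); first by rewrite divr_ge0 ?expR_ge0 // (le_trans _ (cH _)) // expR_ge0.
move=> n; rewrite (loopsum_rate _ _ _ _ s) subr0 -/s [in leRHS]mulrC EFinM.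
rewrite lee_wpmul2l ?lee_fin ?expR_ge0 //.
apply: loopsum_superharmonic => // [|x]; first exact: expR_gt0.
have [aE avE] := Hav t x te.
pose Y w := t * (Psi w x - l * (len w)%:R + (u (glueX w x) - u x)).
have sm : rsummable (fun w => q w x * expR (Y w)) by exact: (av_summable Kq).
pose k := V x * expR (t * u x) * expR (- (K * t ^+ 2 + e)).
have k0 : 0 <= k by rewrite !mulr_ge0 ?expR_ge0 //; case/andP: (V0 x) => /ltW.
apply: (@le_trans _ _ (nsum (fun w => k * (q w x * expR (Y w))))).
  apply: le_nsum => w.
  have -> : gibbs (fun y => f y + t * psi y) s (val w) (sval x) =
     gibbs f (P + e) (val w) (sval x) * expR (t * Psi w x - (t * l + K * t ^+ 2 + e) * (len w)%:R).
    rewrite /gibbs -expRD; congr expR.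
    have -> : birk (fun y => f y + t * psi y) (size (val w)) (glue (val w) (sval x)) =
       birk f (size (val w)) (glue (val w) (sval x)) + t * Psi w x.
      by rewrite /birk /Psi /birk mulr_sumr -big_split.
    rewrite /s /len; ring.
  rewrite /H mulrACA qV.
  have -> : k * (q w x * expR (Y w)) = q w x * V x * (expR (t * u x) * expR (- (K * t ^+ 2 + e)) * expR (Y w)).
    by rewrite /k; ring.
  rewrite ler_wpM2l //.
    by rewrite -qV mulr_ge0 ?gibbs_ge0 // (le_trans _ (U1 _)).
  rewrite -!expRD ler_expR /Y.
  have lw : 1 <= (len w)%:R :> R by rewrite ler1n; exact: first_size.
  have : 0 <= K * t ^+ 2 + e by rewrite addr_ge0 ?(ltW e0) // mulr_ge0 ?sqr_ge0 // ltW.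
  move: (K * t ^+ 2) => z z0.
  have : z + e <= (z + e) * (len w)%:R by rewrite ler_peMr.
  lra.
rewrite nsumZ //; last by move=> w; rewrite mulr_ge0 ?expR_ge0 //; case: Kq.
have q0 w : 0 <= q w x * expR (Y w) by rewrite mulr_ge0 ?expR_ge0 //; case: Kq.
rewrite -rsum_nneg // -EFinM lee_fin.
apply: (@le_trans _ _ (k * expR (K * t ^+ 2 + e))); first by rewrite ler_wpM2l.
rewrite /k -mulrA -expRD addNr expR0 mulr1 ler_wpM2r ?expR_ge0 //.
by case/andP: (V0 x).
Qed.

End Perturbation.

(** * Almost superadditive sequences *)

Section Fekete.
Variables (R : realType) (u : nat -> R) (n0 : nat).
Hypothesis u_super : forall n m, (n0 <= n)%N -> (n0 <= m)%N -> u n + u m <= u (n + m)%N.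

Lemma fekete_near m (c : R) : (n0 <= m)%N -> (0 < m)%N -> c * m%:R < u m ->
  exists N, forall n, (N <= n)%N -> c * n%:R <= u n.
Proof.
move=> n0m m0 cm; pose B := \sum_(i < m) `|u (n0 + i)%N - c * (n0 + i)%:R|.
have step q r : (n0 <= r)%N -> q%:R * u m + u r <= u (q * m + r)%N.
  move=> n0r; elim: q => [|q IH]; first by rewrite mul0r add0r mul0n add0n.
  have := u_super n0m (leq_trans n0r (leq_addl (q * m) r)).
  rewrite mulSn -addnA => h; apply: le_trans h.
  by rewrite -natr1; lra.
have d0 : 0 < u m - c * m%:R by rewrite subr_gt0.
pose K := Num.truncn (B / (u m - c * m%:R)).
exists (n0 + K.+1 * m)%N => n nN.
pose q := ((n - n0) %/ m)%N; pose r := ((n - n0) %% m)%N.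
have en : n = (q * m + (n0 + r))%N.
  have := divn_eq (n - n0) m; rewrite -/q -/r; have : (n0 <= n)%N by lia.
  by lia.
have rm : (r < m)%N by rewrite ltn_pmod.
have Kq : (K.+1 <= q)%N by rewrite leq_divRL //; lia.
have h1 := step q (n0 + r)%N (leq_addr r n0); rewrite -en in h1.
have h2 : - B <= u (n0 + r)%N - c * (n0 + r)%:R.
  rewrite lerNl (le_trans (ler_norm _)) // normrN /B (bigD1 (Ordinal rm)) //=.
  by rewrite lerDl sumr_ge0.
have h3 : B <= q%:R * (u m - c * m%:R).
  rewrite -ler_pdivrMr // (@le_trans _ _ K.+1%:R) ?ler_nat //.
  exact/ltW/truncnS_gt.
apply: le_trans h1; rewrite {1}en natrD natrM; lra.
Qed.

Lemma fekete_lim (h : R) : (forall n, (n0 <= n)%N -> u n <= h * n%:R) -> exists l : R,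
  [/\ u n.+1 / n.+1%:R @[n --> \oo] --> l,
      forall n, (n0 <= n)%N -> (0 < n)%N -> u n <= l * n%:R &
      forall e, 0 < e -> exists N, forall n, (N <= n)%N -> (l - e) * n%:R <= u n].
Proof.
move=> uh; pose E := [set u n / n%:R | n in [set n | (n0 <= n)%N /\ (0 < n)%N]].
have supE : has_sup E.
  split; first by exists (u n0.+1 / n0.+1%:R), n0.+1.
  exists h => _ [n [n0n np] <-]; rewrite ler_pdivrMr ?ltr0n //; exact: uh.
pose l := sup E.
have ub n : (n0 <= n)%N -> (0 < n)%N -> u n <= l * n%:R.
  move=> n0n np; rewrite -ler_pdivrMr ?ltr0n //; apply: ub_le_sup; first by case: supE.
  by exists n.
have lb e : 0 < e -> exists N, forall n, (N <= n)%N -> (l - e) * n%:R <= u n.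
  move=> e0; have [_ [m [n0m mp] <-] hm] := sup_adherent e0 supE.
  by apply: (fekete_near n0m mp); rewrite -ltr_pdivlMr ?ltr0n.
exists l; split => //; apply/cvgrPdist_le => e e0.
have [N HN] := lb _ e0; exists (maxn N n0) => // n /=; rewrite geq_max => /andP[Nn n0n].
have p : 0 < n.+1%:R :> R by rewrite ltr0n.
have := HN n.+1 (leqW Nn); rewrite -ler_pdivlMr // => h1.
have := ub n.+1 (leqW n0n) isT; rewrite -ler_pdivrMr // => h2.
have key (x e' : R) : 0 < e' -> l - e' <= x -> x <= l -> `|l - x| <= e'.
  by move=> *; rewrite ler_norml; lra.
exact: key.
Qed.

End Fekete.

Section GrowthRate.
Variables (R : realType) (z : nat -> \bar R) (p n0 : nat) (D : R).
Hypothesis p0 : (0 < p)%N.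
Hypothesis n00 : (0 < n0)%N.
Hypothesis z_super : forall n m, (0 < n)%N -> (0 < m)%N ->
  (z n * z m <= (expR D)%:E * z (n + m)%N)%E.
Hypothesis z_pos : forall n, (n0 <= n)%N -> (0 < z n)%E.
Hypothesis z_ge0 : forall n, (0 <= z n)%E.

Let rate n : \bar R := (lne (z n) * (((p * n)%:R)^-1)%:E)%E.

Lemma growth_bounded : (limn (fun n => rate n.+1) < +oo)%E ->
  exists h : R, forall n, (0 < n)%N -> (z n <= (expR (h * n%:R))%:E)%E.
Proof.
move=> rate_oo.
have pn n : 0 < ((p * n.+1)%:R : R)^-1 by rewrite invr_gt0 ltr0n muln_gt0 p0.
have noty : ~ (forall A : R, exists N, forall n, (N <= n)%N -> (A%:E <= rate n)%E).
  move=> H; move: rate_oo; rewrite (_ : limn _ = +oo%E) ?ltxx //.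
  apply/cvg_lim => //; apply/cvgeyPge => A; have [N HN] := H A.
  by exists N => // n /= Nn; apply: HN; exact: leqW.
have fin n : (0 < n)%N -> (z n < +oo)%E.
  move=> np; rewrite ltey; apply/eqP => zn; apply: noty => A.
  exists (n + n0)%N => m nm.
  have zm : z m = +oo%E.
    have h1 : (n0 <= m - n)%N by lia.
    have h0 : (0 < m - n)%N by lia.
    have := z_super np h0; rewrite zn subnKC; last by lia.
    rewrite gt0_mulye ?z_pos //; rewrite leye_eq => /eqP.
    case: (z m) (z_ge0 m) => [r|//|//] _ //.
  have m0 : (0 < m)%N by lia.
  by rewrite /rate zm /= gt0_mulye ?leey // lte_fin; case: (m) m0.
pose u n := ln (fine (z n)) - D.
have zE n : (n0 <= n)%N -> z n = (expR (u n + D))%:E.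
  move=> n0n; have zf : z n \is a fin_num.
    by rewrite ge0_fin_numE // fin //; exact: leq_trans n00 n0n.
  rewrite /u subrK lnK ?fineK // posrE -lte_fin fineK //; exact: z_pos.
have us n m : (n0 <= n)%N -> (n0 <= m)%N -> u n + u m <= u (n + m)%N.
  move=> hn hm; have := z_super (leq_trans n00 hn) (leq_trans n00 hm).
  have hnm := leq_trans hn (leq_addr m n).
  rewrite (zE n) // (zE m) // (zE (n + m)%N) // -!EFinM lee_fin -!expRD ler_expR; lra.
have [h Hh] : exists h : R, forall n, (n0 <= n)%N -> u n <= h * n%:R.
  apply: contrapT => /forallNP H; apply: noty => A.
  have /existsNP[m] := H (`|A| * p%:R + `|D| + `|u 0%N|).
  move=> /not_implyP[n0m /negP]; rewrite -ltNge => hm.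
  have mp := leq_trans n00 n0m.
  have [|N HN] := fekete_near us n0m mp (c := `|A| * p%:R + `|D|).
    by apply: le_lt_trans hm; rewrite ler_wpM2r // lerDl.
  exists (maxn N n0) => n; rewrite geq_max => /andP[Nn n0n].
  have np := leq_trans n00 n0n.
  rewrite /rate zE // lne_EFin ?expR_gt0 // expRK -EFinM lee_fin.
  rewrite ler_pdivlMr ?ltr0n ?muln_gt0 ?p0 // natrM.
  have h1 := HN n Nn; have n1 : 1 <= n%:R :> R by rewrite ler1n.
  have h2 : `|D| <= `|D| * n%:R by rewrite ler_peMr.
  have h3 : A * (p%:R * n%:R) <= `|A| * p%:R * n%:R.
    by rewrite mulrA !ler_wpM2r // ler_norm.
  by have := ler_norm (- D); rewrite normrN; lra.
pose B := \sum_(i < n0) `|ln (fine (z i))|.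
exists (`|h| + `|D| + B) => n np; have n1 : 1 <= n%:R :> R by rewrite ler1n.
have B0 : 0 <= B by rewrite sumr_ge0.
have [n0n|nn0] := leqP n0 n.
  rewrite zE // lee_fin ler_expR; have h1 := Hh n n0n.
  have h2 : h * n%:R <= `|h| * n%:R by rewrite ler_wpM2r // ler_norm.
  have h3 : `|D| <= `|D| * n%:R by rewrite ler_peMr.
  have h4 : 0 <= B * n%:R by rewrite mulr_ge0.
  by have := ler_norm D; lra.
have := fin n np; have := z_ge0 n.
case ez: (z n) => [r| |] // r0 _; rewrite lee_fin in r0 *.
move: r0; rewrite le_eqVlt => /predU1P[<-|r0]; first exact: expR_ge0.
rewrite lee_fin -[r]lnK ?posrE // ler_expR.
have h1 : ln r <= B.
  rewrite /B (bigD1 (Ordinal nn0)) //= ez /= (le_trans (ler_norm _)) // lerDl sumr_ge0 //.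
have h2 : B <= B * n%:R by rewrite ler_peMr.
have h3 : 0 <= `|h| * n%:R by rewrite mulr_ge0.
have h4 : 0 <= `|D| * n%:R by rewrite mulr_ge0.
lra.
Qed.

Lemma growth_rate (h : R) : (forall n, (0 < n)%N -> (z n <= (expR (h * n%:R))%:E)%E) ->
  exists P : R, [/\ limn (fun n => rate n.+1) = P%:E,
   exists2 C : R, 0 <= C & forall n, (0 < n)%N -> (z n <= (C * expR (P * (p * n)%:R))%:E)%E &
   forall e, 0 < e -> exists N, forall n, (N <= n)%N ->
     ((expR ((P - e) * (p * n)%:R))%:E <= z n)%E].
Proof.
move=> zh.
have fin n : (0 < n)%N -> (z n < +oo)%E.
  by move=> np; apply: le_lt_trans (zh n np) _; rewrite ltry.
pose u n := ln (fine (z n)) - D.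
have zE n : (n0 <= n)%N -> z n = (expR (u n + D))%:E.
  move=> n0n; have zf : z n \is a fin_num.
    by rewrite ge0_fin_numE // fin //; exact: leq_trans n00 n0n.
  rewrite /u subrK lnK ?fineK // posrE -lte_fin fineK //; exact: z_pos.
have us n m : (n0 <= n)%N -> (n0 <= m)%N -> u n + u m <= u (n + m)%N.
  move=> hn hm; have := z_super (leq_trans n00 hn) (leq_trans n00 hm).
  have hnm := leq_trans hn (leq_addr m n).
  rewrite (zE n) // (zE m) // (zE (n + m)%N) // -!EFinM lee_fin -!expRD ler_expR; lra.
have uh n : (n0 <= n)%N -> u n <= (`|h| + `|D|) * n%:R.
  move=> n0n; have np := leq_trans n00 n0n.
  have := zh n np; rewrite zE // lee_fin ler_expR => h1.
  have n1 : 1 <= n%:R :> R by rewrite ler1n.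
  have h2 : h * n%:R <= `|h| * n%:R by rewrite ler_wpM2r // ler_norm.
  have h3 : `|D| <= `|D| * n%:R by rewrite ler_peMr.
  by have := ler_norm (- D); rewrite normrN; lra.
have [l [ul ub lb]] := fekete_lim us uh.
have pR : 0 < p%:R :> R by rewrite ltr0n.
exists (l / p%:R); split.
- apply/cvg_lim => //.
  have e : l / p%:R = (l + D * 0) / p%:R by rewrite mulr0 addr0.
  apply: (@cvg_trans _ (EFin ((u n.+1 / n.+1%:R + D * n.+1%:R^-1) / p%:R) @[n --> \oo])).
    apply: near_eq_cvg; exists n0 => // n /= n0n.
    rewrite /rate zE ?leqW // lne_EFin ?expR_gt0 // expRK -EFinM; congr EFin.
    rewrite natrM; field; rewrite ?gt_eqF ?ltr0n //=.
  apply: cvg_EFin; first by apply: nearW.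
  rewrite e; apply: cvgMl; apply: cvgD => //; apply: cvgMr; exact: cvg_harmonic.
- pose B := \sum_(i < n0) `|fine (z i) * expR (- (l / p%:R * (p * i)%:R))|.
  have B0 : 0 <= B by rewrite sumr_ge0.
  exists (expR D + B); first by rewrite addr_ge0 // expR_ge0.
  move=> n np; have [n0n|nn0] := leqP n0 n.
    rewrite zE // lee_fin expRD mulrC mulrDl ler_wpDr ?mulr_ge0 ?expR_ge0 //.
    rewrite ler_wpM2l ?expR_ge0 // ler_expR natrM mulrA divfK ?gt_eqF //.
    exact: ub.
  have zf : z n \is a fin_num by rewrite ge0_fin_numE // fin.
  rewrite -(fineK zf) lee_fin mulrDl ler_wpDl ?mulr_ge0 ?expR_ge0 //.
  rewrite -[leLHS]mulr1 -[X in _ * X]expR0 -(addNr (l / p%:R * (p * n)%:R)) expRD mulrA.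
  rewrite ler_wpM2r ?expR_ge0 // /B (bigD1 (Ordinal nn0)) //= (le_trans (ler_norm _)) //.
  by rewrite lerDl sumr_ge0.
- move=> e e0; have [N HN] := lb (e * p%:R / 2) ltac:(by rewrite divr_gt0 ?mulr_gt0).
  pose K := Num.truncn (`|D| / (e * p%:R / 2)).
  exists (maxn (maxn N n0) K.+1) => n; rewrite !geq_max => /andP[/andP[Nn n0n] Kn].
  rewrite zE // lee_fin ler_expR; have := HN n Nn.
  have h1 : `|D| <= e * p%:R / 2 * n%:R.
    rewrite mulrC -ler_pdivrMr ?divr_gt0 ?mulr_gt0 // (@le_trans _ _ K.+1%:R) ?ler_nat //.
    exact/ltW/truncnS_gt.
  rewrite natrM mulrA.
  have -> : (l / p%:R - e) * p%:R = l - e * p%:R by field; rewrite gt_eqF.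
  by have := ler_norm (- D); rewrite normrN; lra.
Qed.

End GrowthRate.

(** * Periodic points and the Gurevich pressure *)

Section LoopLengths.
Variables (S : countType) (edge : S -> S -> bool) (a : S).
Notation isloop := (isloop edge a).

Lemma path_word b c n : path_len edge b c n ->
  exists v : seq S, [/\ size v = n, sorted edge (rcons v c) & head c v = b].
Proof.
move=> [w [w0 [wn we]]]; exists (mkseq w n); rewrite size_mkseq; split => //.
  have -> : rcons (mkseq w n) c = mkseq w n.+1.
    by rewrite -wn /mkseq -addn1 iotaD map_cat /= cats1.
  apply/(sortedP b) => i; rewrite size_mkseq ltnS => ni.
  by rewrite !nth_mkseq ?ltnS ?(ltnW ni) //; exact: we.
by case: n wn {we} => [|n] //= wn; rewrite -wn.
Qed.

Lemma loop_path_len v : isloop v -> path_len edge a a (size v).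
Proof.
move=> /andP[/(sortedP a) h /eqP hv]; exists (nth a (rcons v a)); split; last split.
- by case: v hv {h} => //= b v.
- by rewrite nth_rcons ltnn eqxx.
- by move=> i iv; apply: h; rewrite size_rcons ltnS.
Qed.

Lemma path_len_loop n : path_len edge a a n -> exists2 v, isloop v & size v = n.
Proof.
by move=> /path_word[v [<- sv hv]]; exists v; rewrite // /isloop sv hv eqxx.
Qed.

Definition looplen n := exists2 v, isloop v & size v = n.

Lemma looplen0 : looplen 0. Proof. by exists [::]; rewrite ?isloop_nil. Qed.

Lemma looplenD n m : looplen n -> looplen m -> looplen (n + m).
Proof.
by move=> [v lv <-] [w lw <-]; exists (v ++ w); rewrite ?isloop_cat // size_cat.
Qed.

Lemma looplenM k n : looplen n -> looplen (k * n).
Proof.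
by move=> h; elim: k => [|k IH]; [exact: looplen0|rewrite mulSn; exact: looplenD].
Qed.

Variable p : nat.
Hypothesis period_p : is_period edge a p.

Lemma period_dvd v : isloop v -> (p %| size v)%N.
Proof.
case: period_p => _ [h _] lv; have := loop_path_len lv.
by case: (posnP (size v)) => [-> //|v0]; exact: h.
Qed.

(* The least positive difference of two loop lengths divides every loop length, hence
   equals the period. *)
Lemma loop_multiples : exists2 n0, (0 < n0)%N & forall n, (n0 <= n)%N -> looplen (p * n).
Proof.
case: period_p => p0 [pdvd pmax].
pose gap d := `[< (0 < d)%N /\ exists2 y, looplen y & looplen (y + d) >].
have gap_ex : exists d, gap d.
  apply: contrapT => H; suff : (0 %| p)%N by rewrite dvd0n => /eqP e; rewrite e in p0.
  apply: pmax => n n0 /path_len_loop ln; exfalso; apply: H; exists n.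
  by apply/asboolP; split => //; exists 0%N; [exact: looplen0|].
pose d := ex_minn gap_ex.
have [/asboolP[d0 [y ly lyd]] dmin] : gap d /\ forall e, gap e -> (d <= e)%N.
  by rewrite /d; case: ex_minnP.
have dvd x : looplen x -> (d %| x)%N.
  move=> lx; apply: contrapT => /negP; rewrite /dvdn -lt0n => r0.
  have : gap (x %% d)%N.
    apply/asboolP; split => //; exists ((x %/ d) * (y + d))%N; first exact: looplenM.
    have -> : ((x %/ d) * (y + d) + x %% d = x + (x %/ d) * y)%N.
      by rewrite mulnDr -addnA -divn_eq addnC.
    by apply: looplenD => //; exact: looplenM.
  by move/dmin; rewrite leqNgt ltn_pmod.
have dp : d = p.
  apply/eqP; rewrite eqn_dvd; apply/andP; split.
    apply: pmax => n _ /path_len_loop; exact: dvd.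
  have [v lv ev] := ly; have [w lw ew] := lyd.
  have := period_dvd lw; have := period_dvd lv; rewrite ew ev => h.
  by rewrite dvdn_addr.
rewrite dp in lyd; have /dvdnP[k ek] : (p %| y)%N by have [v lv <-] := ly; exact: period_dvd.
exists (k * k).+1 => // n kn.
have [k0|k0] := posnP k.
  by rewrite mulnC; apply: looplenM; rewrite -[p]add0n; move: lyd; rewrite ek k0.
pose q := (n %/ k)%N; pose r := (n %% k)%N.
have en : n = (q * k + r)%N by exact: divn_eq.
have rk : (r < k)%N by rewrite ltn_pmod.
have qk : (k <= q)%N by rewrite leq_divRL //; lia.
have -> : (p * n = (q - r) * y + r * (y + p))%N by rewrite ek en; nia.
by apply: looplenD; exact: looplenM.
Qed.

End LoopLengths.

Section Periodic.
Variables (S : countType) (edge : S -> S -> bool) (R : realType) (a : S).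
Implicit Types (v w : seq S) (f : (nat -> S) -> R).
Notation isloop := (isloop edge a).
Notation isfirst := (isfirst edge a).

Definition per v : nat -> S := fun i => nth a v (i %% size v).

Lemma per_Sigma v : v != [::] -> isloop v -> Sigma edge (per v).
Proof.
move=> v0 /andP[/(sortedP a) h /eqP hv] i; rewrite size_rcons in h.
have sv : (0 < size v)%N by case: (v) v0.
pose j := (i %% size v)%N; have jv : (j < size v)%N by rewrite ltn_pmod.
have := h j; rewrite ltnS jv => /(_ isT); rewrite !nth_rcons jv /per -/j.
rewrite modnS -/j; case: ifP => [j1|j1].
  rewrite (_ : (size v %| i.+1)%N = false) //; apply/negP => /eqP e.
  by move: e; rewrite -addn1 -modnDml -/j addn1 modn_small.
have e : j.+1 = size v by apply/eqP; rewrite eqn_leq jv leqNgt j1.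
rewrite e eqxx /dvdn -addn1 -modnDml -/j addn1 e modnn eqxx nth0.
by case: (v) hv sv => //= b v' ->.
Qed.

Lemma per_agree v (x : nat -> S) : v != [::] -> isloop v -> x 0%N = a ->
  agree (size v + 1) (per v) (glue v x).
Proof.
move=> v0 /andP[_ /eqP hv] xa i; rewrite addn1 ltnS leq_eqVlt => /predU1P[->|iv].
  have := glueEr v x 0; rewrite addn0 xa => ->; rewrite /per modnn nth0.
  by case: (v) hv v0.
by rewrite (glueE _ a) // /per modn_small.
Qed.

Lemma per_set n : (0 < n)%N ->
  set_bij [set v | isloop v && (size v == n)]
    [set x | Sigma edge x /\ iter n (@Defs.shift S) x = x /\ x 0%N = a] per.
Proof.
move=> n0; have nz v : size v = n -> v != [::] by move=> e; apply: contraTneq n0 => v0; rewrite -e v0.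
split.
- move=> v /= /andP[lv /eqP sv]; split; first by apply: per_Sigma => //; exact: nz.
  split; first by apply/funext => i; rewrite iter_shiftE /per sv modnDl.
  by rewrite /per mod0n nth0; case/andP: lv => _ /eqP.
- move=> v w; rewrite !inE /= => /andP[_ /eqP sv] /andP[_ /eqP sw] e.
  apply: (@eq_from_nth _ a); rewrite sv ?sw // => i ni.
  by have := congr1 (fun y => y i) e; rewrite /per sv sw modn_small.
- move=> x /= [sx [px xa]]; exists (mkseq x n).
    rewrite size_mkseq eqxx andbT /isloop; apply/andP; split; last by case: (n) => //= k; rewrite xa.
    have -> : rcons (mkseq x n) a = mkseq x n.+1.
      have xn : x n = a by rewrite -xa -{2}px iter_shiftE addn0.
      by rewrite -xn /mkseq -addn1 iotaD map_cat /= cats1.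
    apply/(sortedP a) => i; rewrite size_mkseq => ni.
    by rewrite !nth_mkseq ?(ltnW ni) //; exact: sx.
  apply/funext => i; rewrite /per size_mkseq nth_mkseq ?ltn_pmod //.
  have pk k j : x (k * n + j)%N = x j.
    elim: k => // k IH; rewrite mulSn -addnA -IH -{2}px iter_shiftE //.
  by rewrite {2}(divn_eq i n) pk.
Qed.

Lemma Zn_words f n : (0 < n)%N -> Zn edge f a n =
  nsum (fun v => if isloop v && (size v == n) then expR (birk f n (per v)) else 0).
Proof.
move=> n0; rewrite (nsum_cond (fun v => isloop v && (size v == n))).
by rewrite /Zn (reindex_esum _ _ _ _ (per_set n0)).
Qed.

Lemma Zstar_words f n : (0 < n)%N -> Zstar edge f a n =
  nsum (fun v => if isfirst v && (size v == n) then expR (birk f n (per v)) else 0).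
Proof.
move=> n0; rewrite (nsum_cond (fun v => isfirst v && (size v == n))).
rewrite /Zstar; apply: reindex_esum; have [h1 h2 h3] := per_set n0.
have fst v : isloop v -> size v = n ->
    isfirst v <-> (forall i, (0 < i)%N -> (i < n)%N -> per v i <> a).
  move=> lv sv; split.
    move=> /and3P[_ _ av] i i0 ni e; move/negP: av; apply.
    rewrite /per sv modn_small // in e; rewrite -e; case: (v) sv ni => [<- //|b t /= <-].
    case: i i0 {e} => // i _; rewrite ltnS => it; exact: mem_nth.
  move=> H; apply/and3P; split => //; first by apply: contraTneq n0 => v0; rewrite -sv v0.
  apply/negP => /(nthP a)[i ib e]; apply: (H i.+1) => //.
    by rewrite -sv; move: ib; rewrite size_behead; case: (size v).
  rewrite /per sv modn_small; first by rewrite -nth_behead.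
  by rewrite -sv; move: ib; rewrite size_behead; case: (size v).
have ll v : isfirst v -> isloop v by case/and3P.
split.
- move=> v /= /andP[fv /eqP sv]; have [|sx [px xa]] := h1 v; first by rewrite /= (ll v) // sv eqxx.
  do 4!split => //; first by rewrite -[n]addn0 -iter_shiftE px.
  by apply/fst => //; exact: ll.
- move=> v w; rewrite !inE /= => /andP[fv sv] /andP[fw sw]; apply: h2; rewrite inE /=.
    by rewrite (ll v).
  by rewrite (ll w).
- move=> x [sx [px [xa [xn H]]]]; have [v /= /andP[lv sv] e] := h3 x (conj sx (conj px xa)).
  by exists v; rewrite // /= sv andbT; apply/(fst v lv (eqP sv)); rewrite e.
Qed.

Section Compare.
Variables (A th : R) (f : (nat -> S) -> R).
Hypothesis th01 : 0 < th < 1.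
Hypothesis A0 : 0 <= A.
Hypothesis fA : var_holder edge A th f.
Let D := A / (1 - th).

Lemma per_distortion v (x : baseX edge a) : v != [::] -> isloop v ->
  `|birk f (size v) (per v) - birk f (size v) (glue v (sval x))| <= D.
Proof.
move=> v0 lv; have [sx xa] := svalP x; have [sg _] := isloop_glue lv (svalP x).
have := birk_distortion th01 A0 fA (n := size v) (l := 1) isT (per_Sigma v0 lv) sg
  (per_agree v0 lv xa).
move/le_trans; apply; case/andP: th01 => t0 t1; rewrite expr1 ler_piMr ?(ltW t1) //.
by rewrite divr_ge0 // subr_ge0 ltW.
Qed.

Let gibbs0 v n x : size v = n -> gibbs f 0 v x = expR (birk f n (glue v x)).
Proof. by move=> <-; rewrite /gibbs mul0r subr0. Qed.

Lemma compare_words (P : pred (seq S)) n (x : baseX edge a) : (0 < n)%N ->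
  (forall v, P v -> isloop v) ->
  (nsum (fun v => if P v && (size v == n) then gibbs f 0 v (sval x) else 0%R) <= (expR D)%:E *
   nsum (fun v => if P v && (size v == n) then expR (birk f n (per v)) else 0%R))%E /\
  (nsum (fun v => if P v && (size v == n) then expR (birk f n (per v)) else 0%R) <= (expR D)%:E *
   nsum (fun v => if P v && (size v == n) then gibbs f 0 v (sval x) else 0%R))%E.
Proof.
move=> n0 PL; have nz v : size v = n -> v != [::] by move=> e; apply: contraTneq n0 => v0; rewrite -e v0.
split; rewrite -nsumZ ?expR_ge0 //; try by (move=> v; case: ifP => // _; exact: expR_ge0).
- apply: le_nsum => v; case: ifP; rewrite ?mulr0 // => /andP[/PL lv /eqP sv].
  rewrite (gibbs0 _ sv) -expRD ler_expR.
  by have := per_distortion x (nz v sv) lv; rewrite sv ler_norml; lra.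
- apply: le_nsum => v; case: ifP; rewrite ?mulr0 // => /andP[/PL lv /eqP sv].
  rewrite (gibbs0 _ sv) -expRD ler_expR.
  by have := per_distortion x (nz v sv) lv; rewrite sv ler_norml; lra.
Qed.

Lemma loopsum_Zn n (x : baseX edge a) : (0 < n)%N ->
  (loopsum edge a f 0%R n (sval x) <= (expR D)%:E * Zn edge f a n)%E /\
  (Zn edge f a n <= (expR D)%:E * loopsum edge a f 0%R n (sval x))%E.
Proof. by move=> n0; rewrite Zn_words //; apply: compare_words. Qed.

Lemma firstsum_Zstar n (x : baseX edge a) : (0 < n)%N ->
  (nsum (fun v => if isfirst v && (size v == n) then gibbs f 0%R v (sval x) else 0%R)
    <= (expR D)%:E * Zstar edge f a n)%E.
Proof.
by move=> n0; rewrite Zstar_words //; apply: (compare_words x n0 _).1 => v /and3P[].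
Qed.

Lemma loopsum_split n m (x : baseX edge a) :
  (nsum (fun w => if isloop w && (size w == m) then gibbs f 0%R w (sval x) else 0%R) *
   loopsum edge a f 0%R n (sval x) <= (expR D)%:E * loopsum edge a f 0%R (n + m)%N (sval x))%E.
Proof.
have dist v : isloop v -> (loopsum edge a f 0%R n (sval x) <=
    (expR D)%:E * loopsum edge a f 0%R n (glue v (sval x)))%E.
  move=> lv; have gx := isloop_glue lv (svalP x); pose y : baseX edge a := exist _ _ gx.
  have xy : agree 1 (sval x) (sval y).
    by case=> // _; have [_ e1] := svalP x; have [_ e2] := gx; exact: etrans e1 (esym e2).
  rewrite -[glue v _]/(sval y) /loopsum -nsumZ ?expR_ge0 //; last first.
    by move=> w; case: ifP => // _; exact: gibbs_ge0.
  apply: le_nsum => w; case: ifP; rewrite ?mulr0 // => /andP[lw _].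
  apply: (le_trans (gibbs_distortion th01 A0 fA 0 (n := 1%N) lw isT xy)); rewrite mulrC.
  rewrite ler_wpM2r ?gibbs_ge0 // ler_expR expr1; case/andP: th01 => t0 t1.
  by rewrite ler_piMr ?(ltW t1) // divr_ge0 // subr_ge0 ltW.
apply: (@le_trans _ _ (\esum_(w in [set w | isloop w && (size w == m)])
   ((expR D)%:E * \esum_(v in [set v | isloop v && (size v == n)])
      (gibbs f 0%R (v ++ w)%SEQ (sval x))%:E))%E).
  apply: (le_trans (nsum_mul_le _ _)).
  - by move=> w; case: ifP => // _; exact: gibbs_ge0.
  - by apply: nsum_ge0 => w; case: ifP => // _; exact: gibbs_ge0.
  rewrite [leRHS]esum_mkcond; apply: le_esum => w _.
  case: (boolP (isloop w && (size w == m))) => [h|h]; last first.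
    rewrite memNset ?mul0e //=; exact/negP.
  rewrite mem_set //; case/andP: h => lw _.
  rewrite -(nsum_cond (fun v => isloop v && (size v == n))).
  apply: (@le_trans _ _ ((gibbs f 0%R w (sval x))%:E *
      ((expR D)%:E * loopsum edge a f 0%R n (glue w (sval x))))%E).
    by rewrite lee_wpmul2l ?lee_fin ?gibbs_ge0 //; exact: dist.
  rewrite muleCA lee_wpmul2l ?lee_fin ?expR_ge0 //.
  rewrite /loopsum -nsumZ ?gibbs_ge0 //; last by move=> v; case: ifP => // _; exact: gibbs_ge0.
  apply: le_nsum => v; case: ifP; rewrite ?mulr0 // => _.
  by rewrite gibbs_cat mulrC.
rewrite esum_ge0_mul ?expR_ge0 //; last first.
  by move=> w _; apply: esum_ge0 => v _; rewrite lee_fin gibbs_ge0.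
rewrite lee_wpmul2l ?lee_fin ?expR_ge0 // esum_esum; last first.
  by move=> w v _ _; rewrite lee_fin gibbs_ge0.
rewrite /loopsum (nsum_cond (fun v => isloop v && (size v == n + m)%N)).
rewrite -(esum_image _ (fun k => k.2 ++ k.1) (fun u => (gibbs f 0%R u (sval x))%:E)); last first.
  move=> [w v] [w' v']; rewrite !inE /= => -[/andP[_ /eqP sw] /andP[_ /eqP sv]].
  move=> [/andP[_ /eqP sw'] /andP[_ /eqP sv']] /eqP; rewrite eqseq_cat ?sv //.
  by move=> /andP[/eqP -> /eqP ->].
apply: le_ereal_sup => _ [X [fX XP] <-]; exists X => //; split => //.
apply: (subset_trans XP) => _ [[w v] /= [/andP[lw /eqP <-] /andP[lv /eqP <-]] <-].
by rewrite isloop_cat //= size_cat.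
Qed.

End Compare.
End Periodic.

Section Pressure.
Variables (S : countType) (edge : S -> S -> bool) (R : realType) (a : S) (p : nat).
Implicit Types (v w : seq S) (f : (nat -> S) -> R).
Notation isloop := (isloop edge a).
Notation isfirst := (isfirst edge a).
Hypothesis period_p : is_period edge a p.

Let p0 : (0 < p)%N. Proof. by case: period_p. Qed.

Lemma Zn_ge0 f n : (0 <= Zn edge f a n)%E.
Proof. by apply: esum_ge0 => x _; rewrite lee_fin expR_ge0. Qed.

Lemma loop_exists : exists v, isloop v && (v != [::]).
Proof.
have [n0 n00 H] := loop_multiples period_p; have [v lv sv] := H n0 (leqnn _).
exists v; rewrite lv; apply: contraTneq n00 => v0; move: sv; rewrite v0 => /eqP.
by rewrite eq_sym muln_eq0 => /orP[/eqP e|/eqP ->//]; move: p0; rewrite e.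
Qed.

Lemma base_inhabited : inhabited (baseX edge a).
Proof.
have [v /andP[lv v0]] := loop_exists.
have h : Sigma edge (per a v) /\ per a v 0%N = a.
  split; first exact: per_Sigma v0 lv.
  by rewrite /per mod0n nth0; case/andP: lv => _ /eqP.
exact: inhabits (exist _ _ h).
Qed.

Lemma first_inhabited : inhabited (firstW edge a).
Proof.
have [v /andP[lv v0]] := loop_exists; have [_ [w [_ fw _]]] := isloop_split lv v0.
exact: inhabits (exist _ w fw).
Qed.

Lemma loopsum_period f n x : ~~ (p %| n)%N -> loopsum edge a f 0%R n x = 0%E.
Proof.
move=> pn; rewrite -[RHS](@nsum0 R (seq S)); congr nsum; apply/funext => v.
case: ifP => // /andP[lv /eqP sv]; move/negP: pn; case; rewrite -sv.
exact: (period_dvd period_p lv).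
Qed.

Lemma Zn_bound f M n : (0 < n)%N -> (forall x, Sigma edge x -> f x <= M) ->
  (Zn edge f a n <= (expR (M * n%:R))%:E * Zn edge (fun=> 0%R : R) a n)%E.
Proof.
move=> n0 fM; rewrite !Zn_words // -nsumZ ?expR_ge0 //; last first.
  by move=> v; case: ifP => // _; exact: expR_ge0.
apply: le_nsum => v; case: ifP; rewrite ?mulr0 // => /andP[lv /eqP sv].
have v0 : v != [::] by apply: contraTneq n0 => e; rewrite -sv e.
have -> : birk (fun=> 0 : R) n (per a v) = 0 by apply: big1.
rewrite expR0 mulr1 ler_expR /birk mulr_natr -[n in leRHS]card_ord -sumr_const.
by apply: ler_sum => i _; apply: fM; apply: Sigma_iter_shift; exact: per_Sigma.
Qed.

Section Potential.
Variables (A th : R) (f : (nat -> S) -> R).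
Hypothesis th01 : 0 < th < 1.
Hypothesis A0 : 0 <= A.
Hypothesis fA : var_holder edge A th f.
Let D := A / (1 - th).

Lemma Zn_super n m : (0 < n)%N -> (0 < m)%N ->
  (Zn edge f a n * Zn edge f a m <= (expR (4 * D))%:E * Zn edge f a (n + m)%N)%E.
Proof.
move=> n0 m0; have [x] := base_inhabited.
have [_ h1] := loopsum_Zn th01 A0 fA x n0; have [_ h2] := loopsum_Zn th01 A0 fA x m0.
have h3 := loopsum_split th01 A0 fA n m x.
have nm0 : (0 < n + m)%N by rewrite addn_gt0 n0.
have [h4 _] := loopsum_Zn th01 A0 fA x nm0.
have e0 : (0 <= (expR D)%:E)%E by rewrite lee_fin expR_ge0.
apply: (le_trans (lee_pmul (Zn_ge0 f n) (Zn_ge0 f m) h1 h2)).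
rewrite muleACA [X in (_ * X)%E]muleC.
apply: (@le_trans _ _ ((expR D)%:E * (expR D)%:E * ((expR D)%:E * ((expR D)%:E * Zn edge f a (n + m)%N)))%E).
  apply: lee_wpmul2l; first by rewrite mule_ge0.
  by apply: (le_trans h3); apply: lee_wpmul2l.
rewrite !muleA -!EFinM -!expRD.
by rewrite (_ : D + D + D + D = 4 * D) //; ring.
Qed.

Lemma Zn_pos n : looplen edge a n -> (0 < n)%N -> (0 < Zn edge f a n)%E.
Proof.
move=> [v lv sv] n0; rewrite Zn_words //; apply: lt_le_trans (nsum_ge_term _ v).
by rewrite lv sv eqxx lte_fin expR_gt0.
Qed.

End Potential.

Hypothesis PG0 : (PG edge (fun=> 0%R : R) p a < +oo)%E.

Lemma entropy_bound : exists h : R, forall n, (0 < n)%N ->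
  (Zn edge (fun=> 0%R : R) a (p * n) <= (expR (h * n%:R))%:E)%E.
Proof.
have th01 : 0 < (2^-1 : R) < 1 by rewrite invr_gt0 invf_lt1 ?ltr0n ?ltr1n.
have H0 : var_holder edge 0 2^-1 (fun=> 0 : R).
  by move=> n x y _ _ _ _; rewrite subrr normr0 mul0r.
have [n0 n00 H] := loop_multiples period_p.
apply: (@growth_bounded R (fun n => Zn edge (fun=> 0%R : R) a (p * n)) p n0
   (4 * (0 / (1 - 2^-1))) p0 n00) => //.
- by move=> n m np mp; rewrite mulnDr; apply: Zn_super; rewrite ?muln_gt0 ?p0.
- move=> n n0n; apply: Zn_pos; first exact: H.
  by rewrite muln_gt0 p0 (leq_trans n00).
- by move=> n; exact: Zn_ge0.
Qed.

Section PressureValue.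
Variables (A th M : R) (f : (nat -> S) -> R).
Hypothesis th01 : 0 < th < 1.
Hypothesis A0 : 0 <= A.
Hypothesis fA : var_holder edge A th f.
Hypothesis fM : forall x, Sigma edge x -> f x <= M.

Lemma pressure_value : exists P : R, [/\ PG edge f p a = P%:E,
  exists2 C : R, 0 <= C & forall (x : baseX edge a) n,
    (loopsum edge a f 0%R n (sval x) <= (C * expR (P * n%:R))%:E)%E,
  forall e, 0 < e -> exists N, forall n, (N <= n)%N ->
     ((expR ((P - e) * (p * n)%:R))%:E <= Zn edge f a (p * n))%E &
  forall n, (0 < n)%N -> (Zn edge f a (p * n) < +oo)%E].
Proof.
have [h Hh] := entropy_bound; have [n0 n00 H] := loop_multiples period_p.
have ub n : (0 < n)%N -> (Zn edge f a (p * n) <= (expR ((M * p%:R + h) * n%:R))%:E)%E.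
  move=> np; apply: le_trans (Zn_bound _ fM) _; first by rewrite muln_gt0 p0.
  apply: (@le_trans _ _ ((expR (M * (p * n)%:R))%:E * (expR (h * n%:R))%:E)%E).
    by apply: lee_wpmul2l (Hh n np); rewrite lee_fin expR_ge0.
  rewrite -EFinM lee_fin -expRD ler_expR natrM; lra.
have [] := @growth_rate R (fun n => Zn edge f a (p * n)) p n0 (4 * (A / (1 - th))) p0 n00
  _ _ _ _ ub.
- by move=> n m np mp; rewrite mulnDr; apply: Zn_super; rewrite ?muln_gt0 ?p0.
- move=> n n0n; apply: Zn_pos; first exact: H.
  by rewrite muln_gt0 p0 (leq_trans n00).
- by move=> n; exact: Zn_ge0.
move=> P [e1 [C C0 HC] e3]; exists P; split => //; last first.
  by move=> n np; apply: le_lt_trans (ub n np) _; rewrite ltry.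
have E0 : 0 <= expR (A / (1 - th)) * C by rewrite mulr_ge0 ?expR_ge0.
exists (expR (A / (1 - th)) * C + 1); first by rewrite addr_ge0.
move=> x n; have [->|np] := posnP n.
  by rewrite loopsum0 mulr0 expR0 mulr1 lee_fin lerDr.
have [/dvdnP[k ek]|pn] := boolP (p %| n)%N; last first.
  by rewrite loopsum_period // lee_fin mulr_ge0 ?expR_ge0 // addr_ge0.
have kp : (0 < k)%N by move: np; rewrite ek; case: (k).
have [h1 _] := loopsum_Zn th01 A0 fA x np.
apply: (le_trans h1); rewrite {1}ek mulnC.
apply: (@le_trans _ _ ((expR (A / (1 - th)))%:E * (C * expR (P * (p * k)%:R))%:E)%E).
  by apply: lee_wpmul2l (HC k kp); rewrite lee_fin expR_ge0.
rewrite -EFinM lee_fin mulrA ek mulnC ler_wpM2r ?expR_ge0 //; lra.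
Qed.

Hypothesis spr : SPR edge f p a.

(* Strong positive recurrence makes the first-return sums converge at a rate strictly
   below the pressure, leaving room for the weight exp(eps |w|). *)
Lemma first_return_tail P : PG edge f p a = P%:E -> exists eps M1 : R, [/\ 0 < eps, 0 <= M1 &
  forall x : baseX edge a, (nsum (fun w : firstW edge a =>
    gibbs f P (val w) (sval x) * expR (eps * (size (val w))%:R))%R <= M1%:E)%E].
Proof.
move=> PE; have [P2 [P2E _ _ Zfin]] := pressure_value.
have [P' P'P [N HN]] : exists2 P' : R, P' < P & exists N, forall n, (N <= n)%N -> (0 < n)%N ->
    (Zstar edge f a (p * n) <= (expR (P' * (p * n)%:R))%:E)%E.
  have := spr; rewrite /SPR PE /limn_esup /limf_esup => /ereal_inf_lt[_ [V [N _ NV] <-]] hV.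
  have [r [hr rP]] : exists r : R,
      (ereal_sup [set (lne (Zstar edge f a (p * n.+1)) * ((p * n.+1)%:R^-1)%:E)%E | n in V]
         <= r%:E)%E /\ r < P.
    move: hV; case: ereal_sup => [r| |] //= hr; first by exists r.
    by exists (P - 1); split; [rewrite leNye|lra].
  exists r => //; exists N.+1 => -[//|n] Nn _.
  have : (lne (Zstar edge f a (p * n.+1)) * ((p * n.+1)%:R^-1)%:E <= r%:E)%E.
    apply: le_trans hr; apply: ereal_sup_ubound; exists n => //; exact: NV.
  have pR : 0 < (p * n.+1)%:R :> R by rewrite ltr0n muln_gt0 p0.
  have Z0 : (0 <= Zstar edge f a (p * n.+1))%E.
    by apply: esum_ge0 => x _; rewrite lee_fin expR_ge0.
  move: Z0; case: (Zstar _ _ _ _) => [z| |] //.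
    rewrite lee_fin le_eqVlt => /predU1P[<- _|z0]; first by rewrite lee_fin expR_ge0.
    rewrite lne_EFin // -EFinM !lee_fin ler_pdivrMr // -ler_expR lnK //.
  by rewrite /= gt0_mulye ?lte_fin ?invr_gt0.
have fin n : (0 < n)%N -> (Zstar edge f a (p * n) < +oo)%E.
  move=> np; apply: le_lt_trans (Zfin n np); rewrite Zstar_words ?muln_gt0 ?p0 //.
  rewrite Zn_words ?muln_gt0 ?p0 //; apply: le_nsum => v.
  case: (boolP (isfirst v)) => /= [/and3P[_ -> _] //|_].
  by case: ifP => // _; exact: expR_ge0.
pose B := \sum_(i < N) fine (Zstar edge f a (p * i)) * expR (- (P' * (p * i)%:R)).
have Z0 n : 0 <= fine (Zstar edge f a n).
  by apply: fine_ge0; apply: esum_ge0 => x _; rewrite lee_fin expR_ge0.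
have B0 : 0 <= B by apply: sumr_ge0 => i _; rewrite mulr_ge0 ?expR_ge0.
have Zb n : (0 < n)%N -> (Zstar edge f a (p * n) <= ((1 + B) * expR (P' * (p * n)%:R))%:E)%E.
  move=> np; have [Nn|nN] := leqP N n.
    apply: (le_trans (HN n Nn np)); rewrite lee_fin ler_peMl ?expR_ge0 //; lra.
  have zf : Zstar edge f a (p * n) \is a fin_num.
    by rewrite ge0_fin_numE ?fin //; apply: esum_ge0 => x _; rewrite lee_fin expR_ge0.
  rewrite -(fineK zf) lee_fin mulrDl ler_wpDl ?mulr_ge0 ?expR_ge0 //.
  rewrite -[leLHS]mulr1 -[X in _ * X]expR0 -(addNr (P' * (p * n)%:R)) expRD mulrA.
  rewrite ler_wpM2r ?expR_ge0 // /B (bigD1 (Ordinal nN)) //= lerDl.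
  by apply: sumr_ge0 => i _; rewrite mulr_ge0 ?expR_ge0.
pose eps := (P - P') / 2; pose r := expR (- eps).
have eps0 : 0 < eps by rewrite divr_gt0 // subr_gt0.
have r01 : 0 <= r < 1 by rewrite expR_ge0 /= -expR0 ltr_expR oppr_lt0.
pose D := A / (1 - th); pose C := expR D * (1 + B).
have C0 : 0 <= C by rewrite mulr_ge0 ?expR_ge0 //; lra.
exists eps, (C / (1 - r)); split => //.
  by rewrite divr_ge0 // subr_ge0 ltW //; case/andP: r01.
move=> x; pose F v := if isfirst v then gibbs f P v (sval x) * expR (eps * (size v)%:R) else 0.
have F0 v : 0 <= F v by rewrite /F; case: ifP => // _; rewrite mulr_ge0 ?expR_ge0.
have -> : nsum (fun w : firstW edge a =>
    gibbs f P (val w) (sval x) * expR (eps * (size (val w))%:R)) = nsum F.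
  rewrite /F (nsum_cond isfirst).
  by rewrite (reindex_esum [set: firstW edge a] _ val).
apply: nsum_by_size => // n.
have [->|np] := posnP n.
  rewrite (_ : (fun v => _) = (fun=> 0)) ?nsum0 ?lee_fin ?expr0 ?mulr1 //.
  by apply/funext => v; rewrite /F; case: v => //=.
rewrite (_ : (fun v => _) = (fun v => expR ((eps - P) * n%:R) *
   (if isfirst v && (size v == n) then gibbs f 0 v (sval x) else 0))); last first.
  apply/funext => v; rewrite /F; case: eqP => [sv|_]; rewrite ?andbF ?mulr0 // andbT.
  case: ifP => _; rewrite ?mulr0 // (gibbs_rate _ _ 0) sub0r -sv -mulrA -expRD mulrC.
  by congr (expR _ * _); ring.
rewrite nsumZ ?expR_ge0 //; last by move=> v; case: ifP => // _; exact: gibbs_ge0.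
have e0 : (0 <= (expR ((eps - P) * n%:R))%:E)%E by rewrite lee_fin expR_ge0.
have [/dvdnP[k ek]|pn] := boolP (p %| n)%N; last first.
  rewrite (_ : (fun v => _) = (fun=> 0)); last first.
    apply/funext => v; case: ifP => // /andP[/and3P[_ lv _] /eqP sv].
    by move/negP: pn; case; rewrite -sv; exact: (period_dvd period_p lv).
  by rewrite nsum0 mule0 lee_fin mulr_ge0 // exprn_ge0 //; case/andP: r01.
have kp : (0 < k)%N by move: np; rewrite ek; case: (k).
apply: (@le_trans _ _ ((expR ((eps - P) * n%:R))%:E *
   ((expR D)%:E * ((1 + B) * expR (P' * n%:R))%:E))%E).
  apply: lee_wpmul2l => //; apply: (le_trans (firstsum_Zstar th01 A0 fA x np)).
  by apply: lee_wpmul2l; rewrite ?lee_fin ?expR_ge0 // ek mulnC; exact: Zb.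
rewrite -!EFinM lee_fin /C /r -expRM_natr.
have -> : - eps * n%:R = (eps - P) * n%:R + P' * n%:R by rewrite /eps; field.
rewrite expRD le_eqVlt; apply/orP; left; apply/eqP; ring.
Qed.

End PressureValue.
End Pressure.

(** * Entropy of finite partitions *)

Section FiniteValued.
Variables (d : measure_display) (T : measurableType d) (R : realType) (mu : probability T R).

Definition fin_meas (J : finType) (F : T -> J) : Prop :=
  forall j, measurable (F @^-1` [set j]).
Definition law (J : finType) (F : T -> J) (j : J) : R := fine (mu (F @^-1` [set j])).

Section OneMap.
Variables (J : finType) (F : T -> J).
Hypothesis mF : fin_meas F.

Lemma mu_fin A : measurable A -> mu A \is a fin_num.
Proof. by move=> mA; exact: fin_num_measure. Qed.

Lemma law_ge0 j : 0 <= law F j.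
Proof. exact: fine_ge0. Qed.

Lemma lawE j : mu (F @^-1` [set j]) = (law F j)%:E.
Proof. by rewrite /law fineK // mu_fin. Qed.

Let indicE (u : J -> R) x :
  (u (F x))%:E = (\sum_(j : J) (u j)%:E * (\1_(F @^-1` [set j]) x)%:E)%E.
Proof.
rewrite (bigD1 (F x)) //= big1 ?adde0.
  by rewrite indicE mem_set // mule1.
by move=> j jF; rewrite indicE memNset ?mule0 //= => e; rewrite e eqxx in jF.
Qed.

Let iterm (u : J -> R) j :
  mu.-integrable setT (fun x => ((u j)%:E * (\1_(F @^-1` [set j]) x)%:E)%E).
Proof.
by apply: integrableZl => //; apply: integrable_indic.
Qed.

Lemma fin_integrable (u : J -> R) : mu.-integrable setT (EFin \o (fun x => u (F x))).
Proof.
rewrite (_ : EFin \o _ = (fun x => \sum_(j : J) (u j)%:E * (\1_(F @^-1` [set j]) x)%:E)%E).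
  by apply: integrable_sum => // j; exact: iterm.
by apply/funext => x; exact: indicE.
Qed.

Lemma fin_integral (u : J -> R) : (\int[mu]_x (u (F x)))%R = \sum_j u j * law F j.
Proof.
rewrite /Rintegral; under eq_integral do rewrite indicE.
rewrite integral_sum //.
rewrite (eq_bigr (fun j => (u j * law F j)%:E)) ?sumEFin // => j _.
rewrite integralZl //; last exact: integrable_indic.
by rewrite integral_indic // setIT EFinM; congr (_ * _)%E; exact: lawE.
Qed.

Lemma sum_law : \sum_j law F j = 1.
Proof.
have := fin_integral (fun=> 1); rewrite Rintegral_cst //= probability_setT mulr1 => ->.
by apply: eq_bigr => j _; rewrite mul1r.
Qed.

Lemma law_le1 j : law F j <= 1.
Proof. by rewrite -lee_fin -lawE; exact: probability_le1. Qed.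

End OneMap.

Lemma fin_meas_comp (J J' : finType) (F : T -> J) (h : J -> J') :
  fin_meas F -> fin_meas (h \o F).
Proof.
move=> mF j'; rewrite (_ : _ @^-1` _ = \bigcup_(j in [set j | h j = j']) (F @^-1` [set j])).
  apply: fin_bigcup_measurable => //; exact: finite_finset.
apply/seteqP; split => [x /= e|x [j /= <- ->] //].
by exists (F x).
Qed.

Lemma sum_law_comp (J J' : finType) (F : T -> J) (h : J -> J') (u : J' -> R) : fin_meas F ->
  \sum_j law F j * u (h j) = \sum_j law (h \o F) j * u j.
Proof.
move=> mF; under eq_bigr do rewrite mulrC; under [RHS]eq_bigr do rewrite mulrC.
rewrite -(fin_integral mF (fun j => u (h j))).
by rewrite -(fin_integral (fin_meas_comp h mF) u).
Qed.

End FiniteValued.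

Section Gibbs.
Variable R : realType.

Lemma ln_le_sub1 (x : R) : 0 < x -> ln x <= x - 1.
Proof. by move=> x0; have := @le_ln1Dx R (x - 1); rewrite (_ : 1 + (x - 1) = x); [apply|]; lra. Qed.

Lemma gibbs_inequality (J : finType) (P Q : J -> R) : (forall j, 0 <= P j) ->
  \sum_j P j = 1 -> (forall j, 0 <= Q j) -> \sum_j Q j <= 1 ->
  (forall j, 0 < P j -> 0 < Q j) -> \sum_j entf (P j) <= \sum_j P j * - ln (Q j).
Proof.
move=> P0 P1 Q0 Q1 PQ.
suff : \sum_j (entf (P j) - P j * - ln (Q j)) <= \sum_j (Q j - P j).
  by rewrite !sumrB P1; lra.
apply: ler_sum => j _; have := P0 j; rewrite le_eqVlt => /predU1P[<-|p0].
  by rewrite /entf !mul0r !oppr0 !addr0.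
have q0 := PQ j p0; have h := ln_le_sub1 (divr_gt0 q0 p0).
rewrite ln_div ?posrE // in h; rewrite /entf.
have : P j * (ln (Q j) - ln (P j)) <= P j * (Q j / P j - 1) by rewrite ler_wpM2l // ltW.
have -> : P j * (Q j / P j - 1) = Q j - P j by field; rewrite gt_eqF.
lra.
Qed.

Lemma entf_ge0 (t : R) : 0 <= t <= 1 -> 0 <= entf t.
Proof.
move=> /andP[t0 t1]; rewrite /entf oppr_ge0 mulr_ge0_le0 //; exact: ln_le0.
Qed.

End Gibbs.

Section SequenceSpace.
Variables (S : countType) (a : S) (R : realType).
Implicit Types (x y : nat -> S).
Notation T := (seqT a).

Definition rdet (r : nat) (B : set (nat -> S)) : Prop :=
  forall x y, agree r x y -> B x -> B y.

Lemma cyl_measurable n (w : nat -> S) :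
  measurable ([set x | forall i, (i < n)%N -> x i = w i] : set T).
Proof. by apply: sub_sigma_algebra; exists n, w. Qed.

Lemma rdet_measurable r B : rdet r B -> measurable (B : set T).
Proof.
move=> Br; rewrite (_ : B = \bigcup_(u : seq S)
  (if `[< B (nth a u) >] then [set x | forall i, (i < r)%N -> x i = nth a u i] else set0)).
  apply: countable_bigcupT_measurable => // u.
  by case: ifP => // _; exact: cyl_measurable.
apply/seteqP; split => [x Bx|x [u _]].
  have xe : agree r x (nth a (mkseq x r)) by move=> i ir; rewrite nth_mkseq.
  exists (mkseq x r) => //; rewrite ifT; first exact: xe.
  by apply/asboolP; exact: Br xe Bx.
case: ifP => // /asboolP Bu xu; apply: Br Bu => i ir; by rewrite xu.
Qed.

Lemma shift_measurable : measurable_fun setT (@Defs.shift S : T -> T).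
Proof.
apply: (@measurability _ _ T T setT _ (@cyl_sets S a)) => // _ [_ [n [w ->]] <-].
rewrite setTI; apply: (@rdet_measurable n.+1) => x y xy /= h i ni.
by rewrite -h // /Defs.shift xy.
Qed.

Lemma iter_shift_measurable k : measurable_fun setT (iter k (@Defs.shift S) : T -> T).
Proof.
elim: k => [|k IH]; first exact: measurable_id.
exact: (measurableT_comp shift_measurable IH).
Qed.

Lemma preimage_iter_measurable k (A : set T) : measurable A ->
  measurable (iter k (@Defs.shift S) @^-1` A : set T).
Proof. by move=> mA; rewrite -[X in measurable X]setTI; exact: iter_shift_measurable. Qed.

Lemma Sigma_measurable edge : measurable (Sigma edge : set T).
Proof.
rewrite (_ : Sigma edge = \bigcap_i [set x | edge (x i) (x i.+1)]).
  apply: bigcapT_measurable => i; apply: (@rdet_measurable i.+2) => x y xy /=.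
  by rewrite -!xy.
by apply/seteqP; split => [x h i _|x h i]; [exact: h|exact: h].
Qed.

Lemma continuous_measurable edge (f : (nat -> S) -> R) (th A : R) : 0 < th < 1 ->
  var_holder edge A th f -> measurable_fun (Sigma edge : set T) (f : T -> R).
Proof.
move=> /andP[th0 th1] fA.
move=> mS; apply: (measurability _ (RGenOInfty.measurableE R)) => // _ [_ [r ->] <-].
rewrite (_ : _ `&` _ = Sigma edge `&` \bigcup_n
    [set x | forall y, Sigma edge y -> agree n x y -> r < f y]).
  apply: measurableI; first exact: Sigma_measurable.
  apply: bigcupT_measurable => n; apply: (@rdet_measurable n) => x y xy /= h z sz yz.
  by apply: h => // i ni; rewrite xy // yz.
apply/seteqP; split => [x [sx]|x [sx [n _ h]]]; last first.
  by split => //; rewrite /= in_itv /= andbT; exact: h.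
rewrite /= in_itv /= andbT => rx; split => //.
have [N HN] : exists N, (2 <= N)%N /\ A * th ^+ N < f x - r.
  have : A * th ^+ n @[n --> \oo] --> A * 0.
    by apply: cvgMr; apply: cvg_expr; rewrite ger0_norm // ltW.
  rewrite mulr0 => /cvgrPdist_lt /(_ (f x - r)); rewrite subr_gt0 => /(_ rx)[N _ H].
  exists (maxn N 2); split; first exact: leq_maxr.
  have := H (maxn N 2) (leq_maxl _ _); rewrite sub0r normrN => /(le_lt_trans _); apply.
  exact: ler_norm.
exists N => // y sy xy; have := fA N x y HN.1 sx sy xy; rewrite ler_norml; have := HN.2; lra.
Qed.

End SequenceSpace.

Section PartitionEntropy.
Variables (S : countType) (a : S) (R : realType) (mu : probability (seqT a) R).
Notation T := (seqT a).
Hypothesis mu_inv : forall A : set T, measurable A -> mu (@Defs.shift S @^-1` A) = mu A.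

Lemma iter_invariant n (A : set T) : measurable A -> mu (iter n (@Defs.shift S) @^-1` A) = mu A.
Proof.
move=> mA; elim: n => // n IH.
rewrite -IH -(mu_inv (preimage_iter_measurable n mA)); congr (mu _).
by apply/seteqP; split => x; rewrite /preimage /= -iterS iterSr.
Qed.

Variables (k : nat) (f : T -> 'I_k).
Hypothesis pf : is_fin_partition f.

Definition itinerary n (x : T) : {ffun 'I_n -> 'I_k} := [ffun j : 'I_n => f (iter j (@Defs.shift S) x)].

Lemma itinerary_meas n : fin_meas (itinerary n).
Proof.
move=> w; rewrite (_ : _ @^-1` _ =
   \bigcap_(j in [set: 'I_n]) (iter j (@Defs.shift S) @^-1` (f @^-1` [set w j]))).
  apply: fin_bigcap_measurable => [|j _]; first exact: finite_finset.
  exact: (preimage_iter_measurable j (pf (w j))).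
apply/seteqP; split => [x /= <- j _|x /= H]; first by rewrite /itinerary ffunE.
by apply/ffunP => j; rewrite ffunE; exact: H.
Qed.

Arguments itinerary_meas : clear implicits.

Lemma HjoinE n : Hjoin mu f n = \sum_w entf (law mu (itinerary n) w).
Proof.
apply: eq_bigr => w _; congr (entf (fine (mu _))).
apply/seteqP; split => [x /= H|x /= <- j]; last by rewrite ffunE.
by apply/ffunP => j; rewrite ffunE.
Qed.

Lemma Hjoin_ge0 n : 0 <= Hjoin mu f n.
Proof.
rewrite HjoinE; apply: sumr_ge0 => w _; apply: entf_ge0.
by rewrite law_ge0 (law_le1 _ (itinerary_meas n)).
Qed.

Definition ffun_left n m (w : {ffun 'I_(n + m) -> 'I_k}) : {ffun 'I_n -> 'I_k} :=
  [ffun j => w (lshift m j)].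
Definition ffun_right n m (w : {ffun 'I_(n + m) -> 'I_k}) : {ffun 'I_m -> 'I_k} :=
  [ffun j => w (rshift n j)].

Lemma sum_ffun_split n m (F : {ffun 'I_n -> 'I_k} -> R) (G : {ffun 'I_m -> 'I_k} -> R) :
  \sum_w F (@ffun_left n m w) * G (ffun_right w) = (\sum_v F v) * (\sum_v G v).
Proof.
rewrite big_distrlr /= pair_big /=.
pose h (q : {ffun 'I_n -> 'I_k} * {ffun 'I_m -> 'I_k}) : {ffun 'I_(n + m) -> 'I_k} :=
  [ffun i => match fintype.split i with inl j => q.1 j | inr j => q.2 j end].
have hl q : ffun_left (h q) = q.1.
  by apply/ffunP => j; rewrite !ffunE (unsplitK (inl j)).
have hr q : ffun_right (h q) = q.2.
  by apply/ffunP => j; rewrite !ffunE (unsplitK (inr j)).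
rewrite (reindex h) /=; first by apply: eq_bigr => q _; rewrite hl hr.
exists (fun w => (ffun_left w, ffun_right w)) => [q _|w _].
  by rewrite hl hr; case: q.
apply/ffunP => i; rewrite ffunE; case: (splitP i) => j e; rewrite ffunE; congr (w _); exact: val_inj.
Qed.

Lemma itinerary_left n m : @ffun_left n m \o itinerary (n + m) = itinerary n.
Proof. by apply/funext => x; apply/ffunP => j; rewrite !ffunE. Qed.

Lemma itinerary_right n m :
  @ffun_right n m \o itinerary (n + m) = itinerary m \o iter n (@Defs.shift S).
Proof. by apply/funext => x; apply/ffunP => j; rewrite !ffunE /= addnC iterD. Qed.

Lemma law_shift n m : law mu (itinerary m \o iter n (@Defs.shift S)) = law mu (itinerary m).
Proof.
apply/funext => w; rewrite /law -(iter_invariant n (itinerary_meas m w)) //.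
Qed.

Lemma Hjoin_subadd n m : Hjoin mu f (n + m) <= Hjoin mu f n + Hjoin mu f m.
Proof.
pose P := law mu (itinerary (n + m)).
have mI := itinerary_meas (n + m).
have lE : law mu (@ffun_left n m \o itinerary (n + m)) = law mu (itinerary n).
  by rewrite itinerary_left.
have rE : law mu (@ffun_right n m \o itinerary (n + m)) = law mu (itinerary m).
  by rewrite itinerary_right law_shift.
pose Q w := law mu (itinerary n) (ffun_left w) * law mu (itinerary m) (@ffun_right n m w).
have mono (J : finType) (h : {ffun 'I_(n + m) -> 'I_k} -> J) w :
    P w <= law mu (h \o itinerary (n + m)) (h w).
  apply: fine_le; try by apply: mu_fin; try exact: (fin_meas_comp h mI).
  apply: le_measure; rewrite ?inE //; first exact: (fin_meas_comp h mI).
  by move=> x /= ->.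
have Ppos w : 0 < P w -> 0 < law mu (itinerary n) (ffun_left w) /\
    0 < law mu (itinerary m) (@ffun_right n m w).
  move=> p0; split; apply: (lt_le_trans p0).
    by rewrite -lE; exact: mono.
  by rewrite -rE; exact: mono.
have h1 : Hjoin mu f (n + m) <= \sum_w P w * - ln (Q w).
  rewrite HjoinE; apply: gibbs_inequality.
  - by move=> w; exact: law_ge0.
  - exact: sum_law.
  - by move=> w; rewrite mulr_ge0 ?law_ge0.
  - by rewrite sum_ffun_split !sum_law ?mulr1 //; exact: itinerary_meas.
  - by move=> w /Ppos[l0 r0]; rewrite mulr_gt0.
apply: (le_trans h1).
have -> : \sum_w P w * - ln (Q w) =
   \sum_w (P w * - ln (law mu (itinerary n) (ffun_left w)) +
           P w * - ln (law mu (itinerary m) (@ffun_right n m w))).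
  apply: eq_bigr => w _; have := @law_ge0 _ _ _ mu _ (itinerary (n + m)) w.
  rewrite -/P le_eqVlt => /predU1P[<-|/Ppos[l0 r0]]; first by rewrite !mul0r addr0.
  by rewrite /Q lnM ?posrE //; ring.
rewrite big_split /= /P.
rewrite (sum_law_comp mu (@ffun_left n m) (fun v => - ln (law mu (itinerary n) v)) mI).
rewrite (sum_law_comp mu (@ffun_right n m) (fun v => - ln (law mu (itinerary m) v)) mI).
rewrite lE rE !HjoinE le_eqVlt; apply/orP; left; apply/eqP.
by congr (_ + _); apply: eq_bigr => v _; rewrite /entf mulrN.
Qed.

Lemma hpart_spec : (forall n, (0 < n)%N -> hpart mu f * n%:R <= Hjoin mu f n) /\
  (forall e, 0 < e -> exists N, forall n, (N <= n)%N -> Hjoin mu f n <= (hpart mu f + e) * n%:R).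
Proof.
have sup n m : (0 <= n)%N -> (0 <= m)%N ->
    - Hjoin mu f n + - Hjoin mu f m <= - Hjoin mu f (n + m).
  by move=> _ _; have := Hjoin_subadd n m; lra.
have ub n : (0 <= n)%N -> - Hjoin mu f n <= 0 * n%:R.
  by move=> _; rewrite mul0r oppr_le0 Hjoin_ge0.
have [l [lim upper lower]] := fekete_lim sup ub.
have hl : hpart mu f = - l.
  apply/cvg_lim => //.
  rewrite (_ : (fun n => _) = (fun n => - (- Hjoin mu f n.+1 / n.+1%:R))); first exact: cvgN.
  by apply/funext => n; rewrite mulNr opprK.
split => [n n0|e e0]; first by have := upper n isT n0; rewrite hl; lra.
have [N HN] := lower e e0; exists N => n Nn; have := HN n Nn; rewrite hl; lra.
Qed.

End PartitionEntropy.

(** * Entropy plus integral is at most the growth rate *)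

Section Approximation.
Variables (S : countType) (a : S) (R : realType) (mu : probability (seqT a) R).
Notation T := (seqT a).
Implicit Types A B C : set T.

Lemma small_tail (E : nat -> set T) (e : R) : 0 < e -> (forall n, measurable (E n)) ->
  (forall n m, (n <= m)%N -> E m `<=` E n) -> \bigcap_n E n = set0 ->
  exists n, (mu (E n) <= e%:E)%E.
Proof.
move=> e0 mE decr E0.
have : (mu \o E) x @[x --> \oo] --> mu (\bigcap_n E n).
  apply: nonincreasing_cvg_mu => //.
  - by apply: le_lt_trans (probability_le1 mu (mE 0%N)) _; rewrite ltry.
  - by rewrite E0.
  - by move=> n m nm; apply/subsetPset; exact: decr.
rewrite E0 measure0 => /fine_cvgP[_ /cvgrPdist_le /(_ e e0)[N _ HN]].
exists N; have := HN N (leqnn N); rewrite /= sub0r normrN => h.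
rewrite -[mu (E N)]fineK ?mu_fin // lee_fin; exact: le_trans (ler_norm _) h.
Qed.

Definition symd A B : set T := (A `\` B) `|` (B `\` A).

Lemma symd_measurable A B : measurable A -> measurable B -> measurable (symd A B).
Proof. by move=> mA mB; apply: measurableU; exact: measurableD. Qed.

Lemma symd_trans A B C : symd A C `<=` symd A B `|` symd B C.
Proof.
move=> x; rewrite /symd /=; have [Bx|Bx] := pselect (B x); tauto.
Qed.

Definition approximable A : Prop := measurable A /\ forall e : R, 0 < e ->
  exists r B, rdet r B /\ (mu (symd A B) <= e%:E)%E.

Lemma rdet_le r r' (B : set (nat -> S)) : (r <= r')%N -> rdet r B -> rdet r' B.
Proof. by move=> rr h x y xy; apply: h; exact: agree_le xy. Qed.

Lemma approximableC A : approximable A -> approximable (~` A).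
Proof.
move=> [mA H]; split; first exact: measurableC.
move=> e e0; have [r [B [rB hB]]] := H e e0; exists r, (~` B); split.
  by move=> x y xy /= nB Bx; apply: nB; apply: rB Bx; exact: agree_sym.
rewrite (_ : symd _ _ = symd A B) //.
apply/seteqP; split=> x; rewrite /symd /=; have [Bx|Bx] := pselect (B x); have [Ax|Ax] := pselect (A x); tauto.
Qed.

Lemma approximableU A B : approximable A -> approximable B -> approximable (A `|` B).
Proof.
move=> [mA HA] [mB HB]; split; first exact: measurableU.
move=> e e0; have e2 : 0 < e / 2 by rewrite divr_gt0.
have [r [A' [rA hA]]] := HA _ e2; have [r' [B' [rB hB]]] := HB _ e2.
exists (maxn r r'), (A' `|` B'); split.
  move=> x y xy [h|h]; [left; apply: rA h|right; apply: rB h]; apply: agree_le xy.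
    exact: leq_maxl.
  exact: leq_maxr.
have mA' := rdet_measurable (a := a) rA; have mB' := rdet_measurable (a := a) rB.
apply: (@le_trans _ _ (mu (symd A A' `|` symd B B'))).
  apply: le_measure; rewrite ?inE.
  - by apply: symd_measurable; exact: measurableU.
  - by apply: measurableU; exact: symd_measurable.
  - by move=> x; rewrite /symd /=; tauto.
apply: (le_trans (measureU2 _ _ _)); try exact: symd_measurable.
by rewrite [e]splitr EFinD leeD.
Qed.

Lemma rdet_approx A : measurable A -> approximable A.
Proof.
move: A; apply: smallest_sub.
  split.
  - split => // e e0; exists 0%N, set0; split => //.
    by rewrite /symd !setD0 setU0 measure0 lee_fin ltW.
  - by move=> A hA; rewrite setTD; exact: approximableC.
  - move=> A' hA'; pose A n : set T := A' n.
    have hA n : approximable (A n) by exact: hA'.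
    rewrite -/(\bigcup_k A k).
    have mA n : measurable (A n) by case: (hA n).
    have mU := bigcupT_measurable _ mA; split => // e e0.
    pose U n := \big[setU/set0]_(i < n) A i.
    have hU n : approximable (U n).
      elim: n => [|n IH]; last by rewrite /U big_ord_recr /=; exact: approximableU.
      rewrite /U big_ord0; split => // e' e'0; exists 0%N, set0; split => //.
      by rewrite /symd !setD0 setU0 measure0 lee_fin ltW.
    have e2 : 0 < e / 2 by rewrite divr_gt0.
    have mUn n : measurable (U n) by case: (hU n).
    have UE n x : U n x <-> exists2 i, (i < n)%N & A i x.
      by rewrite /U -(bigcup_mkord n A); split => [[i /= ? ?]|[i ? ?]]; exists i.
    have [n hn] : exists n, (mu ((\bigcup_k A k) `\` U n) <= (e / 2)%:E)%E.
      apply: small_tail => //; first by move=> n; exact: measurableD.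
        move=> n m nm x [Ax nU]; split => // /UE[i im Aix]; apply: nU; apply/UE; exists i => //.
        exact: leq_trans im nm.
      apply/seteqP; split => // x H; have [[i _ Aix] _] := H 0%N I.
      by have [_] := H i.+1 I; apply; apply/UE; exists i.
    have [_ /(_ _ e2)[r [B [rB hB]]]] := hU n; exists r, B; split => //.
    have mB := rdet_measurable (a := a) rB.
    apply: (@le_trans _ _ (mu (((\bigcup_k A k) `\` U n) `|` symd (U n) B))).
      apply: le_measure; rewrite ?inE; first exact: symd_measurable.
        by apply: measurableU; [exact: measurableD|exact: symd_measurable].
      move=> x /(@symd_trans _ (U n))[[h|[/UE[i _ h] nA]]|h]; [by left| |by right].
      by exfalso; apply: nA; exists i.
    apply: (le_trans (measureU2 _ _ _)); [exact: measurableD|exact: symd_measurable|].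
    by rewrite [e in leRHS]splitr EFinD leeD.
move=> _ [n [w ->]]; have rB : rdet n [set x | forall i, (i < n)%N -> x i = w i].
  by move=> x y xy /= h i ni; rewrite -xy // h.
split; first exact: cyl_measurable.
move=> e e0; exists n, [set x | forall i, (i < n)%N -> x i = w i]; split => //.
by rewrite /symd setDv setU0 measure0 lee_fin ltW.
Qed.

Lemma partition_approx k (f : T -> 'I_k) (e : R) : is_fin_partition f -> 0 < e ->
  exists r (h : T -> 'I_k), [/\ forall x y, agree r x y -> h x = h y,
    measurable [set x | f x <> h x] & (mu [set x | f x <> h x] <= e%:E)%E].
Proof.
move=> pf e0; have k0 : (0 < k)%N by case: k f {pf} => [f|//]; case: (f (fun=> a)).
have ek : 0 < e / k%:R by rewrite divr_gt0 // ltr0n.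
have H i : {p : nat * set (nat -> S) |
    rdet p.1 p.2 /\ (mu (symd (f @^-1` [set i]) p.2) <= (e / k%:R)%:E)%E}.
  apply: cid; have [_ /(_ _ ek)[r [B h]]] := rdet_approx (pf i); by exists (r, B).
pose r := \max_(i < k) (sval (H i)).1; pose B i := (sval (H i)).2.
pose h (x : T) := if [pick i | `[< B i x >]] is Some i then i else f (fun=> a).
have rB i : rdet r (B i).
  have [h1 _] := svalP (H i); apply: rdet_le h1; exact: (leq_bigmax (F := fun i => (sval (H i)).1)).
have hdet x y : agree r x y -> h x = h y.
  move=> xy; rewrite /h; congr (if _ is Some _ then _ else _); apply: eq_pick => i.
  apply/asboolP/asboolP; apply: rB => //; exact: agree_sym.
have mB i : measurable (B i : set T) by exact: (rdet_measurable (rB i)).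
have hm i : measurable (h @^-1` [set i] : set T).
  by apply: (@rdet_measurable _ _ r) => x y xy /= <-; rewrite (hdet _ _ xy).
have mfh : measurable [set x | f x <> h x].
  rewrite (_ : [set x | _] = \bigcup_(i in [set: 'I_k]) ((f @^-1` [set i]) `\` (h @^-1` [set i]))).
    apply: fin_bigcup_measurable => // i _; exact: measurableD.
  apply/seteqP; split => [x /= fh|x [i _ [/= <-]] e1 e2]; last exact: e1.
  by exists (f x) => //; split => //= e1; apply: fh.
exists r, h; split => //.
pose E j : set T := if insub j is Some i then symd (f @^-1` [set i]) (B i) else set0.
have mE j : measurable (E j).
  by rewrite /E; case: insub => // i; apply: symd_measurable.
apply: (@le_trans _ _ (mu (\big[setU/set0]_(i < k) E i))).
  apply: le_measure; rewrite ?inE //; first exact: bigsetU_measurable.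
  move=> x /= fh; rewrite -bigcup_mkord.
  have EE (i : 'I_k) : symd (f @^-1` [set i]) (B i) x -> (\bigcup_(j in `I_k) E j) x.
    by move=> hx; exists (val i) => //=; rewrite /E insubT //= => lt; rewrite (_ : Sub _ _ = i) //; exact: val_inj.
  move: fh; rewrite /h; case: pickP => [i /asboolP Bi fi|nB _].
    by apply: (EE i); right; split => //= e1; apply: fi.
  apply: (EE (f x)); left; split => //= Bf; have := nB (f x); rewrite asboolT //.
apply: (le_trans (Boole_inequality _ _)) => //.
apply: (@le_trans _ _ (\sum_(i < k) (e / k%:R)%:E)%E).
  apply: lee_sum => i _; rewrite /E insubT //= => lt.
  by have [_] := svalP (H i); rewrite (_ : Sub _ _ = i) //; exact: val_inj.
rewrite sumEFin lee_fin sumr_const card_ord -(mulr_natr (e / k%:R)) divfK // pnatr_eq0 -lt0n //.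
Qed.

End Approximation.

Section Channel.
Variables (R : realType) (K : choiceType) (n k : nat).
Variables (G : K -> R) (label : K -> {ffun 'I_n -> 'I_k}) (Z c : R).
Hypothesis G0 : forall u, 0 <= G u.
Hypothesis GZ : (nsum G <= Z%:E)%E.
Hypothesis Z0 : 0 < Z.
Hypothesis c0 : 0 <= c.

Definition mismatch (v w : {ffun 'I_n -> 'I_k}) : R := \sum_(l < n) (w l != v l)%:R.
Let tau := 1 + k%:R * expR (- c).

(* Q is the law obtained by drawing u with weight G u and sending its label through a
   memoryless channel that corrupts each letter with weight exp(-c). *)
Lemma noisy_law : exists Q : {ffun 'I_n -> 'I_k} -> R,
  [/\ forall w, 0 <= Q w, \sum_w Q w <= 1 &
      forall u w, G u * expR (- c * mismatch (label u) w) <= Q w * (Z * tau ^+ n)].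
Proof.
pose t (i j : 'I_k) : R := if i == j then 1 else expR (- c).
have t0 i j : 0 <= t i j by rewrite /t; case: ifP => // _; exact: expR_ge0.
have t1 i j : t i j <= 1.
  by rewrite /t; case: ifP => // _; rewrite -expR0 ler_expR oppr_le0.
pose tw u (w : {ffun 'I_n -> 'I_k}) := \prod_(l < n) t (w l) (label u l).
have tw0 u w : 0 <= tw u w by apply: prodr_ge0.
have twE u w : tw u w = expR (- c * mismatch (label u) w).
  rewrite /mismatch mulr_sumr expR_sum; apply: eq_bigr => l _; rewrite /t.
  by case: eqP => _ /=; rewrite ?mulr0 ?expR0 // mulr1.
have tw1 u w : tw u w <= 1.
  by rewrite twE -expR0 ler_expR mulNr oppr_le0 mulr_ge0 // sumr_ge0.
have tau0 : 0 < tau by rewrite /tau ltr_pwDl // mulr_ge0 // expR_ge0.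
have Zt : 0 < Z * tau ^+ n by rewrite mulr_gt0 // exprn_gt0.
have Gtw u w : 0 <= G u * tw u w by rewrite mulr_ge0.
pose N w := nsum (fun u => G u * tw u w).
have Nfin w : N w \is a fin_num.
  apply: nsum_fin => //; apply: (@le_lt_trans _ _ (nsum G)).
    by apply: le_nsum => u; rewrite ler_piMr.
  by apply: le_lt_trans GZ _; rewrite ltry.
have N0 w : (0 <= N w)%E by exact: nsum_ge0.
exists (fun w => fine (N w) / (Z * tau ^+ n)); split.
- by move=> w; rewrite divr_ge0 ?fine_ge0 // ltW.
- rewrite -mulr_suml ler_pdivrMr // mul1r -lee_fin -sumEFin.
  rewrite (eq_bigr N); last by move=> w _; rewrite fineK.
  rewrite /N /nsum -esum_sum; last by move=> u w _ _; rewrite lee_fin.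
  apply: (@le_trans _ _ (nsum (fun u => tau ^+ n * G u))).
    apply: le_esum => u _; rewrite sumEFin lee_fin -mulr_sumr mulrC ler_wpM2r //.
    rewrite /tw -(bigA_distr_bigA (fun l i => t i (label u l))) /=.
    rewrite -[n in leRHS]card_ord -prodr_const; apply: ler_prod => l _.
    rewrite sumr_ge0 //= (@le_trans _ _ (\sum_(i < k) ((i == label u l)%:R + expR (- c)))) //.
      apply: ler_sum => i _; rewrite /t; case: eqP => _ /=; rewrite ?add0r //.
      by rewrite lerDl expR_ge0.
    rewrite big_split /= sumr_const card_ord -(mulr_natl (expR (- c))) /tau lerD2r.
    rewrite (bigD1 (label u l)) //= eqxx big1 ?addr0 // => i /negbTE -> //.
  rewrite nsumZ ?exprn_ge0 ?(ltW tau0) // mulrC EFinM lee_wpmul2l // lee_fin exprn_ge0 // ltW //.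
- move=> u w; rewrite divfK ?gt_eqF // -twE -lee_fin fineK //.
  exact: (nsum_ge_term (fun u => G u * tw u w)).
Qed.

End Channel.

Section BridgeSums.
Variables (S : countType) (edge : S -> S -> bool) (R : realType) (a : S).
Variables (g : (nat -> S) -> R) (A th C s : R) (x0 : baseX edge a).
Hypothesis conn : strongly_connected edge.
Hypothesis th01 : 0 < th < 1.
Hypothesis A0 : 0 <= A.
Hypothesis gA : var_holder edge A th g.
Hypothesis C0 : 0 <= C.
Hypothesis growth : forall n, (loopsum edge a g 0%R n (sval x0) <= (C * expR (s * n%:R))%:E)%E.

Lemma nsum_inj_le (T T' : choiceType) (P : pred T) (Q : pred T') (e : T -> T') (F : T' -> R) :
  (forall v, 0 <= F v) -> (forall u, P u -> Q (e u)) ->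
  (forall u u', P u -> P u' -> e u = e u' -> u = u') ->
  (nsum (fun u => if P u then F (e u) else 0%R) <= nsum (fun v => if Q v then F v else 0%R))%E.
Proof.
move=> F0 PQ inj; rewrite (nsum_cond P (fun u => F (e u))) (nsum_cond Q F).
rewrite -(esum_image _ e (fun v => (F v)%:E)); last first.
  by move=> u u'; rewrite !inE /= => Pu Pu'; exact: inj.
apply: le_ereal_sup => _ [X [fX XP] <-]; exists X => //; split => //.
by apply: (subset_trans XP) => _ [u /= Pu <-]; exact: PQ.
Qed.

Lemma connecting_word b c : exists v : seq S, sorted edge (rcons v c) && (head c v == b).
Proof.
have [n h] := conn b c; have [v [_ sv hv]] := path_word h.
by exists v; rewrite sv hv eqxx.
Qed.

Lemma sorted_glue (v w : seq S) (b c : S) : sorted edge (rcons v b) -> sorted edge (rcons w c) ->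
  head c w = b -> sorted edge (rcons (v ++ w) c) .
Proof.
rewrite rcons_cat; case: w => [|d w] /= sv sw e; first by rewrite cats1 e.
by subst d; rewrite sorted_cat_cons sv.
Qed.

Lemma head_cat (v w : seq S) c : head c (v ++ w) = head (head c w) v.
Proof. by case: v. Qed.

Definition bridge (b b' : S) (m : nat) : pred (seq S) :=
  fun u => [&& sorted edge (rcons u b'), head b' u == b & size u == m].

Lemma bridge_sums : exists yb : S -> nat -> S,
  (forall b, Sigma edge (yb b) /\ yb b 0%N = b) /\
  forall b b', exists2 K : R, 0 <= K & forall m,
   (nsum (fun u => if bridge b b' m u then expR (birk g m (glue u (yb b'))) else 0%R)
     <= (K * expR (s * m%:R))%:E)%E.
Proof.
have [sx0 xa] := svalP x0.
pose cw b := sval (cid (connecting_word b a)).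
have cwP b : sorted edge (rcons (cw b) a) /\ head a (cw b) = b.
  by have /andP[h /eqP] := svalP (cid (connecting_word b a)).
pose yb b := glue (cw b) (sval x0).
have ybP b : Sigma edge (yb b) /\ yb b 0%N = b.
  have [h1 h2] := cwP b; split; first by apply: glue_Sigma; rewrite ?xa.
  by rewrite /yb glue0 xa.
exists yb; split => // b b'.
have [v /andP[sv /eqP hv]] := connecting_word a b.
pose i := size v; pose j := size (cw b').
pose D := A / (1 - th).
pose k0 := D - birk g i (glue v (yb b)) - birk g j (yb b').
exists (expR k0 * (C * expR (s * (i + j)%:R))); first by rewrite !mulr_ge0 ?expR_ge0.
move=> m.
pose F w := expR k0 * gibbs g 0 w (sval x0).
have F0 w : 0 <= F w by rewrite mulr_ge0 ?expR_ge0.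
pose e u := v ++ u ++ cw b'.
pose Q w := isloop edge a w && (size w == i + m + j)%N.
have [s1 h1] := cwP b'; have [sy0 yb0] := ybP b; have [sy0' yb0'] := ybP b'.
apply: (@le_trans _ _ (nsum (fun u => if bridge b b' m u then F (e u) else 0))).
  apply: le_nsum => u; case: ifP => // /and3P[su /eqP hu /eqP szu].
  rewrite /F /e /gibbs mul0r subr0 -expRD ler_expR !size_cat.
  rewrite birkD glue_cat iter_shift_glue birkD glue_cat iter_shift_glue -/(yb b') -/i -/j szu.
  have gu : Sigma edge (glue u (yb b')) by apply: glue_Sigma; rewrite ?yb0'.
  have gu0 : glue u (yb b') 0%N = b by rewrite glue0 yb0'.
  have ag : agree (i + 1) (glue v (yb b)) (glue v (glue u (yb b'))).
    by apply: glue_agree; case=> // _; rewrite gu0.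
  have sg1 : Sigma edge (glue v (yb b)) by apply: glue_Sigma; rewrite ?yb0.
  have sg2 : Sigma edge (glue v (glue u (yb b'))) by apply: glue_Sigma; rewrite ?gu0.
  have := birk_distortion th01 A0 gA (l := 1) isT sg1 sg2 ag.
  have hD : A / (1 - th) * th ^+ 1 <= D.
    case/andP: th01 => t0 t1; rewrite expr1 ler_piMr ?(ltW t1) //.
    by rewrite divr_ge0 // subr_ge0 ltW.
  move=> /le_trans /(_ hD); rewrite ler_norml /k0; lra.
apply: (@le_trans _ _ (nsum (fun w => if Q w then F w else 0))).
  apply: nsum_inj_le => // [u /and3P[su /eqP hu /eqP szu]|u u' /and3P[_ _ /eqP zu] /and3P[_ _ /eqP zu'] /eqP].
    rewrite /Q /e !size_cat szu addnA eqxx andbT /isloop; apply/andP; split.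
      apply: (sorted_glue sv); first exact: (sorted_glue su s1 h1).
      by rewrite head_cat h1.
    by rewrite !head_cat h1 hu hv.
  rewrite /e eqseq_cat // eqxx /= eqseq_cat ?zu ?zu' // => /andP[/eqP //].
rewrite (_ : (fun w => _) = (fun w => expR k0 * (if Q w then gibbs g 0 w (sval x0) else 0))); last first.
  by apply/funext => w; rewrite /F; case: ifP; rewrite ?mulr0.
rewrite nsumZ ?expR_ge0 //; last by move=> w; case: ifP => // _; exact: gibbs_ge0.
rewrite -mulrA EFinM; apply: lee_wpmul2l; first by rewrite lee_fin expR_ge0.
apply: (le_trans (growth (i + m + j)%N)); rewrite lee_fin -mulrA ler_wpM2l // -expRD ler_expR.
by rewrite !natrD; lra.
Qed.

End BridgeSums.

Section Expectation.
Variables (d : measure_display) (T : measurableType d) (R : realType) (mu : probability T R).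
Implicit Types u v : T -> R.

Definition integ u : Prop := mu.-integrable [set: T] (EFin \o u).
Definition Ex u : R := (\int[mu]_x (u x))%R.

Lemma integD u v : integ u -> integ v -> integ (fun x => u x + v x).
Proof.
move=> iu iv; rewrite /integ (_ : EFin \o _ = ((EFin \o u) \+ (EFin \o v))%E).
  exact: integrableD.
by apply/funext => x /=; rewrite EFinD.
Qed.

Lemma integZ c u : integ u -> integ (fun x => c * u x).
Proof.
move=> iu; rewrite /integ (_ : EFin \o _ = (fun x => c%:E * (EFin \o u) x)%E).
  exact: integrableZl.
by apply/funext => x /=; rewrite EFinM.
Qed.

Lemma integ_cst c : integ (fun=> c).
Proof. exact: finite_measure_integrable_cst. Qed.

Lemma ExD u v : integ u -> integ v -> Ex (fun x => u x + v x) = Ex u + Ex v.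
Proof. by move=> iu iv; exact: RintegralD. Qed.

Lemma ExZ c u : integ u -> Ex (fun x => c * u x) = c * Ex u.
Proof. by move=> iu; exact: RintegralZl. Qed.

Lemma Ex_cst c : Ex (fun=> c) = c.
Proof. by rewrite /Ex Rintegral_cst //= probability_setT mulr1. Qed.

Lemma Ex_sum n (F : nat -> T -> R) : (forall i, integ (F i)) ->
  integ (fun x => \sum_(i < n) F i x) /\ Ex (fun x => \sum_(i < n) F i x) = \sum_(i < n) Ex (F i).
Proof.
move=> iF; elim: n => [|n [i1 e1]].
  rewrite big_ord0 (_ : (fun x => _) = (fun=> 0)); last by apply/funext => x; rewrite big_ord0.
  by rewrite Ex_cst; split => //; exact: integ_cst.
rewrite big_ord_recr /= (_ : (fun x => _) = (fun x => \sum_(i < n) F i x + F n x)); last first.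
  by apply/funext => x; rewrite big_ord_recr.
by rewrite ExD // e1; split => //; exact: integD.
Qed.

Lemma integ_indic (A : set T) : measurable A -> integ \1_A.
Proof. by move=> mA; apply: integrable_indic. Qed.

Lemma Ex_indic (A : set T) : measurable A -> Ex \1_A = fine (mu A).
Proof. by move=> mA; rewrite /Ex /Rintegral integral_indic // setIT. Qed.

Lemma le_Ex_ae (D : set T) u v : measurable D -> mu D = 1%E -> integ u -> integ v ->
  (forall x, D x -> u x <= v x) -> Ex u <= Ex v.
Proof.
move=> mD D1 iu iv uv.
have nD : mu (~` D) = 0%E by rewrite probability_setC // D1 subee.
have red w : integ w -> Ex w = (\int[mu]_(x in D) w x)%R.
  move=> iw; rewrite /Ex /Rintegral (negligible_integral (measurableC mD)) //.
  by rewrite setTD setCK.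
have sub w : integ w -> mu.-integrable D (EFin \o w).
  by move=> iw; apply: integrableS iw.
by rewrite (red u) // (red v) //; apply: le_Rintegral => //; exact: sub.
Qed.

End Expectation.

Section ShiftExpectation.
Variables (S : countType) (a : S) (R : realType) (mu : probability (seqT a) R).
Notation T := (seqT a).
Hypothesis mu_inv : forall A : set T, measurable A -> mu (@Defs.shift S @^-1` A) = mu A.

Lemma Ex_shift (u : T -> R) l : integ mu u ->
  integ mu (fun x => u (iter l (@Defs.shift S) x)) /\
  Ex mu (fun x => u (iter l (@Defs.shift S) x)) = Ex mu u.
Proof.
move=> iu; have mphi := iter_shift_measurable (a := a) l.
have mu_u : measurable_fun setT (EFin \o u) by case/integrableP: iu.
have pf (h : T -> \bar R) : (\int[pushforward mu (iter l (@Defs.shift S) : T -> T)]_x h x = \int[mu]_x h x)%E.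
  apply: eq_measure_integral => A mA _; exact: iter_invariant.
have ish : integ mu (fun x => u (iter l (@Defs.shift S) x)).
  apply/integrableP; split.
    exact: (measurableT_comp mu_u mphi).
  case/integrableP: iu => _; rewrite -(pf (fun x => `|(EFin \o u) x|%E)).
  rewrite (ge0_integral_pushforward mphi) //.
  exact: measurableT_comp.
split => //; rewrite /Ex /Rintegral -(pf (EFin \o u)).
by rewrite (integral_pushforward mphi).
Qed.

End ShiftExpectation.

Lemma nsum_pair_fin (R : realType) (I : finType) (T : choiceType) (F : I * T -> R) :
  (forall q, 0 <= F q) -> (nsum F <= \sum_i nsum (fun t => F (i, t)))%E.
Proof.
move=> F0.
have FE : F = (fun q => \sum_i (if q.1 == i then F (i, q.2) else 0)).
  apply/funext => -[i t] /=; rewrite (bigD1 i) //= eqxx big1 ?addr0 // => j.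
  by rewrite eq_sym => /negbTE ->.
apply: (@le_trans _ _ (\sum_i nsum (fun q : I * T => if q.1 == i then F (i, q.2) else 0%R))%E).
  rewrite {1}FE /nsum -esum_sum; last by move=> q i _ _; rewrite lee_fin; case: ifP.
  by apply: le_esum => q _; rewrite sumEFin.
apply: lee_sum => i _.
apply: (le_trans (@nsum_inj_le _ _ _ (fun q : I * T => q.1 == i) predT snd (fun t => F (i, t)) _ _ _)) => //.
by move=> [j t] [j' t'] /= /eqP -> /eqP -> ->.
Qed.

Lemma le_of_affine (R : realType) (x y z : R) :
  (forall n, (0 < n)%N -> x * n%:R <= y * n%:R + z) -> x <= y.
Proof.
move=> H; rewrite leNgt; apply/negP => yx.
have p : 0 < x - y by rewrite subr_gt0.
have := H (Num.truncn (`|z| / (x - y))).+1 isT.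
have := truncnS_gt (`|z| / (x - y)); rewrite ltr_pdivrMr //.
have := ler_norm z; lra.
Qed.

Section UpperBound.
Variables (S : countType) (edge : S -> S -> bool) (R : realType) (a : S).
Variables (mu : probability (seqT a) R).
Notation T := (seqT a).
Notation Sig := (Sigma edge).
Notation sh := (@Defs.shift S).
Hypothesis mu_Sigma : mu (Sig : set T) = 1%E.
Hypothesis mu_inv : forall A : set T, measurable A -> mu (sh @^-1` A) = mu A.
Variables (g : (nat -> S) -> R) (A th C s Mg : R) (x0 : baseX edge a).
Hypothesis conn : strongly_connected edge.
Hypothesis th01 : 0 < th < 1.
Hypothesis A0 : 0 <= A.
Hypothesis gA : var_holder edge A th g.
Hypothesis C0 : 0 <= C.
Hypothesis growth : forall n, (loopsum edge a g 0%R n (sval x0) <= (C * expR (s * n%:R))%:E)%E.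
Hypothesis gM : forall x, Sig x -> g x <= Mg.
Hypothesis gint : mu.-integrable (Sig : set T) (EFin \o g).

Let gh : T -> R := (g : T -> R) \_ Sig.
Let D := A / (1 - th).

Let mS : measurable (Sig : set T). Proof. exact: Sigma_measurable. Qed.

Let ghint : integ mu gh.
Proof.
rewrite /integ (_ : EFin \o gh = ((EFin \o g) \_ Sig)); first exact/(integrable_mkcond _ mS).1.
by rewrite /gh restrict_EFin.
Qed.

Let ghE : Ex mu gh = (\int[mu]_(x in Sig) (g x))%R.
Proof. by rewrite /Ex /gh -Rintegral_mkcond. Qed.

Let gh_Sig x : Sig x -> gh x = g x.
Proof. by move=> sx; rewrite /gh patchE mem_set. Qed.

Variables (k : nat) (f : T -> 'I_k).
Hypothesis pf : is_fin_partition f.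

Lemma partition_card_gt0 : (0 < k)%N.
Proof. by case: k f => [f0|//]; case: (f0 (fun=> a)). Qed.

Let I0 := Ex mu gh.

Lemma Hjoin_bound (dl c : R) : 0 < dl -> 0 <= c -> exists z : R, forall n, (0 < n)%N ->
  Hjoin mu f n <= (c * dl + k%:R * expR (- c) + s - I0 +
    2 * dl * (`|s| + `|Mg| + ln k%:R)) * n%:R + z.
Proof.
move=> dl0 c0.
have k0 := partition_card_gt0.
have [r [h [hr mE hE]]] := partition_approx mu pf dl0.
pose E : set T := [set x | f x <> h x].
pose B n : set T := [set x | (n <= pickle (x 0%N))%N].
have mB n : measurable (B n).
  by apply: (@rdet_measurable _ _ 1) => x y xy; rewrite /B /= -(xy 0%N).
have [n0 hB] : exists n0, (mu (B n0) <= dl%:E)%E.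
  apply: small_tail => //; first by move=> n m nm x; exact: leq_trans.
  by apply/seteqP; split => // x H; have := H (pickle (x 0%N)).+1 I; rewrite /B /= ltnn.
pose st (i : 'I_n0) : S := odflt a (unpickle i).
have [yb [ybP bsum]] := bridge_sums conn th01 A0 gA C0 growth.
have [K K0 KP] : exists2 K : S -> S -> R, (forall b b', 0 <= K b b') & forall b b' m,
    (nsum (fun u => if bridge edge b b' m u then expR (birk g m (glue u (yb b'))) else 0%R)
      <= (K b b' * expR (s * m%:R))%:E)%E.
  exists (fun b b' => s2val (cid2 (bsum b b'))) => b b'; first exact: (s2valP (cid2 (bsum b b'))).
  exact: (s2valP' (cid2 (bsum b b'))).
pose KF : R := 1 + \sum_i \sum_j K (st i) (st j).
have KF0 : 0 < KF by rewrite ltr_pwDl // sumr_ge0 // => i _; rewrite sumr_ge0.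
have D0 : 0 <= D by rewrite divr_ge0 // subr_ge0 ltW //; case/andP: th01.
have lnk0 : 0 <= ln k%:R :> R by rewrite ln_ge0 // ler1n.
pose tau : R := 1 + k%:R * expR (- c).
have tau1 : 1 <= tau by rewrite lerDl mulr_ge0 // expR_ge0.
have lntau : ln tau <= k%:R * expR (- c).
  by apply: le_ln1Dx; rewrite (lt_le_trans (ltrN10 R)) // mulr_ge0 // expR_ge0.
exists (ln 2 + D + `|ln KF| + `|s - I0| * r%:R +
   2 * dl * (`|ln KF| + `|s| * r%:R + `|Mg| * r%:R)) => n np.
pose m := (n + r)%N; pose Z := KF * expR (s * m%:R).
have Z0 : 0 < Z by rewrite mulr_gt0 // expR_gt0.
have lnZ : ln Z = ln KF + s * m%:R by rewrite lnM ?posrE ?expR_gt0 // expRK.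
pose pt (q : 'I_n0 * 'I_n0 * seq S) := glue q.2 (yb (st q.1.2)).
pose G (q : 'I_n0 * 'I_n0 * seq S) : R :=
  if bridge edge (st q.1.1) (st q.1.2) m q.2 then expR (birk g m (pt q)) else 0.
have G0 q : 0 <= G q by rewrite /G; case: ifP => // _; exact: expR_ge0.
have GZ : (nsum G <= Z%:E)%E.
  apply: (le_trans (nsum_pair_fin G0)).
  apply: (@le_trans _ _ (\sum_(ij : 'I_n0 * 'I_n0) (K (st ij.1) (st ij.2) * expR (s * m%:R))%:E)%E).
    by apply: lee_sum => ij _; exact: (KP (st ij.1) (st ij.2) m).
  rewrite sumEFin lee_fin -mulr_suml ler_wpM2r ?expR_ge0 //.
  by rewrite -(pair_bigA _ (fun i j => K (st i) (st j))) /KF lerDr.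
pose label (q : 'I_n0 * 'I_n0 * seq S) : {ffun 'I_n -> 'I_k} :=
  [ffun l : 'I_n => h (iter l sh (pt q))].
have [Q [Q0 Q1 QG]] := noisy_law label G0 GZ Z0 c0.
pose kn : R := (k%:R ^+ n)^-1.
have kn0 : 0 < kn by rewrite invr_gt0 exprn_gt0 // ltr0n.
pose Q' w := Q w / 2 + kn / 2.
have Q'0 w : 0 < Q' w by rewrite ltr_wpDl ?divr_ge0 // divr_gt0.
have Q'1 : \sum_w Q' w <= 1.
  rewrite big_split /= -mulr_suml sumr_const card_ffun !card_ord.
  have -> : kn / 2 *+ (k ^ n) = 1 / 2.
    rewrite -mulr_natr natrX /kn; field; rewrite expf_neq0 // pnatr_eq0 -lt0n //.
  by move: Q1; lra.
have mI : fin_meas (itinerary f n) by exact: itinerary_meas.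
have H1 : Hjoin mu f n <= Ex mu (fun x => - ln (Q' (itinerary f n x))).
  rewrite /Ex (fin_integral mu mI (fun w => - ln (Q' w))) HjoinE //.
  under [leRHS]eq_bigr do rewrite mulrC.
  apply: gibbs_inequality => //.
  - by move=> w; exact: law_ge0.
  - by exact: sum_law.
  - by move=> w; exact: ltW.
pose w0 := `|ln Z| + m%:R * `|Mg| + n%:R * ln k%:R.
have w00 : 0 <= w0 by rewrite !addr_ge0 ?mulr_ge0.
pose c1 := ln 2 + D + n%:R * ln tau + ln Z.
pose err (x : T) : R := \sum_(l < n) \1_E (iter l sh x).
pose bi (x : T) : R := \sum_(l < m) gh (iter l sh x).
pose Bd x := c1 + (c * err x + ((-1) * bi x + w0 * (\1_(B n0) x + \1_(B n0) (iter m sh x)))).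
have iE l : integ mu (fun x => \1_E (iter l sh x)) /\
    Ex mu (fun x => \1_E (iter l sh x)) = fine (mu E).
  have [h1 h2] := Ex_shift mu_inv l (integ_indic mu mE); split => //.
  by rewrite h2 Ex_indic.
have iB l : integ mu (fun x => \1_(B n0) (iter l sh x)) /\
    Ex mu (fun x => \1_(B n0) (iter l sh x)) = fine (mu (B n0)).
  have [h1 h2] := Ex_shift mu_inv l (integ_indic mu (mB n0)); split => //.
  by rewrite h2 Ex_indic.
have ig l := Ex_shift mu_inv l ghint.
have [ierr Eerr] := Ex_sum n (fun l => (iE l).1).
have [ibi Ebi] := Ex_sum m (fun l => (ig l).1).
have iB2 : integ mu (fun x => w0 * (\1_(B n0) x + \1_(B n0) (iter m sh x))).
  by apply: integZ; apply: integD; [exact: (iB 0%N).1|exact: (iB m).1].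
have ibi' : integ mu (fun x => -1 * bi x) by exact: integZ.
have ierr' : integ mu (fun x => c * err x) by exact: integZ.
have iBd1 : integ mu (fun x => -1 * bi x + w0 * (\1_(B n0) x + \1_(B n0) (iter m sh x))).
  exact: integD.
have iBd2 : integ mu (fun x => c * err x +
   (-1 * bi x + w0 * (\1_(B n0) x + \1_(B n0) (iter m sh x)))).
  exact: integD.
have iBd : integ mu Bd by apply: integD => //; exact: integ_cst.
have EBd : Ex mu Bd = c1 + (c * (n%:R * fine (mu E)) + (-1 * (m%:R * I0) + w0 * (2 * fine (mu (B n0))))).
  rewrite /Bd ExD //; last exact: integ_cst.
  rewrite Ex_cst ExD // ExZ // ExD // ExZ // ExZ; last first.
    by apply: integD; [exact: (iB 0%N).1|exact: (iB m).1].
  rewrite ExD; [|exact: (iB 0%N).1|exact: (iB m).1].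
  rewrite (iB m).2 (iB 0%N).2 /err Eerr /bi Ebi.
  rewrite (eq_bigr (fun=> fine (mu E))); last by move=> l _; exact: (iE l).2.
  rewrite sumr_const card_ord (eq_bigr (fun=> I0)); last by move=> l _; exact: (ig l).2.
  rewrite sumr_const card_ord -(mulr_natl (fine (mu E))) -(mulr_natl I0).
  by congr (_ + (_ + (_ + _))); ring.
have pw x : Sig x -> - ln (Q' (itinerary f n x)) <= Bd x.
  move=> sx.
  have biE : bi x = birk g m x.
    by apply: eq_bigr => l _; apply: gh_Sig; exact: Sigma_iter_shift.
  have biM : birk g m x <= m%:R * `|Mg|.
    rewrite /birk -[m in leRHS]card_ord [leRHS]mulr_natl -sumr_const; apply: ler_sum => l _.
    apply: (le_trans (gM (Sigma_iter_shift _ sx))); exact: ler_norm.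
  have err0 : 0 <= err x by rewrite sumr_ge0 // => l _; rewrite indicE.
  have lntau0 : 0 <= n%:R * ln tau by rewrite mulr_ge0 // ln_ge0.
  have ind0 l : (0 : R) <= \1_(B n0) (iter l sh x) by rewrite indicE.
  have bad : B n0 x \/ B n0 (iter m sh x) -> - ln (Q' (itinerary f n x)) <= Bd x.
    move=> hb.
    have h1 : - ln (Q' (itinerary f n x)) <= ln 2 + n%:R * ln k%:R.
      have q2 : kn / 2 <= Q' (itinerary f n x) by rewrite lerDr divr_ge0.
      have : ln (kn / 2) <= ln (Q' (itinerary f n x)).
        by rewrite ler_ln ?posrE // divr_gt0.
      rewrite ln_div ?posrE // lnV ?posrE ?exprn_gt0 ?ltr0n //.
      rewrite lnXn ?ltr0n // -mulr_natl; lra.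
    have h2 : w0 <= w0 * (\1_(B n0) x + \1_(B n0) (iter m sh x)).
      rewrite ler_peMr //; case: hb => hb.
        have -> : \1_(B n0) x = 1 :> R by rewrite indicE mem_set.
        by rewrite lerDl.
      have -> : \1_(B n0) (iter m sh x) = 1 :> R by rewrite indicE mem_set.
      by rewrite lerDr; exact: (ind0 0%N).
    have h3 : 0 <= c * err x by rewrite mulr_ge0.
    have h4 := ler_norm (- ln Z); rewrite normrN in h4.
    by rewrite /Bd /c1 biE; move: h2; rewrite /w0; lra.
  have [b1|b1] := pselect (B n0 x); first by apply: bad; left.
  have [b2|b2] := pselect (B n0 (iter m sh x)); first by apply: bad; right.
  have i0 : (pickle (x 0%N) < n0)%N by rewrite ltnNge; apply/negP.
  have i1 : (pickle (x m) < n0)%N.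
    by rewrite ltnNge; apply/negP; move: b2; rewrite /B /= iter_shiftE addn0.
  have st0 : st (Ordinal i0) = x 0%N by rewrite /st /= pickleK.
  have st1 : st (Ordinal i1) = x m by rewrite /st /= pickleK.
  pose q := (Ordinal i0, Ordinal i1, mkseq x m).
  have [sy y0] := ybP (x m).
  have ptE : pt q = glue (mkseq x m) (yb (x m)) by rewrite /pt /= st1.
  have srt : sorted edge (rcons (mkseq x m) (x m)).
    have -> : rcons (mkseq x m) (x m) = mkseq x m.+1.
      by rewrite /mkseq -addn1 iotaD map_cat /= cats1.
    apply/(sortedP a) => i; rewrite size_mkseq => mi.
    by rewrite !nth_mkseq ?(ltnW mi) //; exact: sx.
  have ag : agree (m + 1) (pt q) x.
    rewrite ptE => i; rewrite addn1 ltnS leq_eqVlt => /predU1P[->|im].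
      by have := glueEr (mkseq x m) (yb (x m)) 0; rewrite size_mkseq addn0 y0.
    by rewrite (glueE _ a) ?size_mkseq // nth_mkseq.
  have sp : Sig (pt q) by rewrite ptE; apply: glue_Sigma; rewrite ?y0.
  have GE : G q = expR (birk g m (pt q)).
    rewrite /G ifT // /bridge /= st0 st1 srt size_mkseq eqxx andbT /=.
    by case: (m) => [|m'] //=.
  have dist : birk g m x - D <= birk g m (pt q).
    have := birk_distortion th01 A0 gA (n := m) (l := 1) isT sp sx ag.
    have hD : A / (1 - th) * th ^+ 1 <= D.
      case/andP: th01 => t0 t1; rewrite expr1 ler_piMr ?(ltW t1) //.
    move=> /le_trans /(_ hD); rewrite ler_norml; lra.
  have mm : mismatch R (label q) (itinerary f n x) = err x.
    apply: eq_bigr => l _; rewrite !ffunE indicE.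
    have -> : h (iter l sh (pt q)) = h (iter l sh x).
      apply: hr => i ir; rewrite !iter_shiftE; apply: ag.
      by rewrite addn1 ltnS leq_add // ltnW.
    congr (nat_of_bool _)%:R; rewrite /E; apply/idP/idP.
      by move=> /eqP fh; apply: mem_set.
    by rewrite inE /= => /eqP.
  have h1 := QG q (itinerary f n x); rewrite mm GE -expRD -/tau in h1.
  have Zt : 0 < Z * tau ^+ n by rewrite mulr_gt0 // exprn_gt0 // (lt_le_trans ltr01).
  have h2 : expR (birk g m x - D - c * err x) / (Z * tau ^+ n) / 2 <= Q' (itinerary f n x).
    have : expR (birk g m x - D - c * err x) / (Z * tau ^+ n) <= Q (itinerary f n x).
      rewrite ler_pdivrMr //; apply: le_trans h1; rewrite ler_expR; lra.
    rewrite /Q'; have := kn0; lra.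
  have h3 : 0 < expR (birk g m x - D - c * err x) / (Z * tau ^+ n).
    by rewrite divr_gt0 // expR_gt0.
  have tau0 : 0 < tau by exact: lt_le_trans ltr01 tau1.
  have : ln (expR (birk g m x - D - c * err x) / (Z * tau ^+ n) / 2) <= ln (Q' (itinerary f n x)).
    by rewrite ler_ln ?posrE // divr_gt0.
  rewrite ln_div ?posrE // [X in X - ln 2]ln_div ?posrE ?expR_gt0 //.
  rewrite expRK [ln (Z * _)]lnM ?posrE ?exprn_gt0 // lnXn //.
  rewrite -(mulr_natl (ln tau)) /Bd /c1 biE.
  have h4 : 0 <= w0 * (\1_(B n0) x + \1_(B n0) (iter m sh x)).
    by rewrite mulr_ge0 // addr_ge0 //; exact: (ind0 0%N).
  lra.
have iJ : integ mu (fun x => - ln (Q' (itinerary f n x))).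
  exact: (fin_integrable mu mI (fun w => - ln (Q' w))).
have H2 := le_Ex_ae mS mu_Sigma iJ iBd pw.
apply: (le_trans H1); apply: (le_trans H2); rewrite EBd /c1 /w0 lnZ.
have e1 : fine (mu E) <= dl by rewrite -lee_fin fineK ?mu_fin.
have e2 : fine (mu (B n0)) <= dl by rewrite -lee_fin fineK ?mu_fin.
have e10 : 0 <= fine (mu E) by exact: fine_ge0.
have e20 : 0 <= fine (mu (B n0)) by exact: fine_ge0.
have nR : 0 <= n%:R :> R by [].
have mR : m%:R = n%:R + r%:R :> R by rewrite natrD.
have t1 : c * (n%:R * fine (mu E)) <= c * dl * n%:R.
  by rewrite -mulrA ler_wpM2l // mulrC ler_wpM2r.
have t2 : n%:R * ln tau <= k%:R * expR (- c) * n%:R by rewrite mulrC ler_wpM2r.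
have t3 : (s - I0) * r%:R <= `|s - I0| * r%:R by rewrite ler_wpM2r // ler_norm.
have t4 : `|ln KF + s * m%:R| <= `|ln KF| + `|s| * m%:R.
  by rewrite (le_trans (ler_normD _ _)) // normrM (ger0_norm (ler0n _ _)).
have t5 : (`|ln KF + s * m%:R| + m%:R * `|Mg| + n%:R * ln k%:R) * (2 * fine (mu (B n0))) <=
   (`|ln KF| + `|s| * m%:R + m%:R * `|Mg| + n%:R * ln k%:R) * (2 * dl).
  apply: ler_pM; rewrite ?addr_ge0 ?mulr_ge0 //; lra.
have t6 := ler_norm (ln KF).
move: t5; rewrite mR; lra.
Qed.

Lemma entropy_le_growth : hpart mu f + (\int[mu]_(x in Sig) (g x))%R <= s.
Proof.
rewrite -ghE -/I0; apply/ler_addgt0Pr => e e0.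
have [c [c0 hc]] : exists c : R, 0 <= c /\ k%:R * expR (- c) <= e / 2.
  have k0 : 0 < k%:R :> R by rewrite ltr0n partition_card_gt0.
  exists (k%:R / (e / 2)); have p : 0 < k%:R / (e / 2) by rewrite divr_gt0 // divr_gt0.
  split; first exact: ltW.
  have h1 : expR (- (k%:R / (e / 2))) <= (k%:R / (e / 2))^-1.
    rewrite expRN lef_pV2 ?posrE ?expR_gt0 //.
    by have := expR_ge1Dx (k%:R / (e / 2)); lra.
  apply: (le_trans (ler_wpM2l (ltW k0) h1)).
  by rewrite invf_div mulrCA divff ?mulr1 // gt_eqF.
pose v := c + 2 * (`|s| + `|Mg| + ln k%:R) + 1.
have lnk0 : 0 <= ln k%:R :> R by rewrite ln_ge0 // ler1n partition_card_gt0.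
have v0 : 0 < v.
  by rewrite /v; have := normr_ge0 s; have := normr_ge0 Mg; lra.
pose dl := e / 2 / v.
have dl0 : 0 < dl by rewrite divr_gt0 // divr_gt0.
have [z Hz] := Hjoin_bound dl0 c0.
have [lo _] := hpart_spec mu_inv pf.
have : hpart mu f <= c * dl + k%:R * expR (- c) + s - I0 + 2 * dl * (`|s| + `|Mg| + ln k%:R).
  apply: (@le_of_affine _ _ _ z) => n np; exact: le_trans (lo n np) (Hz n np).
have : dl * v = e / 2 by rewrite /dl divfK // gt_eqF.
rewrite /v; lra.
Qed.

End UpperBound.

(** * Measures obtained by concatenating loops *)

Section Images.
Variables (d1 d2 : measure_display) (T1 : measurableType d1) (T2 : measurableType d2).
Variable R : realType.

Lemma image_measure (m : {measure set T1 -> \bar R}) (F : T1 -> T2) :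
  measurable_fun [set: T1] F ->
  exists m' : {measure set T2 -> \bar R}, forall A, m' A = m (F @^-1` A).
Proof.
move=> mF; unshelve eexists; first by refine (pushforward m F : {measure set T2 -> \bar R}).
by [].
Qed.

Lemma average_image (P : {measure set T1 -> \bar R}) (N : nat) (F : nat -> T1 -> T2) :
  P [set: T1] = 1%E -> (forall j, measurable_fun [set: T1] (F j)) ->
  exists Q : probability T2 R,
    forall A, Q A = ((\sum_(j < N.+1) P (F j @^-1` A)) * (N.+1%:R^-1)%:E)%E.
Proof.
move=> P1 mF.
have [m mE] := choice (fun j => image_measure P (mF j)).
exists (mnormalize (msum m N.+1) point) => A.
have tot : msum m N.+1 [set: T2] = N.+1%:R%:E.
  rewrite /msum (eq_bigr (fun=> 1%:E)); last by move=> j _; rewrite mE preimage_setT.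
  by rewrite sumEFin sumr_const card_ord.
rewrite /= /mnormalize; case: ifPn => [/orP[]/eqP h|_].
- have e0 : N.+1%:R%:E = 0%E :> \bar R by rewrite -tot h.
  by case: e0 => /eqP; rewrite pnatr_eq0.
- by have e0 : N.+1%:R%:E = +oo%E :> \bar R by rewrite -tot h.
rewrite (_ : fine _ = N.+1%:R); last exact: (congr1 fine tot).
have sE : msum m N.+1 A = (\sum_(j < N.+1) P (F j @^-1` A))%E.
  by apply: eq_bigr => j _; exact: mE.
exact: (congr1 (fun z => z * _)%E sE).
Qed.

End Images.

Section Digits.
Variables (R : realType) (b' : nat).
Notation b := b'.+1.
Notation T := (seqT (ord0 : 'I_b)).

Definition prefix (x : R) (n : nat) : nat := Num.truncn (b%:R ^+ n * x).
Definition digit (x : R) : nat -> 'I_b := fun i => inord (prefix x i.+1 %% b).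

Lemma truncn_divn (y : R) : 0 <= y -> (Num.truncn (b%:R * y) %/ b)%N = Num.truncn y.
Proof.
move=> y0; have b0 : 0 < b%:R :> R by rewrite ltr0n.
have /andP[h1 h2] := truncn_itv (mulr_ge0 (ltW b0) y0).
apply/esym/truncn_def; set q := Num.truncn _ in h1 h2 *; apply/andP; split.
  rewrite -(ler_pM2l b0); apply: le_trans h1; rewrite -natrM ler_nat mulnC.
  exact: leq_trunc_div.
rewrite -(ltr_pM2l b0); apply: (lt_le_trans h2); rewrite -natrM ler_nat mulnC.
by rewrite {1}(divn_eq q b) mulSn addnC -addSn leq_add2r ltn_pmod.
Qed.

Lemma prefixS x n : 0 <= x -> prefix x n.+1 = (prefix x n * b + digit x n)%N.
Proof.
move=> x0; rewrite /digit inordK ?ltn_pmod // {1}(divn_eq (prefix x n.+1) b).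
congr (_ * _ + _)%N; rewrite /prefix exprS -mulrA truncn_divn //.
by rewrite mulr_ge0 // exprn_ge0.
Qed.

Fixpoint code (w : nat -> 'I_b) (n : nat) : nat := if n is m.+1 then (code w m * b + w m)%N else 0%N.

Lemma code_lt w n : (code w n < b ^ n)%N.
Proof.
elim: n => // n IH /=; rewrite expnSr (leq_trans (n := (code w n).+1 * b)) //.
  by rewrite mulSn addnC ltn_add2r.
by rewrite leq_mul2r.
Qed.

Lemma digit_code x w n : 0 <= x < 1 ->
  (forall i, (i < n)%N -> digit x i = w i) <-> prefix x n = code w n.
Proof.
move=> /andP[x0 x1]; elim: n => [|n IH].
  split => // _; rewrite /prefix expr0 mul1r /=; apply: truncn_def.
  by rewrite x0 x1.
rewrite prefixS //=; split.
  move=> h; rewrite (h n) //; congr (_ * _ + _)%N; apply/IH => i ni; apply: h.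
  exact: leqW.
move=> e; have := congr1 (modn^~ b) e; rewrite !modnMDl !modn_small ?ltn_ord // => dn.
have pn : prefix x n = code w n.
  by move: e; rewrite dn => /addIn /eqP; rewrite eqn_pmul2r // => /eqP.
move=> i; rewrite ltnS leq_eqVlt => /predU1P[->|]; first exact: val_inj.
by move/IH: pn => h /h.
Qed.

Let mI : measurable (`[0, 1[%classic : set (measurableTypeR R)).
Proof. exact: measurable_itv. Qed.

Definition unit_measure : {measure set (measurableTypeR R) -> \bar R} :=
  mrestr lebesgue_measure mI.

Lemma unit_measureE A : unit_measure A = lebesgue_measure (A `&` `[0, 1[%classic).
Proof. by []. Qed.

Lemma unit_measure1 : unit_measure [set: measurableTypeR R] = 1%E.
Proof.
by rewrite unit_measureE setTI lebesgue_measure_itv /= lte_fin ltr01 oppr0 adde0.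
Qed.

Lemma digit_measurable : measurable_fun setT (digit : measurableTypeR R -> T).
Proof.
apply: (@measurability _ _ (measurableTypeR R) T setT _ (@cyl_sets 'I_b ord0)) => // _ [_ [n [w ->]] <-].
rewrite setTI (_ : _ @^-1` _ = \bigcap_(i in [set i | (i < n)%N])
   \bigcup_(k in [set k | (k %% b = w i)%N]) [set x : R | prefix x i.+1 = k]).
  apply: bigcap_measurableType => i _; apply: bigcup_measurable => k _.
  have le_meas m : measurable [set x : measurableTypeR R | (prefix x i.+1 <= m)%N].
    rewrite (_ : [set x | _] = `]-oo, m.+1%:R / b%:R ^+ i.+1[%classic); first exact: measurable_itv.
    apply/seteqP; split => x /=; rewrite in_itv /= /prefix truncn_le_nat ltr_pdivlMr ?exprn_gt0 ?ltr0n // mulrC //.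
  case: k => [|k].
    rewrite (_ : [set x | _] = [set x | (prefix x i.+1 <= 0)%N]) //.
    by apply/seteqP; split => x /=; [move=> ->|rewrite leqn0 => /eqP].
  rewrite (_ : [set x | _] = [set x | (prefix x i.+1 <= k.+1)%N] `\` [set x | (prefix x i.+1 <= k)%N]).
    exact: measurableD.
  apply/seteqP; split => x /=; first by move=> ->; rewrite ltnn.
  by move=> [h /negP]; rewrite -ltnNge => h'; apply/eqP; rewrite eqn_leq h.
apply/seteqP; split => x /=.
  by move=> h i /= ni; exists (prefix x i.+1) => //=; rewrite -h // /digit inordK ?ltn_pmod.
move=> h i ni; have [k /= kw e] := h i ni; apply: val_inj; rewrite /= -kw -e.
by rewrite /digit inordK ?ltn_pmod.
Qed.

Lemma bernoulli_measure : exists m : {measure set T -> \bar R},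
  [/\ m setT = 1%E,
      forall n (w : nat -> 'I_b), m [set x | forall i, (i < n)%N -> x i = w i] = ((b%:R ^- n)%:E)%E &
      forall A : set T, measurable A -> m (@Defs.shift 'I_b @^-1` A) = m A].
Proof.
have [m mE] := image_measure unit_measure digit_measurable.
have bR n : 0 < b%:R ^+ n :> R by rewrite exprn_gt0 // ltr0n.
have cyl n (w : nat -> 'I_b) :
    m [set x | forall i, (i < n)%N -> x i = w i] = ((b%:R ^- n)%:E)%E.
  rewrite mE unit_measureE.
  rewrite (_ : _ `&` _ = `[(code w n)%:R / b%:R ^+ n, (code w n).+1%:R / b%:R ^+ n[%classic).
    rewrite lebesgue_measure_itv /= lte_fin ltr_pM2r ?invr_gt0 // ltr_nat ltnSn.
    by rewrite -EFinD -mulrBl -natrB // subSnn mul1r.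
  apply/seteqP; split => x /=; rewrite !in_itv /=.
    move=> [h x01]; have := (digit_code w n x01).1 h; rewrite /prefix => <-.
    rewrite ler_pdivrMr // ltr_pdivlMr // ![x * _]mulrC; apply: truncn_itv.
    by rewrite mulr_ge0 // ?(ltW (bR n)) //; case/andP: x01.
  rewrite ler_pdivrMr // ltr_pdivlMr // ![x * _]mulrC => h.
  have x0 : 0 <= x.
    by rewrite -(pmulr_rge0 _ (bR n)); apply: le_trans (ler0n _ _) _; case/andP: h => [h _]; exact: h.
  have x1 : x < 1.
    rewrite -(ltr_pM2l (bR n)) mulr1; case/andP: h => _ /lt_le_trans; apply.
    by rewrite -natrX ler_nat; exact: code_lt.
  split; last by rewrite x0 x1.
  by apply/digit_code; rewrite ?x0 // /prefix; exact: truncn_def.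
have m1 : m setT = 1%E by rewrite mE preimage_setT unit_measure1.
exists m; split => // A mA.
have [m' m'E] := image_measure m (@shift_measurable _ (ord0 : 'I_b)).
rewrite -m'E; move: A mA.
pose G : set (set T) := [set A | A = set0 \/ cyl_sets A].
have sG : <<s G >> = <<s @cyl_sets 'I_b ord0 >>.
  apply/seteqP; split; apply: smallest_sub; try exact: smallest_sigma_algebra.
    by move=> A [->|h]; [exact: sigma_algebra0|exact: sub_sigma_algebra].
  by move=> A h; apply: sub_sigma_algebra; right.
have Tc : G setT.
  by right; exists 0%N, (fun=> ord0); apply/seteqP; split.
move=> A mA; apply: (@measure_unique _ _ _ G (fun=> setT)) => //.
- move=> A1 A2 [->|[n [w ->]]]; first by left; rewrite set0I.
  move=> [->|[n' [w' ->]]]; first by left; rewrite setI0.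
  have [comp|ncomp] := pselect (forall i, (i < n)%N -> (i < n')%N -> w i = w' i).
    right; exists (maxn n n'), (fun i => if (i < n)%N then w i else w' i).
    apply/seteqP; split => x /=.
      move=> [h h'] i; rewrite leq_max; case: ifP => [ni _|_ /= ni]; [exact: h|exact: h'].
    move=> h; split => i ni; rewrite h ?leq_max ?ni ?orbT //.
    by case: ifP => // ni'; exact: comp.
  left; apply/seteqP; split => // x [/= h h'].
  by apply: ncomp => i ni ni'; rewrite -h // -h'.
- by rewrite bigcup_const.
- move=> _ [->|[n [w ->]]]; first by rewrite !measure0.
  rewrite m'E cyl.
  pose G' (c : 'I_b) : set T :=
    [set x | forall i, (i < n.+1)%N -> x i = (if i is j.+1 then w j else c)].
  have -> : @Defs.shift 'I_b @^-1` [set x | forall i, (i < n)%N -> x i = w i] =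
      \big[setU/set0]_(c < b) G' c.
    rewrite -bigcup_mkord_ord; apply/seteqP; split => x /=.
      move=> h; exists (val (x 0%N)) => //=; rewrite inord_val => -[//|i].
      by rewrite ltnS => ni; rewrite -h.
    by move=> [c _ h] i ni; rewrite /Defs.shift (h i.+1).
  have mG c : measurable (G' c).
    by apply: sub_sigma_algebra; exists n.+1, (fun i => if i is j.+1 then w j else c).
  rewrite measure_semi_additive_ord //; last 2 first.
  - by apply/trivIsetP => c c' _ _ /eqP cc; apply/seteqP; split => // x [/= h h'];
      apply: cc; rewrite -(h 0%N) // -(h' 0%N).
  - exact: bigsetU_measurable.
  rewrite (eq_bigr (fun=> (b%:R ^- n.+1)%:E)); last first.
    by move=> c _; exact: (cyl n.+1 (fun i => if i is j.+1 then w j else c)).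
  rewrite sumEFin sumr_const card_ord -(mulr_natl (b%:R ^- n.+1)) exprS invfM mulrA.
  by rewrite divff ?mul1r // pnatr_eq0.
- by rewrite m'E preimage_setT m1 ltry.
Qed.

End Digits.

Section Tower.
Variables (S : countType) (a : S) (R : realType).
Notation T := (seqT a).
Notation sh := (@Defs.shift S).
Variables (d1 : measure_display) (T1 : measurableType d1) (m : {measure set T1 -> \bar R}).
Variables (s : T1 -> T1) (N' : nat) (F : T1 -> T).
Notation N := N'.+1.

(* The measure of the suspension over [s] with constant roof [N]. *)
Lemma tower_measure : m setT = 1%E ->
  (forall A, measurable A -> m (s @^-1` A) = m A) ->
  measurable_fun setT F -> (forall w, iter N sh (F w) = F (s w)) ->
  exists mu : probability T R,
  [/\ forall A : set T, measurable A -> mu (sh @^-1` A) = mu A,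
      forall (A : set T) (c : R), measurable A ->
        (forall j, (j < N)%N -> (m ((fun w => iter j sh (F w)) @^-1` A) <= c%:E)%E) -> (mu A <= c%:E)%E &
      forall A : set T, measurable A -> (forall w j, (j < N)%N -> A (iter j sh (F w))) ->
        mu A = 1%E].
Proof.
move=> m1 minv mF FN.
have mG j : measurable_fun setT (fun w => iter j sh (F w) : T).
  exact: (measurableT_comp (iter_shift_measurable (a := a) j) mF).
have [mu muE] := average_image N' m1 mG.
have N0 : (N%:R : R) != 0 by rewrite pnatr_eq0.
exists mu; split.
- move=> A mA; rewrite !muE; congr (_ * _)%E.
  pose q j := m ((fun w => iter j sh (F w)) @^-1` A).
  transitivity (\sum_(i < N) q i.+1)%E.
    by apply: eq_bigr => i _; congr (m _).
  transitivity (\sum_(i < N) q i)%E; last by [].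
  rewrite big_ord_recr [RHS]big_ord_recl /= addeC; congr (_ + _)%E.
  rewrite /q -(minv (F @^-1` A)); last by rewrite -[X in measurable X]setTI; exact: mF.
  by congr (m _); apply/seteqP; split => w; rewrite /preimage /= -iterS FN.
- move=> A c mA H; rewrite muE.
  apply: (@le_trans _ _ ((\sum_(j < N) c%:E) * (N%:R^-1)%:E)%E).
    by apply: lee_wpmul2r; [rewrite lee_fin invr_ge0|apply: lee_sum => j _; exact: H].
  by rewrite sumEFin sumr_const card_ord -EFinM -(mulr_natr c) -mulrA divff // mulr1.
- move=> A mA H; rewrite muE (eq_bigr (fun=> 1%E)); last first.
    move=> j _; rewrite -m1; congr (m _); apply/seteqP; split => // w _; exact: H.
  by rewrite sumEFin sumr_const card_ord -EFinM divff.
Qed.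

End Tower.

Section LoopMeasure.
Variables (S : countType) (edge : S -> S -> bool) (R : realType) (a : S).
Notation T := (seqT a).
Notation sh := (@Defs.shift S).
Variables (b' N' : nat) (v : 'I_b'.+1 -> seq S).
Notation b := b'.+1.
Notation N := N'.+1.
Notation B := (seqT (ord0 : 'I_b)).
Hypothesis v_inj : injective v.
Hypothesis v_size : forall d, size (v d) = N.
Hypothesis v_loop : forall d, isloop edge a (v d).

Definition concat (w : B) : T := fun i => nth a (v (w (i %/ N)%N)) (i %% N)%N.

Lemma concat_measurable : measurable_fun setT concat.
Proof.
apply: (@measurability _ _ B T setT _ (@cyl_sets S a)) => // _ [_ [n [w ->]] <-].
rewrite setTI; apply: (@rdet_measurable _ _ n) => x y xy /= h i ni.
by rewrite -h // /concat xy // (leq_ltn_trans (leq_div _ _)).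
Qed.

Lemma iter_concat q (w : B) : iter (q * N) sh (concat w) = concat (iter q (@Defs.shift 'I_b) w).
Proof.
by apply/funext => i; rewrite iter_shiftE /concat divnMDl // modnMDl iter_shiftE.
Qed.

Lemma nth_head d : nth a (v d) 0 = a.
Proof. by rewrite nth0; have /andP[_ /eqP] := v_loop d. Qed.

Lemma concat_agree w : agree (N + 1) (concat w) (per a (v (w 0%N))).
Proof.
move=> i; rewrite addn1 ltnS leq_eqVlt /per v_size /concat => /predU1P[->|iN].
  by rewrite modnn !nth_head.
by rewrite divn_small.
Qed.

Let v_nil d : v d != [::].
Proof. by rewrite -size_eq0 v_size. Qed.

Lemma concat_Sigma w : Sigma edge (concat w).
Proof.
move=> i; have iN : (i %% N < N)%N by rewrite ltn_pmod.
rewrite (divn_eq i N) -addnS -!iter_shiftE iter_concat.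
rewrite !concat_agree ?addn1 ?ltnS // 1?ltnW //.
exact: (per_Sigma (v_nil _) (v_loop _)).
Qed.

Definition symbol (x : T) : 'I_b := odflt ord0 [pick d | mkseq x N == v d].

Lemma symbol_partition : is_fin_partition symbol.
Proof.
move=> d; apply: (@rdet_measurable _ _ N) => x y xy /= <-.
rewrite /symbol; have -> // : mkseq x N = mkseq y N.
by apply/eq_in_map => i; rewrite mem_iota => /= iN; exact: xy.
Qed.

Lemma symbol_concat w : symbol (concat w) = w 0%N.
Proof.
rewrite /symbol (_ : mkseq _ _ = v (w 0%N)).
  by case: pickP => [d /eqP /v_inj //|/(_ (w 0%N))]; rewrite eqxx.
apply: (@eq_from_nth _ a); rewrite size_mkseq ?v_size // => i iN.
by rewrite nth_mkseq // /concat divn_small // modn_small.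
Qed.

Section Measure.
Variables (m : {measure set B -> \bar R}) (mu : probability T R).
Hypothesis m1 : m setT = 1%E.
Hypothesis m_inv : forall A : set B, measurable A -> m (@Defs.shift 'I_b @^-1` A) = m A.
Hypothesis m_cyl : forall n (w : nat -> 'I_b),
  m [set x | forall i, (i < n)%N -> x i = w i] = ((b%:R ^- n)%:E)%E.
Hypothesis mu_inv : forall A : set T, measurable A -> mu (sh @^-1` A) = mu A.
Hypothesis mu_le : forall (A : set T) (c : R), measurable A ->
  (forall j, (j < N)%N -> (m ((fun w => iter j sh (concat w)) @^-1` A) <= c%:E)%E) -> (mu A <= c%:E)%E.
Hypothesis mu_full : forall A : set T, measurable A ->
  (forall w j, (j < N)%N -> A (iter j sh (concat w))) -> mu A = 1%E.

Lemma concat_mu_Sigma : mu (Sigma edge) = 1%E.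
Proof.
apply: mu_full => [|w j _]; first exact: Sigma_measurable.
exact: Sigma_iter_shift (concat_Sigma w).
Qed.

Lemma itinerary_law_le n u : law mu (itinerary symbol n.+1) u <= b%:R ^- (n %/ N).
Proof.
have mI := @itinerary_meas _ _ _ _ symbol_partition n.+1 u.
rewrite -lee_fin -lawE //; last exact: (itinerary_meas symbol_partition).
apply: mu_le => // j jN.
pose C : set B := [set x | forall i, (i < n %/ N)%N -> x i = u (inord (i.+1 * N - j))].
have mC : measurable C by apply: cyl_measurable.
rewrite -(m_cyl (n %/ N) (fun i => u (inord (i.+1 * N - j)))) -(m_inv mC).
apply: le_measure; rewrite ?inE.
- rewrite -[X in measurable X]setTI.
  exact: (measurableT_comp (iter_shift_measurable (a := a) j) concat_measurable) mI.
- rewrite -[X in measurable X]setTI; exact: (@shift_measurable _ (ord0 : 'I_b)).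
move=> w /= e i iq.
have jiN : (j <= i.+1 * N)%N by rewrite (leq_trans (ltnW jN)) // mulSn leq_addr.
have lt : (i.+1 * N - j < n.+1)%N.
  rewrite ltnS (leq_trans (leq_subr _ _)) // (leq_trans _ (leq_trunc_div n N)) //.
  by rewrite leq_mul2r iq orbT.
rewrite -e ffunE inordK // -iterD subnK // iter_concat symbol_concat.
by rewrite iter_shiftE addn0.
Qed.

Lemma concat_entropy : ln b%:R / N%:R <= hpart mu symbol.
Proof.
have b0 : 0 <= ln b%:R :> R by rewrite ln_ge0 // ler1n.
have H1 n : (n %/ N)%:R * ln b%:R <= Hjoin mu symbol n.+1.
  rewrite HjoinE.
  have -> : (n %/ N)%:R * ln b%:R =
     \sum_w law mu (itinerary symbol n.+1) w * ((n %/ N)%:R * ln b%:R) :> R.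
    by rewrite -mulr_suml sum_law ?mul1r //; exact: (itinerary_meas symbol_partition).
  apply: ler_sum => u _; have := @law_ge0 _ _ _ mu _ (itinerary symbol n.+1) u.
  rewrite le_eqVlt => /predU1P[<-|p0]; first by rewrite /entf !mul0r oppr0.
  rewrite /entf -mulrN ler_pM2l // lerNr.
  have := itinerary_law_le u; rewrite -ler_ln ?posrE ?invr_gt0 ?exprn_gt0 ?ltr0n //.
  by rewrite lnV ?posrE ?exprn_gt0 ?ltr0n // lnXn ?ltr0n // mulr_natl.
have [_ H2] := hpart_spec mu_inv symbol_partition.
rewrite ler_pdivrMr ?ltr0n // mulrC.
apply/ler_addgt0Pr => e e0; have eN : 0 < e / N%:R by rewrite divr_gt0 // ltr0n.
have [K HK] := H2 _ eN.
pose h := hpart mu symbol.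
suff : ln b%:R * K.+1%:R <= (N%:R * h + e) * K.+1%:R by rewrite ler_pM2r ?ltr0n.
apply: (@le_of_affine _ _ _ (h + e / N%:R)) => k k0.
have Kk : (K <= (k * K.+1 * N).+1)%N.
  rewrite ltnW // ltnS (leq_trans (leqnSn K)) // -[leqLHS]mul1n -[leqLHS]muln1.
  by rewrite !leq_mul.
have := H1 (k * K.+1 * N)%N; rewrite mulnK // => /le_trans /(_ (HK _ Kk)).
rewrite -/h (_ : (k * K.+1 * N).+1%:R = k%:R * K.+1%:R * N%:R + 1); last first.
  by rewrite -[LHS]natr1 !natrM.
rewrite natrM mulrDr mulr1.
have -> : ln b%:R * K.+1%:R * k%:R = k%:R * K.+1%:R * ln b%:R :> R by ring.
have -> : (h + e / N%:R) * (k%:R * K.+1%:R * N%:R) = (N%:R * h + e) * K.+1%:R * k%:R.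
  have key (x y z w t : R) : z != 0 -> (x + t / z) * (y * w * z) = (z * x + t) * w * y by move=> z0; field.
  by rewrite key // pnatr_eq0.
by [].

Qed.

Section Integral.
Variables (A th M c : R) (f : (nat -> S) -> R).
Hypothesis th01 : 0 < th < 1.
Hypothesis A0 : 0 <= A.
Hypothesis fA : var_holder edge A th f.
Hypothesis fM : forall x, Sigma edge x -> f x <= M.
Hypothesis fc : forall d, c <= birk f N (per a (v d)).
Let D := A / (1 - th).
Let bd := `|c| + D + N%:R * `|M| + `|M|.

Let D0 : 0 <= D.
Proof. by rewrite /D divr_ge0 // subr_ge0; case/andP: th01 => _ /ltW. Qed.

Lemma birk_concat w : c - D <= birk f N (concat w).
Proof.
have := birk_distortion th01 A0 fA (n := N) (l := 1) isT (concat_Sigma w)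
  (per_Sigma (v_nil _) (v_loop _)) (concat_agree w).
rewrite expr1 -/D ler_norml => /andP[h _]; have := fc (w 0%N).
have : D * th <= D by rewrite ler_piMr //; case/andP: th01 => _ /ltW.
move: h; lra.
Qed.

Lemma birk_concat_mul K w : K%:R * (c - D) <= birk f (K * N) (concat w).
Proof.
elim: K w => [|K IH] w; first by rewrite mul0r /birk big_ord0.
rewrite mulSn birkD -[X in iter X _]mul1n iter_concat -natr1 mulrDl mul1r addrC.
by rewrite lerD // birk_concat.
Qed.

Lemma concat_bounded w j : `|f (iter j sh (concat w))| <= bd.
Proof.
rewrite (divn_eq j N) addnC iterD iter_concat; move: (iter _ _ w) (j %% N)%N (ltn_pmod j (isT : 0 < N)%N) => {}w i iN.
have sS l := Sigma_iter_shift l (concat_Sigma w).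
have le_f l : f (iter l sh (concat w)) <= `|M| by rewrite (le_trans (fM _)) // ler_norm.
have h : c - D <= f (iter i sh (concat w)) + N%:R * `|M|.
  apply: (le_trans (birk_concat w)); rewrite /birk (bigD1 (Ordinal iN)) //= lerD2l.
  apply: (@le_trans _ _ (\sum_(k < N | k != Ordinal iN) `|M|)); first by apply: ler_sum.
  apply: (@le_trans _ _ (\sum_(k < N) `|M|)).
    by rewrite [leRHS](bigD1 (Ordinal iN)) //= lerDr.
  by rewrite sumr_const card_ord mulr_natl.
have := le_f i; have := normr_ge0 M; have : 0 <= N%:R * `|M| by rewrite mulr_ge0.
have := D0; have := ler_norm (- c); rewrite normrN ler_norml /bd; have := normr_ge0 c.
move: h; move: (N%:R * `|M|) => z; lra.
Qed.

Lemma concat_Pmu : (((ln b%:R + c - D) / N%:R)%:E <= Pmu edge f mu)%E.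
Proof.
have mS := Sigma_measurable (a := a) edge.
have bd0 : 0 <= bd by apply: le_trans (concat_bounded (fun=> ord0) 0).
pose G : set T := Sigma edge `&` (f : T -> R) @^-1` [set` `[- bd, bd]].
have mf := continuous_measurable (a := a) th01 fA.
have mG : measurable G by apply: mf.
have GC w j : G (iter j sh (concat w)).
  split; first exact: Sigma_iter_shift (concat_Sigma w).
  by rewrite /= in_itv /= -ler_norml; exact: concat_bounded.
have G1 : mu G = 1%E by apply: mu_full => // w j _; exact: GC.
pose u : T -> R := (f : T -> R) \_ G.
have uG x : G x -> u x = f x by move=> Gx; rewrite /u patchE mem_set.
have ub x : `|u x| <= bd.
  rewrite /u patchE; case: ifPn => [/set_mem[_]|_]; last by rewrite normr0.
  by rewrite /= in_itv /= -ler_norml.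
have mu_ : measurable_fun setT u.
  by apply/(measurable_restrictT _ mG); apply: measurable_funS mf => // x [].
have iu : integ mu u.
  apply: (le_integrable measurableT _ _ (integ_cst mu bd)).
    exact/measurable_EFinP.
  by move=> x _ /=; rewrite lee_fin (ger0_norm bd0).
have Eu : (\int[mu]_(x in Sigma edge) (f x)%:E = (Ex mu u)%:E)%E.
  have nG : mu (~` G) = 0%E by rewrite probability_setC // G1 subee.
  have SG : Sigma edge `\` ~` G = G by rewrite setDE setCK; apply/setIidr => x [].
  have mfE : measurable_fun (Sigma edge : set T) (fun x : T => (f x)%:E).
    by apply/measurable_EFinP.
  rewrite (negligible_integral (measurableC mG)) //; last first.
    apply/(negligible_integrable (measurableC mG)) => //; rewrite SG.
    apply: (eq_integrable mG (EFin \o u)); last exact: integrableS iu.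
    by move=> x /set_mem Gx /=; rewrite uG.
  rewrite SG.
  rewrite integral_mkcond /Ex /Rintegral fineK; last exact: integrable_fin_num.
  by apply: eq_integral => x _; rewrite /u /= !patchE; case: ifP.
have Ec : (c - D) / N%:R <= Ex mu u.
  rewrite ler_pdivrMr ?ltr0n //; apply: (@le_of_affine _ _ _ (2 * N%:R * bd)) => K K0.
  pose Fu i (x : T) := u (iter i sh x).
  have iF i : integ mu (Fu i) by have [] := Ex_shift mu_inv i iu.
  have [iB EB] := Ex_sum (K * N) iF.
  have EF i : Ex mu (Fu i) = Ex mu u by have [] := Ex_shift mu_inv i iu.
  rewrite (eq_bigr (fun=> Ex mu u)) // sumr_const card_ord in EB.
  have -> : Ex mu u * N%:R * K%:R = Ex mu (fun x => \sum_(i < K * N) Fu i x).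
    by rewrite EB -(mulr_natr (Ex mu u)) natrM mulrA mulrAC.
  pose Q : set T := [set x | (c - D) * K%:R - 2 * N%:R * bd <= \sum_(i < K * N) Fu i x].
  have mQ : measurable Q.
    have mB : measurable_fun setT (fun x => \sum_(i < K * N) Fu i x).
      by apply/measurable_EFinP; case/integrableP: iB.
    rewrite (_ : Q = [set: T] `&` (fun x => \sum_(i < K * N) Fu i x) @^-1`
      `[(c - D) * K%:R - 2 * N%:R * bd, +oo[%classic); first exact: mB.
    by rewrite setTI; apply/seteqP; split => z; rewrite /Q /= in_itv /= andbT.
  have Q1 : mu Q = 1%E.
    apply: mu_full => // w j jN; rewrite /Q /=.
    rewrite (eq_bigr (fun i : 'I_(K * N) => f (iter i sh (iter j sh (concat w))))); last first.
      by move=> i _; rewrite /Fu -iterD uG //; exact: GC.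
    rewrite -/(birk f (K * N) (iter j sh (concat w))).
    have e : birk f j (concat w) + birk f (K * N) (iter j sh (concat w)) =
             birk f (K * N) (concat w) + birk f j (iter (K * N) sh (concat w)).
      by rewrite -!birkD addnC.
    have sb q : `|birk f j (iter q sh (concat w))| <= N%:R * bd.
      apply: (le_trans (ler_norm_sum _ _ _)).
      apply: (@le_trans _ _ (\sum_(k < j) bd)).
        by apply: ler_sum => i _; rewrite -iterD; exact: concat_bounded.
      by rewrite sumr_const card_ord -(mulr_natl bd) ler_wpM2r // ler_nat ltnW.
    have key (x1 y1 z t k b1 : R) : `|x1| <= b1 -> `|y1| <= b1 -> x1 + z = t + y1 -> k <= t -> k - 2 * b1 <= z.
      by rewrite !ler_norml => /andP[? ?] /andP[? ?]; lra.
    rewrite mulrC -mulrA; apply: key (sb 0%N) (sb (K * N)%N) e (birk_concat_mul K w).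
  have := le_Ex_ae (D := Q) (u := fun=> (c - D) * K%:R - 2 * N%:R * bd) mQ Q1 (integ_cst mu _) iB (fun x h => h).
  by rewrite Ex_cst; lra.
rewrite /Pmu Eu; apply: (@le_trans _ _ ((hpart mu symbol)%:E + (Ex mu u)%:E)%E).
  by rewrite -EFinD lee_fin -addrA mulrDl; apply: lerD Ec; exact: concat_entropy.
apply: leeD => //; apply: ereal_sup_ubound; exists b, symbol; split => //; exact: symbol_partition.
Qed.

End Integral.
End Measure.

Theorem loop_measure (A th M c : R) (f : (nat -> S) -> R) : 0 < th < 1 -> 0 <= A ->
  var_holder edge A th f -> (forall x, Sigma edge x -> f x <= M) ->
  (forall d, c <= birk f N (per a (v d))) ->
  exists2 mu : probability T R, invariant_prob edge mu &
    (((ln b%:R + c - A / (1 - th)) / N%:R)%:E <= Pmu edge f mu)%E.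
Proof.
move=> th01 A0 fA fM fc; have [m [m1 mC mI]] := bernoulli_measure R b'.
have cN w : iter N sh (concat w) = concat (@Defs.shift 'I_b w).
  by rewrite -[N in LHS]mul1n iter_concat.
have [mu [muI mu_le mu_full]] := tower_measure m1 mI concat_measurable cN.
exists mu; first by split; [exact: (concat_mu_Sigma mu_full)|exact: muI].
exact: (concat_Pmu mI mC muI mu_le mu_full th01 A0 fA fM fc).
Qed.

End LoopMeasure.

Section Selection.
Variables (R : realType) (T : eqType) (y : T -> R).
Implicit Types (s t : seq T).

Definition level_le s (B : R) : Prop := forall t c, uniq t -> {subset t <= s} -> 0 < c ->
  (forall v, v \in t -> c <= y v) -> (size t)%:R * c <= B.

Lemma seq_min s : s != [::] -> exists2 x, x \in s & forall v, v \in s -> y x <= y v.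
Proof.
elim: s => // x [|z s] IH _; first by exists x; rewrite ?mem_head // => v; rewrite inE => /eqP ->.
have [m ms H] := IH isT; have [xm|mx] := leP (y x) (y m).
  exists x; rewrite ?mem_head // => v; rewrite inE => /predU1P[-> //|/H].
  exact: le_trans.
exists m; first by rewrite inE ms orbT.
by move=> v; rewrite inE => /predU1P[->|/H //]; exact: ltW.
Qed.

Lemma level_sum n s B : size s = n.+1 -> uniq s -> (forall v, v \in s -> 0 < y v) ->
  level_le s B -> \sum_(v <- s) y v <= B * (1 + ln n.+1%:R).
Proof.
elim: n s => [|n IH] s sn us y0 H.
all: have [|x xs xmin] := seq_min (s := s); first by rewrite -size_eq0 sn.
all: have xB := H s (y x) us (fun _ => id) (y0 x xs) xmin; rewrite sn in xB.
all: rewrite (perm_big _ (perm_to_rem xs)) big_cons /=.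
  have -> : rem x s = [::] by apply: size0nil; rewrite size_rem // sn.
  by rewrite big_nil addr0 ln1 addr0 mulr1; move: xB; rewrite mul1r.
have sub : {subset rem x s <= s} by exact: mem_rem.
have := IH (rem x s); rewrite size_rem // sn rem_uniq // => /(_ erefl isT).
have yr v : v \in rem x s -> 0 < y v by move=> /sub /y0.
move=> /(_ yr) => {}IH; have {IH} := IH (fun t c ut ts => H t c ut (fun v h => sub v (ts v h))).
have n1 : 0 < n.+1%:R :> R by rewrite ltr0n.
have n2 : 0 < n.+2%:R :> R by rewrite ltr0n.
have := ln_le_sub1 (divr_gt0 n1 n2); rewrite ln_div ?posrE //.
have -> : n.+1%:R / n.+2%:R - 1 = - n.+2%:R^-1 :> R.
  have key (x0 : R) : 0 < x0 + 1 -> x0 / (x0 + 1) - 1 = - (x0 + 1)^-1.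
    by move=> h; field; rewrite gt_eqF.
  by rewrite -[n.+2%:R]natr1 key // natr1.
have yx : y x <= B * n.+2%:R^-1 by rewrite ler_pdivlMr // mulrC.
have B0 : 0 <= B by apply: le_trans xB; rewrite mulr_ge0 ?ltW // y0.
move: yx; move: (ln _) (ln _) (n.+2%:R^-1) => p q r yx pq; nra.
Qed.

(* Among the super-level sets of [y], one carries a proportion [1 / log (size s)]
   of the sum, because the harmonic series grows logarithmically. *)
Lemma level_selection s : s != [::] -> uniq s -> (forall v, v \in s -> 0 < y v) ->
  exists t c, [/\ uniq t, {subset t <= s}, 0 < c, forall v, v \in t -> c <= y v &
    \sum_(v <- s) y v <= 2 * ((size t)%:R * c) * (1 + ln (size s)%:R)].
Proof.
move=> s0 us y0; apply: contrapT => H.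
have [n sn] : exists n, size s = n.+1 by case: (s) s0 => // x s' _; exists (size s').
have L0 : 0 < 1 + ln (size s)%:R :> R.
  by rewrite sn ltr_pwDl // ln_ge0 // ler1n.
have S0 : 0 < \sum_(v <- s) y v.
  case: (s) s0 y0 => // x s' _ y0; rewrite big_cons ltr_pwDl ?y0 ?mem_head //.
  by rewrite big_seq; apply: sumr_ge0 => v vs; rewrite ltW // y0 // inE vs orbT.
pose B := (\sum_(v <- s) y v) / (2 * (1 + ln (size s)%:R)).
have : level_le s B.
  move=> t c ut ts c0 tc; rewrite leNgt; apply/negP => h; apply: H; exists t, c; split => //.
  move: h; rewrite /B ltr_pdivrMr ?mulr_gt0 // => /ltW /le_trans; apply.
  by rewrite le_eqVlt; apply/orP; left; apply/eqP; ring.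
move=> /(level_sum sn us y0); rewrite -sn /B.
have -> : (\sum_(v <- s) y v) / (2 * (1 + ln (size s)%:R)) * (1 + ln (size s)%:R) =
          (\sum_(v <- s) y v) / 2 by field; rewrite gt_eqF.
by move: S0; lra.
Qed.

End Selection.

Section ApproximatePressure.
Variables (S : countType) (edge : S -> S -> bool) (R : realType) (a : S) (p : nat).
Hypothesis period_p : is_period edge a p.
Hypothesis ent : (PG edge (fun=> 0%R : R) p a < +oo)%E.
Variables (A th M : R) (f : (nat -> S) -> R).
Hypothesis th01 : 0 < th < 1.
Hypothesis A0 : 0 <= A.
Hypothesis fA : var_holder edge A th f.
Hypothesis fM : forall x, Sigma edge x -> f x <= M.

Lemma nsum_finite_part (T : choiceType) (u : T -> R) (z : R) : (z%:E < nsum u)%E ->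
  exists2 s, uniq s & z < \sum_(v <- s) u v.
Proof.
move=> /ereal_sup_gt[_ [X [fX _] <-] h]; exists (finmap.enum_fset (fset_set X)).
  exact: finmap.fset_uniq.
by move: h; rewrite fsbig_finite //= sumEFin lte_fin.
Qed.

Lemma le_nsum_seq (T : choiceType) (u : T -> R) s : (forall i, 0 <= u i) -> uniq s ->
  ((\sum_(v <- s) u v)%:E <= nsum u)%E.
Proof.
move=> u0 us; apply: ereal_sup_ubound; exists [set` s] => //.
rewrite -sumEFin. by rewrite -(fsbig_seq _ _ us).
Qed.

Lemma loop_list n (z : R) : (0 < n)%N -> (z%:E < Zn edge f a n)%E -> 0 <= z ->
  exists2 s, [/\ s != [::], uniq s, {in s, forall v, isloop edge a v && (size v == n)} &
    z <= \sum_(v <- s) expR (birk f n (per a v))] &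
  ((size s)%:R%:E <= Zn edge (fun=> 0%R : R) a n)%E.
Proof.
move=> n0; rewrite !Zn_words // => /nsum_finite_part[s us zs] z0.
pose P v := isloop edge a v && (size v == n).
have e : \sum_(v <- s) (if P v then expR (birk f n (per a v)) else 0) =
  \sum_(v <- [seq v <- s | P v]) expR (birk f n (per a v)) by rewrite -big_mkcond big_filter.
have uf : uniq [seq v <- s | P v] by exact: filter_uniq.
exists [seq v <- s | P v].
  split => //; last by rewrite -e ltW.
    by apply/eqP => e0; move: zs; rewrite [X in _ < X]e e0 big_nil; lra.
  by move=> v; rewrite mem_filter => /andP[].
rewrite -sum1_size natr_sum; apply: le_trans (le_nsum_seq _ uf).
  rewrite lee_fin !big_seq; apply: ler_sum => v; rewrite mem_filter => /andP[Pv _].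
  by rewrite -/(P v) Pv /birk big1 // expR0.
by move=> v; case: ifP => // _; exact: expR_ge0.
Qed.

Lemma approximate_pressure P : PG edge f p a = P%:E -> forall e : R, 0 < e ->
  exists2 mu : probability (seqT a) R, invariant_prob edge mu & ((P - e)%:E <= Pmu edge f mu)%E.
Proof.
move=> PE e' e'0; have [e e0 e3] : exists2 e, 0 < e & 2 * e = e' by exists (e' / 2); lra.
have p0 : (0 < p)%N by case: period_p.
have [P' [P'E _ Zlow _]] := pressure_value period_p ent th01 A0 fA fM.
have PP : P' = P by move: P'E; rewrite PE => -[].
rewrite {P'E}PP in Zlow *; have [N0 HN0] := Zlow _ e0.
have [h0 Hh0] := entropy_bound period_p ent.
pose h := Num.max h0 1; have h1 : 1 <= h by rewrite le_max lexx orbT.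
have Hh n : (0 < n)%N -> (Zn edge (fun=> 0%R : R) a (p * n) <= (expR (h * n%:R))%:E)%E.
  move=> /Hh0 /le_trans; apply; rewrite lee_fin ler_expR ler_wpM2r //.
  by rewrite le_max lexx.
(* [ln x <= d x - ln d - 1] makes the logarithmic loss affine with small slope *)
pose d := e / (2 * h); have d0 : 0 < d by rewrite divr_gt0 ?mulr_gt0 //; lra.
have lnaff (x : R) : 0 < x -> ln x <= d * x - ln d - 1.
  by move=> x0; have := ln_le_sub1 (mulr_gt0 d0 x0); rewrite lnM ?posrE //; lra.
pose D := A / (1 - th); pose Q := ln 4 + d - ln d - 1 + D.
pose n := (maxn N0 (Num.truncn (2 * `|Q| / e))).+1.
have nN : (N0 <= n)%N by rewrite ltnW // ltnS leq_maxl.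
have nQ : 2 * Q <= e * n%:R.
  have : 2 * `|Q| / e <= n%:R.
    rewrite (le_trans (ltW (truncnS_gt _))) // ler_nat ltnS leq_maxr //.
  rewrite ler_pdivrMr // [_ * e]mulrC; apply: le_trans.
  by rewrite ler_pM2l // ler_norm.
have pn0 : (0 < p * n)%N by rewrite muln_gt0 p0.
pose z := expR ((P - e) * (p * n)%:R) / 2.
have z0 : 0 < z by rewrite divr_gt0 // expR_gt0.
have [||s [s0 us sl zs] ssz] := loop_list (n := p * n) (z := z) pn0.
- apply: lt_le_trans (HN0 n nN); rewrite lte_fin /z.
  by have := expR_gt0 ((P - e) * (p * n)%:R); lra.
- exact: ltW.
have := level_selection (y := fun v => expR (birk f (p * n) (per a v))) s0 us (fun v _ => expR_gt0 _).
move=> [t [c [ut ts c0 tc H]]].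
have s1 : 1 <= (size s)%:R :> R by rewrite ler1n lt0n size_eq0.
have ls : ln (size s)%:R <= h * n%:R :> R.
  rewrite -[leRHS]expRK ler_ln ?posrE ?expR_gt0 // ?(lt_le_trans _ s1) //.
  by rewrite -lee_fin; apply: le_trans ssz (Hh n isT).
have ls0 : 0 <= ln (size s)%:R :> R by rewrite ln_ge0.
have t0 : (0 < size t)%N.
  rewrite lt0n; apply/eqP => t0; move: H; rewrite t0 mul0r mulr0 mul0r.
  by move: z0 zs; lra.
have [N' eN] : exists N', (p * n)%N = N'.+1 by exists (p * n).-1; rewrite prednK.
have [b' eb] : exists b', size t = b'.+1 by exists (size t).-1; rewrite prednK.
pose v (i : 'I_b'.+1) := nth [::] t i.
have vt i : v i \in t by rewrite mem_nth // eb.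
have vP i : isloop edge a (v i) && (size (v i) == (p * n)%N) by apply: sl; exact: ts.
have v_inj : injective v.
  by move=> i j /eqP; rewrite nth_uniq ?eb // => /eqP /val_inj.
have v_size i : size (v i) = N'.+1 by case/andP: (vP i) => _ /eqP ->.
have v_loop i : isloop edge a (v i) by case/andP: (vP i).
have fc i : ln c <= birk f N'.+1 (per a (v i)).
  by rewrite -ler_expR lnK ?posrE // -eN; exact: tc.
have [mu muI muP] := loop_measure v_inj v_size v_loop th01 A0 fA fM fc.
exists mu => //; apply: le_trans muP; rewrite lee_fin ler_pdivlMr ?ltr0n // -eN -eb -/D.
have b0 : 0 < (size t)%:R :> R by rewrite ltr0n.
have L : (P - e) * (p * n)%:R - ln 4 <= ln (size t)%:R + ln c + ln (1 + h * n%:R).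
  have hn0 : 0 < 1 + h * n%:R by rewrite (lt_le_trans ltr01) // lerDl; lra.
  rewrite -!lnM ?posrE ?mulr_gt0 // -[X in X - _]expRK -ln_div ?posrE ?expR_gt0 //.
  rewrite ler_ln ?posrE ?mulr_gt0 ?divr_gt0 ?expR_gt0 //.
  have : z <= 2 * ((size t)%:R * c) * (1 + h * n%:R).
    apply: (le_trans zs); apply: (le_trans H); rewrite ler_wpM2l ?lerD2l //.
    by rewrite !mulr_ge0 // ltW.
  by rewrite /z ler_pdivrMr // ler_pdivrMr //; lra.
have hn0 : 0 < 1 + h * n%:R by rewrite (lt_le_trans ltr01) // lerDl; lra.
have := lnaff _ hn0.
have -> : d * (1 + h * n%:R) = d + e * n%:R / 2 by rewrite /d; field; rewrite gt_eqF //; lra.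
have : e * n%:R <= e * (p * n)%:R by rewrite ler_pM2l // ler_nat leq_pmull.
have -> : P - e' = P - e - e by rewrite -e3; ring.
rewrite [(P - e - e) * _]mulrBl.
move: L nQ; rewrite /Q; move: ((P - e) * _) (ln _) (ln _) (ln _) (ln _) => x1 x2 x3 x4 x5.
move: (e * _) (e * _) => x6 x7; lra.
Qed.

End ApproximatePressure.

(** * Square-root stability *)

Section FreeEnergy.
Variables (S : countType) (edge : S -> S -> bool) (R : realType) (a : S).
Notation T := (seqT a).
Variable mu : probability T R.
Hypothesis mu_prob : invariant_prob edge mu.
Variables (A th M : R) (f : (nat -> S) -> R).
Hypothesis th01 : 0 < th < 1.
Hypothesis A0 : 0 <= A.
Hypothesis fA : var_holder edge A th f.
Hypothesis fM : forall x, Sigma edge x -> f x <= M.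

Let mS : measurable (Sigma edge : set T). Proof. exact: Sigma_measurable. Qed.

Let mf : measurable_fun (Sigma edge : set T) (fun x : T => (f x)%:E).
Proof. by apply/measurable_EFinP; exact: (continuous_measurable th01 fA). Qed.

Lemma bounded_integrable (g : (nat -> S) -> R) (B c : R) : var_holder edge B th g ->
  (forall x, Sigma edge x -> `|g x| <= c) ->
  mu.-integrable (Sigma edge : set T) (EFin \o (g : T -> R)).
Proof.
move=> gB gc.
have ic : mu.-integrable (Sigma edge : set T) (EFin \o (fun=> `|c|)).
  by apply: integrableS (integ_cst mu `|c|).
apply: (le_integrable mS _ _ ic).
  by apply/measurable_EFinP; exact: (continuous_measurable th01 gB).
by move=> x sx /=; rewrite lee_fin normr_id (le_trans (gc x sx)) // ler_norm.
Qed.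

Lemma Pmu_nonintegrable : ~ mu.-integrable (Sigma edge : set T) (EFin \o (f : T -> R)) ->
  Pmu edge f mu = -oo%E.
Proof.
move=> nint; rewrite /Pmu; set I := (\int[mu]_(x in _) _)%E.
suff -> : I = -oo%E by rewrite addeNy.
pose F : T -> \bar R := fun x => (f x)%:E.
have mFp : measurable_fun (Sigma edge : set T) F^\+%E by exact: measurable_funepos.
have mFn : measurable_fun (Sigma edge : set T) F^\-%E by exact: measurable_funeneg.
have fp : (\int[mu]_(x in Sigma edge) F^\+ x < +oo)%E.
  apply: (@le_lt_trans _ _ (\int[mu]_(x in Sigma edge) (cst `|M|%:E x))%E); last first.
    by rewrite integral_cst // ltey_eq fin_numM // fin_num_measure.
  apply: ge0_le_integral => //.
  move=> x sx; rewrite /F funeposE /= -EFin_max lee_fin ge_max normr_ge0 andbT.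
  by rewrite (le_trans (fM sx)) // ler_norm.
have fn : (\int[mu]_(x in Sigma edge) F^\- x = +oo)%E.
  apply: contrapT => h; apply: nint; apply/integrableP; split => //.
  rewrite (eq_integral (fun x => F^\+ x + F^\- x)%E); last first.
    by move=> x _; rewrite -[RHS]/((F^\+ \+ F^\-) x)%E -fune_abse.
  rewrite ge0_integralD //; try by move=> x _; rewrite ?funepos_ge0 ?funeneg_ge0.
  by rewrite lte_add_pinfty // lt_neqAle leey andbT; apply/eqP.
by rewrite /I integralE -/F fn; move: fp; case: (integral _ _ _).
Qed.

Section Integrable.
Variables (C s : R) (x0 : baseX edge a).
Hypothesis conn : strongly_connected edge.
Hypothesis C0 : 0 <= C.
Hypothesis growth : forall n, (loopsum edge a f 0%R n (sval x0) <= (C * expR (s * n%:R))%:E)%E.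
Hypothesis fint : mu.-integrable (Sigma edge : set T) (EFin \o (f : T -> R)).
Let I := (\int[mu]_(x in Sigma edge) (f x))%R.

Lemma entropy_le : (entropy mu <= (s - I)%:E)%E.
Proof.
apply: ge_ereal_sup => _ [k [g [pg ->]]]; rewrite lee_fin lerBrDr.
have [m1 mI] := mu_prob.
exact: (entropy_le_growth m1 mI conn th01 A0 fA C0 growth fM fint pg).
Qed.

Lemma entropy_fin_num : entropy mu \is a fin_num.
Proof.
rewrite fin_numE -ltNye -ltey (le_lt_trans entropy_le (ltry _)) andbT.
pose g (x : T) : 'I_1 := ord0.
have pg : is_fin_partition g.
  by move=> i; rewrite (_ : _ @^-1` _ = setT) //; apply/seteqP; split => // x _; rewrite /= (ord1 i).
apply: lt_le_trans (ltNyr (hpart mu g)) _.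
by apply: ereal_sup_ubound; exists 1%N, g.
Qed.

Lemma Pmu_integrable : Pmu edge f mu = (fine (entropy mu) + I)%:E.
Proof.
rewrite /Pmu EFinD (fineK entropy_fin_num) /I /Rintegral fineK //.
exact: (integrable_fin_num mS fint).
Qed.

Lemma free_energy_le : fine (entropy mu) + I <= s.
Proof. by rewrite -lerBrDr -lee_fin (fineK entropy_fin_num) entropy_le. Qed.

End Integrable.
End FreeEnergy.

Lemma slope_bound (R : realType) (K e1 x D : R) : 0 < K -> 0 < e1 -> 0 < D -> `|x| <= 2 ->
  (forall t, `|t| <= e1 -> t * x <= D + K * t ^+ 2) ->
  `|x| <= (2 * Num.sqrt K + 2 / (e1 * Num.sqrt K)) * Num.sqrt D.
Proof.
move=> K0 e10 D0 x2 H; set r := Num.sqrt K; set u := Num.sqrt D.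
have r0 : 0 < r by rewrite sqrtr_gt0.
have u0 : 0 < u by rewrite sqrtr_gt0.
have rK : K = r ^+ 2 by rewrite sqr_sqrtr // ltW.
have uD : D = u ^+ 2 by rewrite sqr_sqrtr // ltW.
have q0 : 0 <= 2 / (e1 * r) by rewrite divr_ge0 // mulr_ge0 // ltW.
have [h|h] := leP (u / r) e1; last first.
  apply: (le_trans x2); apply: (@le_trans _ _ (2 / (e1 * r) * u)); last first.
    by rewrite [leRHS]mulrDl lerDr !mulr_ge0 // ltW.
  rewrite [leRHS]mulrAC ler_pdivlMr ?mulr_gt0 // ler_pM2l //.
  by rewrite -ler_pdivlMr // ltW.
have ur0 : 0 <= u / r by rewrite divr_ge0 // ltW.
have key (y : R) : `|y| = 1 -> y * x <= 2 * r * u.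
  move=> y1; have := H (y * (u / r)); rewrite normrM y1 mul1r ger0_norm // => /(_ h).
  have y2 : y ^+ 2 = 1 by rewrite -real_normK ?num_real // y1 expr1n.
  have -> : D + K * (y * (u / r)) ^+ 2 = (2 * r * u) * (u / r).
    by rewrite !exprMn y2 mul1r rK uD; field; rewrite gt_eqF.
  have -> : y * (u / r) * x = y * x * (u / r) by ring.
  by rewrite ler_pM2r // divr_gt0.
have xb : `|x| <= 2 * r * u.
  rewrite ler_norml; have := key 1 (normr1 _); have := key (-1).
  by rewrite normrN1 mul1r mulN1r => /(_ erefl); lra.
by rewrite mulrDl ler_wpDr // mulr_ge0 // ltW.
Qed.

Lemma sqrt_shrink (R : realType) (c D x : R) : 0 < c -> 0 <= D ->
  (forall e, 0 < e <= 1 -> x <= c * (Num.sqrt (D + 2 * e) + Num.sqrt (2 * e))) ->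
  x <= c * Num.sqrt D.
Proof.
move=> c0 D0 H; apply/ler_addgt0Pr => h h0.
have [w w0 [w1 wh]] : exists2 w, 0 < w & w <= 1 /\ 2 * c * w <= h.
  exists (Num.min 1 (h / (2 * c))).
    by rewrite lt_min ltr01 divr_gt0 // mulr_gt0.
  split; first by rewrite ge_min lexx.
  by rewrite mulrC -ler_pdivlMr ?mulr_gt0 // ge_min lexx orbT.
have e01 : 0 < w ^+ 2 / 2 <= 1 by apply/andP; split; nra.
have := H _ e01; have -> : 2 * (w ^+ 2 / 2) = w ^+ 2 by field.
rewrite sqrtr_sqr ger0_norm ?(ltW w0) //.
have : Num.sqrt (D + w ^+ 2) <= Num.sqrt D + w.
  rewrite -[leRHS]ger0_norm ?addr_ge0 ?sqrtr_ge0 ?(ltW w0) // -sqrtr_sqr.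
  apply: ler_wsqrtr; rewrite sqrrD sqr_sqrtr // -addrA lerD2l lerDr.
  by rewrite mulrn_wge0 // mulr_ge0 ?sqrtr_ge0 // ltW.
move=> h1 /le_trans; apply.
apply: (@le_trans _ _ (c * (Num.sqrt D + 2 * w))); first by rewrite ler_pM2l //; lra.
by rewrite mulrDr lerD2l; lra.
Qed.

Section Stability.
Variables (S : countType) (edge : S -> S -> bool) (R : realType) (a : S) (p : nat).
Notation T := (seqT a).
Hypothesis conn : strongly_connected edge.
Hypothesis period_p : is_period edge a p.
Hypothesis ent : (PG edge (fun=> 0%R : R) p a < +oo)%E.
Variables (A th M : R) (f : (nat -> S) -> R).
Hypothesis th01 : 0 < th < 1.
Hypothesis A0 : 0 < A.
Hypothesis fA : var_holder edge A th f.
Hypothesis fM : forall x, Sigma edge x -> f x <= M.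
Hypothesis spr : SPR edge f p a.
Variable m : probability T R.
Hypothesis meq : equilibrium edge f m.

Let mS : measurable (Sigma edge : set T). Proof. exact: Sigma_measurable. Qed.
Let J (mu : probability T R) (g : (nat -> S) -> R) : R := (\int[mu]_(x in Sigma edge) (g x))%R.

Lemma normalized_stability : exists C P : R, [/\ 0 < C, PG edge f p a = P%:E,
  Pmu edge f m = P%:E &
  forall psi, (forall y, Sigma edge y -> `|psi y| <= 1) -> var_holder edge 1 th psi ->
  forall mu : probability T R, invariant_prob edge mu ->
  mu.-integrable (Sigma edge : set T) (EFin \o (f : T -> R)) ->
  exists2 d, 0 <= d & Pmu edge f mu = (P - d)%:E /\ `|J mu psi - J m psi| <= C * Num.sqrt d].
Proof.
have A0' := ltW A0.
have [P [PE [C C0 growth] _ _]] := pressure_value period_p ent th01 A0' fA fM.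
have [eps [M1 [eps0 M10 tail]]] := first_return_tail period_p ent th01 A0' fA fM spr PE.
have [x0] := base_inhabited period_p; have [w0] := first_inhabited period_p.
have [e1 [K [e10 K0 pert]]] := perturbed_growth w0 x0 th01 A0 fA C0 growth eps0 M10 tail.
have [minv mmax] := meq.
have mP e : 0 < e -> ((P - e)%:E <= Pmu edge f m)%E.
  move=> e0; have [mu muI h] := approximate_pressure period_p ent th01 A0' fA fM PE e0.
  exact: le_trans h (mmax _ muI).
have mint : m.-integrable (Sigma edge : set T) (EFin \o (f : T -> R)).
  apply: contrapT => h; have := mP 1 ltr01.
  by rewrite (Pmu_nonintegrable th01 fA fM h).
pose F (mu : probability T R) := fine (entropy mu) + J mu f.
have FP mu : invariant_prob edge mu ->
    mu.-integrable (Sigma edge : set T) (EFin \o (f : T -> R)) ->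
    Pmu edge f mu = (F mu)%:E /\ F mu <= P.
  move=> muI fi; split.
    exact: (Pmu_integrable muI th01 A0' fA fM conn C0 (growth x0) fi).
  exact: (free_energy_le muI th01 A0' fA fM conn C0 (growth x0) fi).
have [mF mFP] := FP m minv mint.
have FmP : F m = P.
  apply/eqP; rewrite eq_le mFP; apply/ler_addgt0Pr => e e0.
  by have := mP e e0; rewrite mF lee_fin; lra.
pose c := 2 * Num.sqrt K + 2 / (e1 * Num.sqrt K).
have r0 : 0 < Num.sqrt K by rewrite sqrtr_gt0.
have c0 : 0 < c by rewrite addr_gt0 ?divr_gt0 ?mulr_gt0.
exists c, P; split => //; first by rewrite mF FmP.
move=> psi psi1 psiA mu muI fi; have [muF muFP] := FP mu muI fi.
exists (P - F mu); first by rewrite subr_ge0.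
split; first by rewrite opprB addrCA subrr addr0.
apply: sqrt_shrink => //; first by rewrite subr_ge0.
move=> e e01; have e0 : 0 < e by case/andP: e01.
have [l l1 H] := pert psi psi1 psiA e e01.
have J1 (nu : probability T R) : invariant_prob edge nu -> `|J nu psi| <= 1.
  move=> [n1 _].
  have ip := bounded_integrable nu th01 psiA psi1.
  have ic r : nu.-integrable (Sigma edge : set T) (EFin \o (fun=> r)).
    by apply: integrableS (integ_cst nu r).
  have Jc r : (\int[nu]_(x in Sigma edge) r)%R = r by rewrite Rintegral_cst // (congr1 fine n1) mulr1.
  rewrite ler_norml; apply/andP; split.
    by rewrite -[leLHS]Jc; apply: le_Rintegral => // x /psi1; rewrite ler_norml => /andP[].
  by rewrite -[leRHS]Jc; apply: le_Rintegral => // x /psi1; rewrite ler_norml => /andP[].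
have slope (nu : probability T R) : invariant_prob edge nu ->
    nu.-integrable (Sigma edge : set T) (EFin \o (f : T -> R)) -> F nu <= P ->
    `|J nu psi - l| <= c * Num.sqrt (P - F nu + 2 * e).
  move=> nI ni nP; apply: slope_bound => //; first by rewrite ltr_wpDl ?subr_ge0 ?mulr_gt0.
    by rewrite (le_trans (ler_normB _ _)) // (le_trans (lerD (J1 nu nI) l1)) //; lra.
  move=> t te; have [C' C'0 gr] := H t te.
  have ip := bounded_integrable nu th01 psiA psi1.
  have gA := var_holderD t fA psiA.
  have B0 : 0 <= A + `|t| * 1 by rewrite addr_ge0 // mulr1.
  have gM x : Sigma edge x -> f x + t * psi x <= M + `|t|.
    move=> sx; rewrite lerD ?fM // (le_trans (ler_norm _)) // normrM ler_piMr // psi1 //.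
  have itp : nu.-integrable (Sigma edge : set T) (EFin \o (fun x : T => t * psi x)).
    rewrite (_ : EFin \o _ = (fun x => t%:E * (EFin \o (psi : T -> R)) x)%E).
      exact: integrableZl.
    by apply/funext => x /=; rewrite EFinM.
  have ig : nu.-integrable (Sigma edge : set T) (EFin \o (fun x : T => f x + t * psi x)).
    rewrite (_ : EFin \o _ = ((EFin \o (f : T -> R)) \+ (EFin \o (fun x : T => t * psi x)%R))%E).
      exact: integrableD.
    by apply/funext => x /=; rewrite EFinD.
  have := free_energy_le nI th01 B0 gA gM conn C'0 gr ig.
  rewrite RintegralD // RintegralZl // -/(J nu f) -/(J nu psi) /F.
  move: (K * t ^+ 2) (J nu f) (J nu psi) => k j j'; rewrite mulrBr; lra.
have h1 := slope mu muI fi muFP; have h2 := slope m minv mint mFP.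
rewrite FmP subrr add0r in h2.
rewrite mulrDr (_ : J mu psi - J m psi = (J mu psi - l) - (J m psi - l)); last by ring.
by apply: (le_trans (ler_normB _ _)); rewrite lerD.
Qed.

End Stability.

Section Norm.
Variables (S : countType) (edge : S -> S -> bool) (R : realType).

Lemma first_diff_exists (x y : nat -> S) : x <> y -> exists n, Defs.first_diff x y n.
Proof.
move=> xy; have [i xyi] : exists i, x i != y i.
  by apply: contrapT => h; apply: xy; apply/funext => i; apply/eqP/negP => /negP e; apply: h; exists i.
have ex : exists i, x i != y i by exists i.
exists (ex_minn ex); case: ex_minnP => n /eqP xn nmin; split => // j jn.
by apply/eqP; apply: contraTT jn => /nmin; rewrite -leqNgt.
Qed.

Lemma hnorm_bounds (beta th : R) (psi : (nat -> S) -> R) (x y : nat -> S) :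
  0 < beta -> 0 < th < 1 -> expR (- beta) <= th -> Sigma edge x -> Sigma edge y -> x <> y ->
  (hnorm edge beta psi < +oo)%E ->
  exists2 b, hnorm edge beta psi = b%:E & [/\ 0 <= b, forall z, Sigma edge z -> `|psi z| <= b &
    var_holder edge b th psi].
Proof.
move=> beta0 /andP[th0 th1] bth sx sy xy; rewrite /hnorm.
set s1 := ereal_sup _; set s2 := ereal_sup _ => fin.
have b1 z : Sigma edge z -> ((`|psi z|)%:E <= s1)%E.
  by move=> sz; apply: ereal_sup_ubound; exists z.
have b2 u w n : Sigma edge u -> Sigma edge w -> Defs.first_diff u w n ->
    ((`|psi u - psi w| * expR (beta * n%:R))%:E <= s2)%E.
  by move=> su sw uw; apply: ereal_sup_ubound; exists u, w, n.
have s10 : (0 <= s1)%E by apply: le_trans (b1 x sx); rewrite lee_fin.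
have s20 : (0 <= s2)%E.
  have [n xyn] := first_diff_exists xy; apply: le_trans (b2 x y n sx sy xyn).
  by rewrite lee_fin mulr_ge0 ?expR_ge0.
have f1 : s1 \is a fin_num.
  by rewrite ge0_fin_numE // (le_lt_trans _ fin) // leeDl.
have f2 : s2 \is a fin_num.
  by rewrite ge0_fin_numE // (le_lt_trans _ fin) // leeDr.
rewrite -(fineK f1) -(fineK f2) -EFinD; exists (fine s1 + fine s2) => //.
have r1 := fine_ge0 s10; have r2 := fine_ge0 s20; split; first by rewrite addr_ge0.
  by move=> z /b1; rewrite -(fineK f1) lee_fin => /le_trans; apply; rewrite lerDl.
move=> n u w n2 su sw uw.
have [->|/first_diff_exists[k uwk]] := pselect (u = w).
  by rewrite subrr normr0 mulr_ge0 ?addr_ge0 // exprn_ge0 // ltW.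
have nk : (n <= k)%N by rewrite leqNgt; apply/negP => /uw; case: uwk.
have := b2 u w k su sw uwk; rewrite -(fineK f2) lee_fin.
rewrite -ler_pdivlMr ?expR_gt0 // -expRN => /le_trans; apply.
apply: ler_pM => //; rewrite ?expR_ge0 //; first by rewrite lerDr.
rewrite -mulNr expRM_natr.
apply: (@le_trans _ _ (th ^+ k)); first by rewrite lerXn2r // nnegrE ?expR_ge0 // ltW.
by apply: ler_wiXn2l => //; exact: ltW.
Qed.

End Norm.

Section OnePoint.
Variables (S : countType) (edge : S -> S -> bool) (R : realType) (a : S).
Notation T := (seqT a).
Variables (mu nu : probability T R).
Hypothesis munu : forall A : set T, measurable A -> mu A = nu A.

Lemma Pmu_ext (f : (nat -> S) -> R) : Pmu edge f mu = Pmu edge f nu.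
Proof.
rewrite /Pmu; congr (_ + _)%E; last by apply: eq_measure_integral => A mA _; exact: munu.
rewrite /entropy; congr ereal_sup.
have h k (g : T -> 'I_k) : is_fin_partition g -> hpart mu g = hpart nu g.
  move=> pg; rewrite /hpart; under eq_fun do rewrite HjoinE.
  under [in RHS]eq_fun do rewrite HjoinE.
  by under eq_fun do under eq_bigr do rewrite /law (munu (itinerary_meas pg _)).
by apply/seteqP; split => e [k [g [pg ->]]]; exists k, g; rewrite h.
Qed.

End OnePoint.

Lemma one_point_unique (S : countType) (edge : S -> S -> bool) (R : realType) (a : S)
  (mu nu : probability (seqT a) R) (x : nat -> S) :
  Sigma edge x -> (forall y, Sigma edge y -> y = x) ->
  mu (Sigma edge) = 1%E -> nu (Sigma edge) = 1%E ->
  forall A : set (seqT a), measurable A -> mu A = nu A.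
Proof.
move=> sx xu mu1 nu1 A mA; have mS := Sigma_measurable (a := a) edge.
have [Ax|nAx] := pselect (A x).
  suff h (q : probability (seqT a) R) : q (Sigma edge) = 1%E -> q A = 1%E by rewrite !h.
  move=> q1; apply/eqP; rewrite eq_le probability_le1 //= -q1.
  by apply: le_measure; rewrite ?inE // => y /xu ->.
suff h (q : probability (seqT a) R) : q (Sigma edge) = 1%E -> q A = 0%E by rewrite !h.
move=> q1; apply/eqP; rewrite eq_le measure_ge0 andbT.
have <- : q (~` Sigma edge : set (seqT a)) = 0%E by rewrite probability_setC // q1 subee.
apply: le_measure; rewrite ?inE //; first exact: measurableC.
by move=> y Ay /xu e; apply: nAx; rewrite -e.
Qed.

Local Open Scope ereal_scope.

Theorem theorem7p3 (S : countType) (edge : S -> S -> bool) (R : realType)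
  (a : S) (p : nat) :
  strongly_connected edge ->
  is_period edge a p ->
  PG edge (fun _ => 0%R : R) p a < +oo ->
  forall (theta : R) (phi : (nat -> S) -> R),
  (0 < theta < 1)%R ->
  weakly_holder edge theta phi ->
  SPR edge phi p a ->
  (exists M : R, forall x, Sigma edge x -> (phi x <= M)%R) ->
  forall m : probability (seqT a) R, equilibrium edge phi m ->
  forall beta : R, (0 < beta)%R -> (expR (- beta) <= theta)%R ->
  exists C : R, (0 < C)%R /\
    forall psi : (nat -> S) -> R, hnorm edge beta psi < +oo ->
    forall mu : probability (seqT a) R, invariant_prob edge mu ->
      `| \int[mu]_(x in Sigma edge) (psi x)%:E - \int[m]_(x in Sigma edge) (psi x)%:E |
        <= (C%:E * hnorm edge beta psi) * sqrte (PG edge phi p a - Pmu edge phi mu).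
Proof.
move=> conn period_p ent theta phi th01 wh spr [M fM] m meq beta beta0 bth.
have th0 : (0 < theta)%R by case/andP: th01.
have [A A0 fA] := weakly_holderP th0 wh.
have [C [P [C0 PE mP H]]] := normalized_stability conn period_p ent th01 A0 fA fM spr meq.
exists C; split => // psi psifin mu muI; rewrite PE.
have mS := Sigma_measurable (a := a) edge.
have [mu1 _] := muI; have [[m1 _] _] := meq.
have [[x [y [sx [sy xy]]]]|one] := pselect (exists x y, Sigma edge x /\ Sigma edge y /\ x <> y);
    last first.
  have [x sx] : exists x, Sigma edge x.
    apply: contrapT => h; have := mu1; rewrite (_ : Sigma edge = set0) ?measure0.
      by move=> [] /eqP; rewrite eq_sym oner_eq0.
    by apply/seteqP; split => // x sx; apply: h; exists x.
  have xu y : Sigma edge y -> y = x.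
    by move=> sy; apply: contrapT => yx; apply: one; exists y, x.
  have eqm := one_point_unique sx xu mu1 m1.
  rewrite (Pmu_ext edge eqm) mP subee // sqrte0 mule0.
  rewrite (eq_measure_integral m); last by move=> B mB _; exact: eqm.
  rewrite (eq_integral (cst (psi x)%:E)); last by move=> z /set_mem /xu ->.
  have cE : (psi x)%:E * m (Sigma edge) = (psi x)%:E by rewrite -[RHS]mule1; congr (_ * _).
  by rewrite integral_cst // cE -EFinB subrr abse0.
have [b -> [b0 psib psih]] := hnorm_bounds beta0 th01 bth sx sy xy psifin.
have ints (nu : probability (seqT a) R) := bounded_integrable nu th01 psih psib.
have Eint (nu : probability (seqT a) R) : \int[nu]_(x in Sigma edge) (psi x)%:E =
    (\int[nu]_(x in Sigma edge) psi x)%R%:E.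
  by rewrite /Rintegral fineK //; exact: (integrable_fin_num mS (ints nu)).
rewrite !Eint -EFinB abse_EFin.
have [b00|b00] := eqVneq b 0%R.
  have z (nu : probability (seqT a) R) : (\int[nu]_(x in Sigma edge) psi x)%R = 0%R.
    rewrite (@eq_Rintegral _ _ _ nu _ (fun=> 0%R)).
      by rewrite Rintegral_cst // mul0r.
    move=> z /set_mem /psib; rewrite b00 normr_le0 => /eqP //.
  by rewrite !z subrr normr0 b00 mule0 mul0e.
have bgt0 : (0 < b)%R by rewrite lt_neqAle eq_sym b00.
pose psi' (z : nat -> S) := (b^-1 * psi z)%R.
have psi'1 z : Sigma edge z -> (`|psi' z| <= 1)%R.
  by move=> sz; rewrite normrM gtr0_norm ?invr_gt0 // ler_pdivrMl // mulr1 psib.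
have psi'h : var_holder edge 1 theta psi'.
  move=> n u w n2 su sw uw; rewrite -mulrBr normrM gtr0_norm ?invr_gt0 //.
  by rewrite ler_pdivrMl // mul1r; exact: psih.
have [fi|nfi] := pselect (mu.-integrable (Sigma edge : set (seqT a)) (EFin \o (phi : seqT a -> R)));
    last first.
  rewrite (Pmu_nonintegrable th01 fA fM nfi) /= -EFinM gt0_muley ?leey //.
  by rewrite lte_fin mulr_gt0.
have [d d0 [-> h]] := H psi' psi'1 psi'h mu muI fi.
rewrite -EFinB opprB addrCA subrr addr0 /= -!EFinM lee_fin.
have scale (nu : probability (seqT a) R) : (\int[nu]_(x in Sigma edge) psi' x =
    b^-1 * \int[nu]_(x in Sigma edge) psi x)%R by exact: RintegralZl mS (ints nu).
move: h; rewrite !scale -mulrBr normrM gtr0_norm ?invr_gt0 // ler_pdivrMl //.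
by rewrite mulrCA mulrA.
Qed.
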